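(* There exists $n_0$ such that, for all $n\ge n_0$, $E_n$ is the unique $n$-vertex graph (up to isomorphism) containing $m_e(n)$ induced even cycles.
   Context: All graphs are finite and simple. A cycle is even if it contains an even number of vertices. $m_e(n)$ denotes the maximum number of induced even cycles that can be contained in a graph on $n$ vertices. $N_B(x)$ denotes the neighbourhood of $x$ in $B$. A graph $B$ is a cyclic braid if there exist $k\ge 3$ and a partition $B_1,\dots,B_k$ of $V(B)$ such that for every $1\le i\le k$ and every $x\in B_i$ we have $B_{i-1}\cup B_{i+1}\subseteq N_B(x)\subseteq B_{i-1}\cup B_i\cup B_{i+1}$, indices modulo $k$. The sets $B_i$ are the clusters. A cyclic braid is empty if it has no edges inside its clusters. Two clusters are adjacent if every vertex of one is joined to every vertex of the other; a triple of clusters $A_1,A_2,A_3$ is consecutive if $A_1$ is adjacent to $A_2$ and $A_2$ is adjacent to $A_3$. $E_n$ is the empty cyclic braid on $n$ vertices whose clusters all have size 3 except for: - one cluster of size 4, when $n\equiv 1$ modulo 6; - two adjacent clusters of size 4, when $n\equiv 2$ modulo 6; - three consecutive clusters of size 2, when $n\equiv 3$ modulo 6; - two adjacent clusters of size 2, when $n\equiv 4$ modulo 6; - one cluster of size 2, when $n\equiv 5$ modulo 6. (When $n\equiv 0$ modulo 6 all clusters have size 3.) *)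

(* Defs.v *)
From mathcomp Require Import all_boot.

Set Implicit Arguments.
Unset Strict Implicit.
Unset Printing Implicit Defensive.

(* A graph on the finite vertex type V is its adjacency relation e : rel V. *)
Definition simple_graph (V : finType) (e : rel V) : bool :=
  [forall x, ~~ e x x] && [forall x, forall y, e x y == e y x].

Definition graph_iso (V W : finType) (e : rel V) (g : rel W) : Prop :=
  exists2 f : V -> W, bijective f & forall x y, g (f x) (f y) = e x y.

Definition nbhd (V : finType) (e : rel V) (x : V) : {set V} := [set y | e x y].

(* The adjacency of the cycle graph on 0, ..., m-1; ordS is the successor
   modulo m.  It is only meaningful as a simple graph for m >= 3. *)
Definition cycle_adj (m : nat) : rel 'I_m :=
  fun i j => (j == ordS i) || (i == ordS j).

(* The subgraph of e induced by S is isomorphic to the cycle on #|S| vertices. *)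
Definition induces_cycle (V : finType) (e : rel V) (S : {set V}) : bool :=
  (2 < #|S|) &&
  [exists f : {ffun 'I_#|S| -> V},
     [&& injectiveb f, f @: setT == S &
         [forall i, forall j, e (f i) (f j) == cycle_adj i j]]].

(* An induced subgraph is determined by its vertex set, so induced even cycles
   are counted by their vertex sets. *)
Definition nb_induced_even_cycles (V : finType) (e : rel V) : nat :=
  #|[set S : {set V} | induces_cycle e S && ~~ odd #|S|]|.

(* Up to isomorphism the vertex type is 'I_n; coding adjacency relations as sets
   of pairs makes the graphs on 'I_n range over a finite type. *)
Definition m_e (n : nat) : nat :=
  \max_(A : {set 'I_n * 'I_n} | simple_graph (fun x y => (x, y) \in A))
    nb_induced_even_cycles (fun x y => (x, y) \in A).

(* e is a cyclic braid with clusters B.  The partition has nonempty parts, and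
   injectivity of B makes its parts correspond to the k indices. *)
Definition cyclic_braid_with (V : finType) (e : rel V) (k : nat)
    (B : 'I_k -> {set V}) : Prop :=
  [/\ 3 <= k,
      injective B,
      partition [set B i | i : 'I_k] [set: V] &
      forall (i : 'I_k) (x : V), x \in B i ->
        (B (ord_pred i) :|: B (ordS i) \subset nbhd e x) /\
        (nbhd e x \subset B (ord_pred i) :|: B i :|: B (ordS i))].

Definition empty_clusters (V : finType) (e : rel V) (k : nat)
    (B : 'I_k -> {set V}) : Prop :=
  forall i x y, x \in B i -> y \in B i -> ~~ e x y.

Definition adjacent_clusters (V : finType) (e : rel V) (A1 A2 : {set V}) : Prop :=
  forall x y, x \in A1 -> y \in A2 -> e x y.

Definition consecutive_clusters (V : finType) (e : rel V)
    (A1 A2 A3 : {set V}) : Prop :=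
  adjacent_clusters e A1 A2 /\ adjacent_clusters e A2 A3.

Definition size_3_except (V : finType) (k : nat) (B : 'I_k -> {set V})
    (X : {set 'I_k}) (s : nat) : Prop :=
  forall i, #|B i| = if i \in X then s else 3.

Definition E_cluster_sizes (n : nat) (V : finType) (e : rel V) (k : nat)
    (B : 'I_k -> {set V}) : Prop :=
  match n %% 6 with
  | 0 => forall i, #|B i| = 3
  | 1 => exists a, size_3_except B [set a] 4
  | 2 => exists a b,
           [/\ a != b, adjacent_clusters e (B a) (B b) &
               size_3_except B [set a; b] 4]
  | 3 => exists a b c,
           [/\ uniq [:: a; b; c], consecutive_clusters e (B a) (B b) (B c) &
               size_3_except B [set a; b; c] 2]
  | 4 => exists a b,
           [/\ a != b, adjacent_clusters e (B a) (B b) &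
               size_3_except B [set a; b] 2]
  | _ => exists a, size_3_except B [set a] 2
  end.

(* e is (a copy of) the graph E_n. *)
Definition is_E (n : nat) (V : finType) (e : rel V) : Prop :=
  [/\ simple_graph e, #|V| = n &
      exists k (B : 'I_k -> {set V}),
        [/\ cyclic_braid_with e B, empty_clusters e B & E_cluster_sizes n e B]].

(* Main.v *)
Require Import Defs.
From mathcomp Require Import all_boot all_order all_algebra.
From mathcomp Require Import realalg.
From mathcomp Require Import ring lra zify.
From Stdlib Require Import Classical.

(* Let t be the cube root of 3.  Following induced paths from a vertex, every
   step removes the whole neighbourhood (of size d) of the current vertex from
   the available vertices, and d <= t ^ d with equality only for d = 3; hence an
   n-vertex graph has O(t ^ n) induced cycles.  In an extremal graph (which has
   at least 0.85 t ^ n of them) a vertex may be replaced by a twin of another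
   one, so every vertex lies in a positive proportion of the even cycles; this
   bounds the degrees.  The search tree of the induced paths between two
   adjacent vertices then has a positive density at some node, and below a node
   of nearly maximal density all steps have degree 3 and, by a pigeonhole
   argument on the few vertices that are ever wasted, the tree has the form of
   consecutive, completely joined clusters of size 3: the graph contains a long
   segment of a braid.  Almost all cycles cross this segment exactly once, so
   that counting them amounts to counting induced paths of a given parity
   between two vertices outside the segment.  A recursion on the first
   neighbourhood shows that the number of such paths is at most the largest
   product of an even number of parts, and is smaller by a constant factor
   unless the graph is a chain of completely joined clusters of optimal sizes.
   Thus an extremal graph is a cyclic braid up to edges inside the clusters;
   such an edge destroys three 4-cycles and creates at most two, so there is
   none.  All optimal sequences of cluster sizes give the same number of long
   cycles, and counting 4-cycles shows that the exceptional clusters must be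
   consecutive. *)

Set Implicit Arguments.
Unset Strict Implicit.
Unset Printing Implicit Defensive.

Import Order.TTheory GRing.Theory Num.Theory.
Local Open Scope ring_scope.

(** * Exponential estimates for the cube root of 3 *)

(** The estimate [d <= t ^ d] is lossless whenever all steps have degree 3, so it says nothing about
    how vertices met at different times are joined, and an extremal graph attains [t ^ n] only up to
    a constant factor. Structure therefore has to come from the waste. Giving a step of degree [d]
    the weight [(101 / 100) ^ |d - 3|] keeps the total below [t ^ n], so Markov's inequality makes
    heavy waste rare in any graph, with constants that do not depend on [n]. An edge from a late
    path vertex back to a discarded one costs nothing in this count, but shows up as waste when the
    same path is read from its other end; this is why good paths are those with little waste in both
    directions. The segment is needed to cut the cycles open: paths between two fixed vertices obey
    an exact recursion with the sharp constant [optval], cycles do not. The constant 0.85 is a lower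
    bound for [optval] over the six residues. All estimates take place in an Archimedean real field
    with a cube root of 3, eventually the real algebraic numbers. *)

Section CubeRoot.

Variables (R : realFieldType) (t : R).
Hypotheses (t_gt0 : 0 < t) (t3 : t ^+ 3 = 3).

Lemma t_bounds : 144 / 100 < t < 145 / 100.
Proof. by move: t_gt0 t3 => h h3; apply/andP; split; nra. Qed.

Lemma t2_bounds : 206 / 100 < t ^+ 2 < 209 / 100.
Proof. have /andP[] := t_bounds; move: t3 t_gt0 => ? ? ? ?; apply/andP; split; nra. Qed.

Lemma t_ge1 : 1 <= t.
Proof. by have /andP[] := t_bounds; lra. Qed.

(** The exponent is [|d - 3|] in truncated subtraction. Both sides are 3 at [d = 3]; beyond, the
    left side grows by at most [4 / 3 * 101 / 100 < 14 / 10 < t] per unit. *)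
Lemma loss_step (d : nat) :
  d%:R * (101 / 100) ^+ ((d - 3) + (3 - d)) <= t ^+ d.
Proof.
have /andP[t1 t1'] := t_bounds; have /andP[t2 t2'] := t2_bounds.
case: d => [|[|[|d]]] /=; rewrite ?expr0 ?mul0r //.
- rewrite expr1; lra.
- rewrite expr1; lra.
elim: d => [|d IH]; first by rewrite t3; lra.
rewrite [_ ^+ d.+4]exprS; apply: le_trans (_ : (14 / 10) * t ^+ d.+3 <= _); last first.
  by rewrite ler_wpM2r ?exprn_ge0 ?ltW //; lra.
apply: le_trans (_ : (14 / 10) * (d.+3%:R * (101 / 100) ^+ (d.+3 - 3 + (3 - d.+3))) <= _).
  have -> : (d.+4 - 3 + (3 - d.+4) = d.+1)%N by lia.
  have -> : (d.+3 - 3 + (3 - d.+3) = d)%N by lia.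
  rewrite exprS; set b := _ ^+ d; have b0 : 0 <= b by rewrite exprn_ge0 //; lra.
  have -> : d.+4%:R = d%:R + 4 :> R by rewrite -natrD; congr (_%:R); lia.
  have -> : d.+3%:R = d%:R + 3 :> R by rewrite -natrD; congr (_%:R); lia.
  have d0 : 0 <= d%:R :> R by rewrite ler0n.
  nra.
by rewrite ler_wpM2l //; lra.
Qed.

(** At [d = 3] both sides drop by [3 / 100] per mark to first order, which ties the weight
    [97 / 100] of a visited mark to the weight [99 / 100] of a consumed one. From [d = 4] on there
    is slack: already [d <= (99 / 100 * t) ^ d]. *)
Lemma mark_step (d j : nat) : (j <= d)%N ->
  d%:R - 3 / 100 * j%:R <= t ^+ d * (99 / 100) ^+ j.
Proof.
have /andP[t1 t1'] := t_bounds; have /andP[t2 t2'] := t2_bounds.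
have [|d_ge4] := leqP d 3.
  case: d => [|[|[|[|//]]]] _; case: j => [|[|[|[|//]]]] // _;
  rewrite ?expr0 ?expr1 ?mulr1 ?t3 ?exprS ?expr0; lra.
move=> jd; apply: le_trans (_ : d%:R <= _).
  by rewrite lerBlDr lerDl mulr_ge0 ?ler0n //; lra.
apply: le_trans (_ : t ^+ d * (99 / 100) ^+ d <= _); last first.
  rewrite ler_wpM2l ?exprn_ge0 ?(ltW t_gt0) // ler_wiXn2l //; lra.
have -> : d = (d - 4 + 4)%N by lia.
elim: (d - 4)%N => [|n IH].
  rewrite !exprS !expr0 !mulr1; nra.
rewrite addSn 2![_ ^+ _.+1]exprS mulrACA.
apply: le_trans (_ : (125 / 100) * (n + 4)%:R <= _).
  rewrite -addn1 !natrD; have : 0 <= n%:R :> R by rewrite ler0n.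
  lra.
apply: ler_pM => //; rewrite ?ler0n //; lra.
Qed.

(** The two factors [d] will stand for the choices of the two neighbours, on a cycle, of a vertex of
    degree [d]. *)
Lemma sq_le_tpow (d : nat) : d%:R ^+ 2 <= 5 * t ^+ d.
Proof.
have /andP[t1 t1'] := t_bounds; have /andP[t2 t2'] := t2_bounds.
have [|d_ge6] := leqP d 5.
  have t4 : t ^+ 4 = 3 * t by rewrite exprSr t3.
  have t5 : t ^+ 5 = 3 * t ^+ 2 by rewrite (exprD t 3 2) t3.
  by case: d => [|[|[|[|[|[|//]]]]]] _; rewrite ?t3 ?t4 ?t5 ?expr0 ?expr1; lra.
have -> : d = (d - 6 + 6)%N by lia.
elim: (d - 6)%N => [|n IH].
  by rewrite (exprM t 3 2) t3; lra.
rewrite addSn [t ^+ _.+1]exprS mulrCA.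
apply: le_trans (_ : (14 / 10) * (n + 6)%:R ^+ 2 <= _).
  rewrite -addn1 !natrD; have : 0 <= n%:R :> R by rewrite ler0n.
  nra.
apply: ler_pM => //; rewrite ?exprn_ge0 //; lra.
Qed.

End CubeRoot.

(** * Search tree of induced paths *)

Section InducedPaths.

Variables (V : finType) (e : rel V) (q : V).
Implicit Types (x y : V) (A B U : {set V}) (s F : seq V).

Definition fwd x A := [set y in A | e x y].

Lemma fwd_sub x A : fwd x A \subset A.
Proof. by apply/subsetP=> y; rewrite inE => /andP[]. Qed.

Lemma in_fwd x A y : (y \in fwd x A) = (y \in A) && e x y.
Proof. by rewrite inE. Qed.

Lemma card_fwdD x A : (#|A :\: fwd x A| + #|fwd x A| = #|A|)%N.
Proof. by rewrite -(cardsID (fwd x A) A) (setIidPr (fwd_sub x A)) addnC. Qed.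

(** [n] is fuel. If [q] is a neighbour of [x], the edge is the only induced path from [x] to [q],
    hence the single answer [[:: q]]. *)
Fixpoint ipaths_rec n x A : seq (seq V) :=
  if n is n'.+1 then
    if q \in fwd x A then [:: [:: q]]
    else flatten [seq [seq y :: F | F <- ipaths_rec n' y (A :\: fwd x A)]
                     | y <- enum (fwd x A)]
  else [::].

(* The induced paths from x, excluding x itself, that end in q and whose
   vertices lie in A.  After each step all the neighbours of the vertex just
   left are removed from the set of available vertices. *)
Definition ipaths x A := ipaths_rec #|A| x A.

Lemma ipaths_rec_fuel n x A : (#|A| <= n)%N -> ipaths_rec n x A = ipaths x A.
Proof.
rewrite /ipaths; elim: n {-2}n (leqnn n) x A => [|m IH] [|n] lenm x A leAn //.
- by move: leAn; rewrite leqn0 => /eqP ->.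
- by move: leAn; rewrite leqn0 => /eqP ->.
case cardA: #|A| => [|a] /=.
  have D0 : fwd x A = set0.
    by apply/eqP; rewrite -subset0 -(cards0_eq cardA) fwd_sub.
  by rewrite D0 in_set0 enum_set0.
case: ifP => // _; congr flatten; apply/eq_in_map => y; rewrite mem_enum => yD.
have D_gt0 : (0 < #|fwd x A|)%N by apply/card_gt0P; exists y.
have le_a : (#|A :\: fwd x A| <= a)%N by have := card_fwdD x A; lia.
have le_n : (#|A :\: fwd x A| <= n)%N by lia.
have le_nm : (n <= m)%N by lia.
rewrite (IH n le_nm y _ le_n).
by case: (leqP a m) => [am|ma]; rewrite ?(IH a am) //; lia.
Qed.

Lemma ipathsE x A : ipaths x A =
  if q \in fwd x A then [:: [:: q]]
  else flatten [seq [seq y :: F | F <- ipaths y (A :\: fwd x A)]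
                   | y <- enum (fwd x A)].
Proof.
rewrite -(@ipaths_rec_fuel #|A|.+1) //=; case: ifP => // _.
congr flatten; apply/eq_in_map => y yD; rewrite ipaths_rec_fuel //.
by have := card_fwdD x A; lia.
Qed.

Lemma ipaths_ind (P : V -> {set V} -> Prop) :
  (forall x A, q \in fwd x A -> P x A) ->
  (forall x A, q \notin fwd x A ->
     (forall y, y \in fwd x A -> P y (A :\: fwd x A)) -> P x A) ->
  forall x A, P x A.
Proof.
move=> Pq PD x A; have [n] := ubnP #|A|; elim: n x A => // n IH x A leAn.
case: (boolP (q \in fwd x A)) => [/Pq // | qD]; apply: PD => // y yD.
apply: IH; have : (0 < #|fwd x A|)%N by apply/card_gt0P; exists y.
by have := card_fwdD x A; lia.
Qed.

Lemma mem_ipaths x A F : F \in ipaths x A ->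
  F != [::] /\ (if q \in fwd x A then F = [:: q] else
    exists y F', [/\ F = y :: F', y \in fwd x A & F' \in ipaths y (A :\: fwd x A)]).
Proof.
rewrite ipathsE; case: ifP => qD; first by rewrite inE => /eqP ->.
case/flatten_mapP => y; rewrite mem_enum => yD /mapP[F' F'in ->].
by split=> //; exists y, F'.
Qed.

Lemma ipaths_last x A F z : F \in ipaths x A -> last z F = q.
Proof.
move: x A F z; apply: ipaths_ind => [x A qD|x A qD IH] F z /mem_ipaths[_].
  by rewrite qD => ->.
by rewrite (negPf qD) => -[y [F' [-> yD F'in]]] /=; apply: IH F'in.
Qed.

Lemma ipaths_uniq x A : uniq (ipaths x A).
Proof.
move: x A; apply: ipaths_ind => [x A qD|x A qD IH]; rewrite ipathsE ?qD // (negPf qD).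
have IH' y : y \in enum (fwd x A) -> uniq (ipaths y (A :\: fwd x A)).
  by rewrite mem_enum; apply: IH.
elim: (enum _) (enum_uniq (fwd x A)) IH' => //= y s IHs /andP[ys us] IH'.
rewrite cat_uniq map_inj_uniq ?IH' ?mem_head //; last by move=> ? ? [].
rewrite IHs ?andbT //= => [|z zs]; last by rewrite IH' // inE zs orbT.
apply/hasPn => F /flatten_mapP[z zs /mapP[F' _ ->]].
by apply/mapP => -[F'' _ [zy _]]; rewrite -zy zs in ys.
Qed.

(* [y :: F] lists the vertices of an induced path from x: consecutive vertices
   are adjacent, and no other pair [i < j] is. *)
Definition is_ipath x F := forall i j, (i < j <= size F)%N ->
  e (nth x (x :: F) i) (nth x (x :: F) j) = (j == i.+1).

Lemma ipathsP x A F : q \in A -> q != x ->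
  reflect [/\ last x F = q, {subset F <= A} & is_ipath x F] (F \in ipaths x A).
Proof.
move=> qA qx; apply: (iffP idP) => [|[lastF FA ipF]].
  move: qA qx; move: x A F; apply: ipaths_ind => [x A qD|x A qD IH] F qA qx Fin.
    have [_] := mem_ipaths Fin; rewrite qD => ->; split=> //.
      by move=> y; rewrite inE => /eqP ->.
    case=> [|i] [|[|j]] //= ij; try by (move: ij; lia).
    by move: qD; rewrite in_fwd => /andP[_ ->].
  have [_] := mem_ipaths Fin; rewrite (negPf qD) => -[y [F' [-> yD F'in]]].
  have qA' : q \in A :\: fwd x A by rewrite in_setD qD.
  have qy : q != y by apply: contraNneq qD => ->.
  have [lastF' F'A ipF'] := IH y yD F' qA' qy F'in.
  split=> //=.
    move=> z; rewrite inE => /predU1P[-> | /F'A].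
      by apply: (subsetP (fwd_sub x A)).
    by rewrite in_setD => /andP[].
  case=> [|i] [|j] //= ij.
    case: j ij => [|j] /= ij; first by move: yD; rewrite in_fwd => /andP[_ ->].
    have := F'A _ (mem_nth x (_ : j < size F')%N).
    rewrite in_setD in_fwd => /(_ ltac:(lia)) /andP[/nandP[|/negPf ->] // nA A0].
    by rewrite A0 in nA.
  rewrite !(set_nth_default y) /=; try (case: (i) ij => /=; lia); try lia.
  by rewrite ipF' //; lia.
move: qA qx FA ipF lastF.
move: x A F; apply: ipaths_ind => [x A qD|x A qD IH] F qA qx FA ipF lastF.
  rewrite ipathsE qD inE.
  case: F ipF lastF FA => [|y F] ipF lastF FA; first by rewrite -lastF eqxx in qx.
  have /= := ipF 0%N (size F).+1 => /(_ ltac:(lia)).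
  rewrite -[nth _ _ _]/(nth x (y :: F) (size (y :: F)).-1) nth_last /= in lastF *.
  rewrite lastF (_ : e x q); last by move: qD; rewrite in_fwd => /andP[_ ->].
  by move=> /esym/eqP[]; case: F {ipF FA} lastF => //= ->.
rewrite ipathsE (negPf qD).
case: F ipF lastF FA => [|y F] ipF lastF FA; first by rewrite -lastF eqxx in qx.
have yD : y \in fwd x A.
  by rewrite in_fwd FA ?mem_head //= -[y]/(nth x [:: x, y & F] 1) -[X in e X _]/(nth x [:: x, y &
    F] 0) ipF.
apply/flatten_mapP; exists y; first by rewrite mem_enum.
apply: map_f; apply: IH => //.
- by rewrite in_setD qD.
- by apply: contraNneq qD => ->.
- move=> z zF; rewrite in_setD in_fwd FA ?inE ?zF ?orbT //= andbT.
  have := ipF 0%N (index z F).+2 => /=; rewrite ltnS index_mem zF nth_index //.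
  by move=> ->.
move=> i j ij; have := ipF i.+1 j.+1 => /=.
rewrite !(set_nth_default y x) /=; try (case: (i) ij => /=; lia); lia.
Qed.

Lemma ipaths_sub x A F : F \in ipaths x A -> {subset F <= A}.
Proof.
move: x A F; apply: ipaths_ind => [x A qD|x A qD IH] F /mem_ipaths[_].
  rewrite qD => -> z; rewrite inE => /eqP ->.
  exact: (subsetP (fwd_sub x A)).
rewrite (negPf qD) => -[y [F' [-> yD F'in]]] z; rewrite inE => /predU1P[->|zF'].
  exact: (subsetP (fwd_sub x A)).
by have := IH y yD F' F'in z zF'; rewrite in_setD => /andP[].
Qed.

Lemma sum_ipaths (M : nmodType) (w : seq V -> M) x A : q \notin fwd x A ->
  \sum_(F <- ipaths x A) w F =
  \sum_(y in fwd x A) \sum_(F <- ipaths y (A :\: fwd x A)) w (y :: F).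
Proof.
move=> qD; rewrite ipathsE (negPf qD) big_flatten big_map -big_enum /=.
by apply: eq_bigr => y _; rewrite big_map.
Qed.

Lemma sum_ipaths_end (M : nmodType) (w : seq V -> M) x A : q \in fwd x A ->
  \sum_(F <- ipaths x A) w F = w [:: q].
Proof. by move=> qD; rewrite ipathsE qD big_seq1. Qed.

(** The waste along [F]: a step of degree [d] wastes [|d - 3|], and whatever is still available when
    [q] comes into reach counts as wasted too. *)
Fixpoint loss x A F : nat :=
  if F is y :: F' then
    if q \in fwd x A then #|A|
    else (#|fwd x A| - 3 + (3 - #|fwd x A|) + loss y (A :\: fwd x A) F')%N
  else 0%N.

Section Weights.

Variables (R : realFieldType) (t : R).
Hypotheses (t_gt0 : 0 < t) (t3 : t ^+ 3 = 3).

(** An exponential moment bound: by [loss_step], a step of degree [d] contributes at most the factor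
    [t ^ d]. By Markov's inequality, paths of large waste are then a small fraction of
    [t ^ #|A|]. *)
Lemma sum_loss_le x A :
  \sum_(F <- ipaths x A) (101 / 100) ^+ loss x A F <= t ^+ #|A|.
Proof.
move: x A; apply: ipaths_ind => [x A qD|x A qD IH].
  have /andP[t1 _] := t_bounds t_gt0 t3.
  by rewrite sum_ipaths_end //= qD; apply: lerXn2r; rewrite ?nnegrE //; lra.
rewrite sum_ipaths //=.
rewrite (eq_bigr (fun y => (101 / 100) ^+ (#|fwd x A| - 3 + (3 - #|fwd x A|)) *
  \sum_(F <- ipaths y (A :\: fwd x A)) (101 / 100) ^+ loss y (A :\: fwd x A) F));
  last first.
  by move=> y _; rewrite (negPf qD) big_distrr /=; apply: eq_bigr => F _; rewrite exprD.
rewrite -big_distrr /=.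
apply: le_trans (_ : (101 / 100) ^+ (#|fwd x A| - 3 + (3 - #|fwd x A|)) *
   \sum_(y in fwd x A) t ^+ #|A :\: fwd x A| <= _).
  by rewrite ler_wpM2l ?exprn_ge0 //; [lra | apply: ler_sum => y /IH].
have -> : t ^+ #|A| = t ^+ #|fwd x A| * t ^+ #|A :\: fwd x A|.
  by rewrite -exprD addnC card_fwdD.
rewrite sumr_const -[t ^+ _ *+ _]mulr_natl mulrA [_ * #|_|%:R]mulrC.
rewrite ler_wpM2r ?exprn_ge0 ?(ltW t_gt0) //.
exact: loss_step.
Qed.

Lemma size_ipaths_le x A : (size (ipaths x A))%:R <= t ^+ #|A|.
Proof.
apply: le_trans (sum_loss_le x A).
rewrite -sum1_size natr_sum; apply: ler_sum => F _.
by rewrite exprn_ege1 //; lra.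
Qed.

(** If [U] is large, the right side is far below [t ^ #|A|]; so a number of paths comparable to
    [t ^ #|A|] cannot consist of paths that meet [U] only a bounded number of times. *)
Lemma sum_mark_le U x A :
  \sum_(F <- ipaths x A) (97 / 100) ^+ count (mem U) F <=
    (99 / 100) ^+ #|A :&: U| * t ^+ #|A|.
Proof.
have t1 := t_bounds t_gt0 t3.
move: x A; apply: ipaths_ind => [x A qD|x A qD IH].
  rewrite sum_ipaths_end //=; apply: le_trans (_ : 1 <= _).
    by rewrite exprn_ile1 //; lra.
  apply: le_trans (_ : (99 / 100) ^+ #|A| * t ^+ #|A| <= _).
    by rewrite -exprMn exprn_ege1 //; lra.
  rewrite ler_wpM2r ?exprn_ge0 ?(ltW t_gt0) // ler_wiXn2l //; try lra.
  exact/subset_leq_card/subsetIl.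
rewrite sum_ipaths //=; set D := fwd x A; set A' := A :\: D.
rewrite (eq_bigr (fun y => (97 / 100) ^+ (y \in U) *
  \sum_(F <- ipaths y A') (97 / 100) ^+ count (mem U) F)); last first.
  by move=> y _; rewrite big_distrr /=; apply: eq_bigr => F _; rewrite exprD.
apply: le_trans (_ : \sum_(y in D) (97 / 100) ^+ (y \in U) *
   ((99 / 100) ^+ #|A' :&: U| * t ^+ #|A'|) <= _).
  apply: ler_sum => y yD; rewrite ler_wpM2l ?exprn_ge0 ?IH //; lra.
rewrite -big_distrl /=.
have -> : \sum_(y in D) (97 / 100 : R) ^+ (y \in U) =
          #|D|%:R - 3 / 100 * #|D :&: U|%:R.
  rewrite (eq_bigr (fun y => 1 - 3 / 100 * (y \in U)%:R)); last first.
    by move=> y _; case: (y \in U) => /=; rewrite ?expr1 ?expr0; lra.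
  rewrite sumrB sumr_const -big_distrr /= -natr_sum; congr (_ - _ * _%:R).
  rewrite -sum1_card big_mkcond [RHS]big_mkcond /=; apply: eq_bigr => y _.
  by rewrite [y \in _ :&: _]inE; case: (y \in D); case: (y \in U).
have cA : #|A| = (#|D| + #|A'|)%N by rewrite -(card_fwdD x A) addnC.
have cAU : #|A :&: U| = (#|D :&: U| + #|A' :&: U|)%N.
  rewrite -(cardsID D (A :&: U)).
  by congr (_ + _)%N; apply: eq_card => y; rewrite /A' /D !inE;
     case: (y \in A); case: (y \in U); case: (e x y).
rewrite cA cAU 2!exprD.
have -> : (99 / 100) ^+ #|D :&: U| * (99 / 100) ^+ #|A' :&: U| * (t ^+ #|D| * t ^+ #|A'|) =
  (t ^+ #|D| * (99 / 100) ^+ #|D :&: U|) * ((99 / 100) ^+ #|A' :&: U| * t ^+ #|A'|) :> R by ring.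
rewrite ler_wpM2r //.
  by rewrite mulr_ge0 ?exprn_ge0 ?(ltW t_gt0) //; lra.
by rewrite mark_step // subset_leq_card ?subsetIl.
Qed.

End Weights.
End InducedPaths.

(** * Vertices consumed along a path, read from both ends *)

Section Consumption.

Variables (V : finType) (e : rel V) (q : V).
Implicit Types (x y : V) (A B U : {set V}) (s F : seq V).

Definition nbs s := [set v | has (e^~ v) s].

Fixpoint avail x A s := if s is y :: s' then avail y (A :\: fwd e x A) s' else A.

Lemma availE x A s : avail x A s = A :\: nbs (belast x s).
Proof.
elim: s x A => [|y s IH] x A /=.
  by apply/setP => v; rewrite !inE.
by rewrite IH; apply/setP => v; rewrite !inE /=; case: (v \in A); rewrite ?andbF // !andbT negb_or andbC.
Qed.

Lemma avail_rcons x A s y :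
  avail x A (rcons s y) = avail x A s :\: fwd e (last x s) (avail x A s).
Proof. by elim: s x A => //= z s IH x A; rewrite IH. Qed.

Lemma ipath_uniq x A F : F \in ipaths e q x A -> uniq F.
Proof.
move: x A F; apply: (@ipaths_ind _ e q) => [x A qD|x A qD IH] F /mem_ipaths[_].
  by rewrite qD => ->.
rewrite (negPf qD) => -[y [F' [-> yD F'in]]] /=; rewrite (IH y yD F' F'in) andbT.
by apply/negP => /(ipaths_sub F'in); rewrite in_setD yD.
Qed.

(** A step consumes as many vertices as its degree, so the deviation from three vertices per step
    adds up to at most the waste. *)
Lemma loss_avail x A s F : F != [::] -> s ++ F \in ipaths e q x A ->
  (#|A| <= #|avail x A s| + 3 * size s + loss e q x A (s ++ F) /\
   #|avail x A s| + 3 * size s <= #|A| + loss e q x A (s ++ F))%N.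
Proof.
move=> F0; elim: s x A => [|y s IH] x A /=; first by lia.
move/mem_ipaths => [_]; case: ifP => _ [].
  by case: s {IH} F F0 => [|? ?] [|? ?].
move=> y' [F' [[<- <-] _ /IH]] [] h1 h2.
by have := card_fwdD e x A; lia.
Qed.

Lemma loss_end x A s z : rcons s z \in ipaths e q x A ->
  (#|avail x A s| <= loss e q x A (rcons s z))%N.
Proof.
elim: s x A => [|y s IH] x A /= /mem_ipaths[_]; case: ifP => // _.
- by case=> y [F' [[_ <-] _ /mem_ipaths[]]].
- by case: s {IH}.
by move=> [y' [F' [[<- <-] _ /IH h]]]; apply: leq_trans h (leq_addl _ _).
Qed.

End Consumption.

Section Overlap.

Variables (V : finType) (e : rel V) (p q : V).
Hypotheses (e_sym : symmetric e) (pq : p != q).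
Implicit Types (x y : V) (A B U : {set V}) (s F : seq V).

Lemma rev_ipaths F : F \in ipaths e q p [set~ p] ->
  rev (belast p F) \in ipaths e p q [set~ q].
Proof.
move=> Fin; have uF := ipath_uniq Fin; have FA := ipaths_sub Fin.
have [F0 _] := mem_ipaths Fin.
have uF' : uniq (p :: F).
  by rewrite /= uF andbT; apply/negP => /FA; rewrite !inE eqxx.
have [lastF _ ipF] : [/\ last p F = q, {subset F <= [set~ p]} & is_ipath e p F].
  by apply/ipathsP; rewrite ?inE 1?eq_sym.
have revE : q :: rev (belast p F) = rev (p :: F).
  by rewrite [in RHS]lastI lastF rev_rcons.
have szE : size (rev (belast p F)) = size F by rewrite size_rev size_belast.
apply/ipathsP; rewrite ?inE //; split.
- case: F F0 lastF {FA Fin uF uF' ipF revE szE} => //= y F _ _.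
  by rewrite rev_cons last_rcons.
- move=> z; rewrite mem_rev => zF; rewrite !inE; move: uF'.
  by rewrite lastI lastF rcons_uniq => /andP[qF _]; apply: contraNneq qF => <-.
move=> i j; rewrite szE => /andP[ij jF].
rewrite revE !nth_rev ?[size _]/= //; try lia.
rewrite e_sym !(set_nth_default p q) /=; try lia.
by rewrite ipF; [apply/eqP/eqP; lia | lia].
Qed.

(** Read from [p], the part [s] consumes about [3 * size s] vertices; read from [q], the part [F]
    consumes about [3 * size F]. Together the two consumed sets cover nearly everything, while
    [3 * (size s + size F)] is about [#|V|], so they overlap little. The vertex [last p s] belongs
    to neither part, whence the term [Dl]. *)
Lemma overlap_bound (K Dl : nat) s F :
  F != [::] -> s ++ F \in ipaths e q p [set~ p] ->
  (loss e q p [set~ p] (s ++ F) <= K)%N ->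
  (loss e p q [set~ q] (rev (belast p (s ++ F))) <= K)%N ->
  (#|nbhd e (last p s)| <= Dl)%N ->
  (#|nbs e F :\: avail e p [set~ p] s| <= 4 * K + 6 + Dl)%N.
Proof.
move=> F0 Fin; have := rev_ipaths Fin.
set R := rev _ => Rin lossF lossR degx.
have cp : #|[set~ p]| = #|V|.-1 by rewrite cardsC1.
have cq : #|[set~ q]| = #|V|.-1 by rewrite cardsC1.
have n_gt0 : (0 < #|V|)%N by apply/card_gt0P; exists p.
set A := avail _ _ _ _.
case: (eqVneq s [::]) => [s0|s0].
  apply: leq_trans (_ : #|[set p]| <= _)%N; last by rewrite cards1; lia.
  apply/subset_leq_card/subsetP => v; rewrite /A s0 /= !inE negbK.
  by case/andP.
have := loss_avail F0 Fin; rewrite -/A cp => -[A1 _].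
have [s0' F0E] : exists s0', s ++ F = rcons s0' q.
  exists (s ++ take (size F).-1 F); rewrite rcons_cat; congr (_ ++ _).
  case: F F0 Fin {Rin lossF R lossR A1} => // y F _ Fin.
  have /= := ipaths_last p Fin; rewrite last_cat /= => <-.
  rewrite [in RHS]lastI [in LHS]lastI -cats1 take_size_cat ?cats1 ?size_belast //.
have lossE : (#|avail e p [set~ p] s0'| <= K)%N.
  by apply: leq_trans lossF; rewrite F0E; apply: loss_end; rewrite -F0E.
have sz0 : (3 * size s0' <= #|V|.-1 + K)%N.
  have := @loss_avail _ e q p [set~ p] s0' [:: q] isT.
  by rewrite cats1 -F0E => /(_ Fin); rewrite cp => -[_]; lia.
have sz0' : (size s0').+1 = (size s + size F)%N.
  by rewrite -size_cat F0E size_rcons.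
(* the same path read backwards from [q] splits at the same vertex *)
have bk : exists s' F', [/\ F' != [::], R = s' ++ F', size s' = size F &
                            belast q s' = rev F].
  have qR : q :: R = rev (p :: s ++ F).
    by rewrite [in RHS]lastI (ipaths_last p Fin) rev_rcons.
  have [y [F1 FE]] : exists y F1, rev F = y :: F1.
    by case: (rev F) (size_rev F) F0 => [|y F1 _ _];
      [case: F {Fin A1 R Rin lossF lossR F0E qR sz0'} | exists y, F1].
  exists (rcons F1 (last p s)), (rev (belast p s)).
  move: qR; rewrite -cat_cons rev_cat [p :: s]lastI rev_rcons FE /= => -[yq ->].
  split.
  - by case: s s0 {Fin A A1 R Rin lossF lossR F0E sz0' degx} => //= y' s _; rewrite rev_cons; case: rev.
  - by rewrite cat_rcons.
  - by rewrite size_rcons -(size_rev F) FE.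
  by rewrite belast_rcons yq.
have {bk} [s' [F' [F'0 RE szs' bel']]] := bk.
have Rin' : s' ++ F' \in ipaths e p q [set~ q] by rewrite -RE.
have := loss_avail F'0 Rin'; rewrite -RE cq szs' => -[B1 _].
move: B1; rewrite availE bel'.
have -> : nbs e (rev F) = nbs e F by apply/setP => v; rewrite !inE has_rev.
move=> B1.
have AE : A = [set~ p] :\: nbs e (belast p s) by rewrite /A availE.
set a := nbs e (belast p s) in AE; set b := nbs e F in B1 *.
have ca : (#|a| <= 3 * size s + K + 1)%N.
  have : (#|a| <= #|~: A|)%N.
    by apply/subset_leq_card/subsetP => v va; rewrite in_setC AE in_setD va.
  by have := cardsC A; lia.
have cb : (#|b| <= 3 * size F + K + 1)%N.
  have : (#|b| <= #|~: ([set~ q] :\: b)|)%N.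
    by apply/subset_leq_card/subsetP => v vb; rewrite in_setC in_setD vb.
  by have := cardsC ([set~ q] :\: b); lia.
(* Apart from [p], a vertex is left over at the end or adjacent to a vertex of [belast p s], to
   [last p s], or to a vertex of [F]. *)
have cab : (#|V| <= 1 + K + #|a :|: b| + Dl)%N.
  have : (#|[set: V]| <= #|[set p] :|: avail e p [set~ p] s0' :|: (a :|: b) :|: nbhd e (last p s)|)%N.
    apply/subset_leq_card/subsetP => v _; rewrite availE !inE.
    case: (eqVneq v p) => //= vp; case: hasP => //= -[z zs ezv].
    have : z \in belast p (s ++ F).
      by rewrite F0E belast_rcons; apply: mem_belast.
    rewrite belast_cat mem_cat => /orP[zs'|zF].
      by rewrite [has _ (belast p s)](_ : _ = true) //; apply/hasP; exists z.
    have : z \in last p s :: F by apply: mem_belast zF.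
    rewrite inE => /predU1P[<-|zF']; first by rewrite ezv !orbT.
    by rewrite [has _ F](_ : _ = true) ?orbT //; apply/hasP; exists z.
  rewrite cardsT => /leq_trans; apply.
  have := cardsUI ([set p] :|: avail e p [set~ p] s0' :|: (a :|: b)) (nbhd e (last p s)).
  have := cardsUI ([set p] :|: avail e p [set~ p] s0') (a :|: b).
  by have := cardsUI [set p] (avail e p [set~ p] s0'); rewrite cards1; lia.
have : (#|b :\: A| <= #|p |: (a :&: b)|)%N.
  apply/subset_leq_card/subsetP => v; rewrite AE !inE.
  by case: (v == p) => //=; rewrite andbT negbK.
have := cardsUI a b; have := cardsUI [set p] (a :&: b); rewrite cards1; lia.
Qed.

End Overlap.

(** * Nodes of the search tree *)

Section Zone.

Variables (V : finType) (e : rel V) (p q : V).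
Hypothesis e_sym : symmetric e.
Implicit Types (x y : V) (X : {set V}) (s l F : seq V).

(* A node of the search tree is the list [s] of the vertices visited after [p]. *)
Definition av s := avail e p [set~ p] s.
Definition ch s := fwd e (last p s) (av s).

Fixpoint walk s l := if l is y :: l' then (y \in ch s) && walk (rcons s y) l' else true.

Lemma av_rcons s y : av (rcons s y) = av s :\: ch s.
Proof. exact: avail_rcons. Qed.

Lemma ch_sub s : ch s \subset av s.
Proof. exact: fwd_sub. Qed.

Lemma in_ch s y : (y \in ch s) = (y \in av s) && e (last p s) y.
Proof. exact: in_fwd. Qed.

Lemma walk_rcons s l y : walk s (rcons l y) = walk s l && (y \in ch (s ++ l)).
Proof.
elim: l s y => [|z l IH] s y /=; first by rewrite cats0 andbT.
by rewrite IH cat_rcons andbA.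
Qed.

Lemma walk_cat s l l' : walk s (l ++ l') = walk s l && walk (s ++ l) l'.
Proof.
elim: l s => [|z l IH] s /=; first by rewrite cats0.
by rewrite IH cat_rcons andbA.
Qed.

Lemma walk_av s l : walk s l -> av (s ++ l) \subset av s.
Proof.
elim: l s => [|z l IH] s /=; first by rewrite cats0.
case/andP=> zs /IH; rewrite cat_rcons => h; apply: subset_trans h _.
by rewrite av_rcons subsetDl.
Qed.

Lemma walk_ch s l a : walk s l -> (0 < size l)%N -> a \in ch s -> a \notin av (s ++ l).
Proof.
case: l => //= c l /andP[_ wl] _ as_; rewrite -cat_rcons.
apply/negP => /(subsetP (walk_av wl)); by rewrite av_rcons in_setD as_.
Qed.

Fixpoint zone h s : Prop :=
  if h is h'.+1 then
    [/\ q \notin ch s, #|ch s| = 3 & forall y, y \in ch s -> zone h' (rcons s y)]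
  else True.

Lemma zoneW h k s : (h <= k)%N -> zone k s -> zone h s.
Proof.
elim: h k s => [|h IH] [|k] s //= hk [qs c3 zy]; split=> // y ys.
by apply: (IH k) => //; apply: zy.
Qed.

Lemma zone_walk h s l : walk s l -> zone (size l + h) s -> zone h (s ++ l).
Proof.
elim: l s => [|y l IH] s /=; first by rewrite cats0.
by case/andP=> ys wl [_ _ /(_ y ys) /(IH _ wl)]; rewrite cat_rcons.
Qed.

(* Two nodes with the same last vertex and nested available sets have the same
   subtree as long as all the degrees are 3, so the extra vertices of the larger
   available set are never used. *)
Lemma zone_nested h s1 s2 l : last p s1 = last p s2 -> av s1 \subset av s2 ->
  zone h s1 -> zone h s2 -> walk s2 l -> (size l <= h)%N ->
  av s2 :\: av s1 \subset av (s2 ++ l).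
Proof.
elim: l h s1 s2 => [|y l IH] h s1 s2 last12 av12 z1 z2.
  by rewrite cats0 subsetDl.
case: h z1 z2 => //= h [q1 c1 z1] [q2 c2 z2] /andP[ys wl] lh.
have chE : ch s1 = ch s2.
  apply/eqP; rewrite eqEcard c1 c2 leqnn andbT.
  by apply/subsetP => z; rewrite !in_ch last12 => /andP[/(subsetP av12) -> ->].
have := IH h (rcons s1 y) (rcons s2 y); rewrite !last_rcons cat_rcons => /(_ erefl).
rewrite !av_rcons chE => H; apply: subset_trans (H _ _ _ wl lh).
- apply/subsetP => z; rewrite !in_setD => /andP[nz1 z2'].
  rewrite z2' (negPf nz1) andbF /= andbT.
  by apply: contra nz1; rewrite -chE; apply: (subsetP (ch_sub s1)).
- exact: setSD.
- by apply: z1; rewrite chE.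
- exact: z2.
Qed.

(** Where this holds, the children of [s] form a cluster that is completely joined to the next
    one. *)
Definition uniform s := forall a b, a \in ch s -> b \in ch s -> ch (rcons s a) = ch (rcons s b).

(* After at most two steps, some neighbour of the current vertex has been removed
   while one of its own neighbours stays unused during the next [h] steps. *)
Lemma not_uniform_leaves h s : zone (h + h + 2) s -> ~ uniform s ->
  exists l, [/\ walk s l, (0 < size l <= 2)%N & exists2 a, a \in ch s &
    forall l', walk (s ++ l) l' -> (size l' <= h)%N ->
      exists2 u, u \in av (s ++ l ++ l') & e a u].
Proof.
rewrite (_ : h + h + 2 = (h + h).+2)%N; last by lia.
move=> [qs c3 zs] /not_all_ex_not[a] /not_all_ex_not[b] nab.
have [aD nb] := imply_to_and _ _ nab; have [bD /eqP Sab] := imply_to_and _ _ nb.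
have [qa ca za] := zs a aD; have [qb cb zb] := zs b bD.
case: (classic (exists l1, [/\ walk (rcons s a) l1, (size l1 <= h)%N,
   ch (rcons s b) :&: av (rcons s a ++ l1) != set0 &
   ch (rcons s b) :&: av (rcons s a ++ l1) \subset ch (rcons s a ++ l1)])).
  case=> l1 [w1 l1h /set0Pn[y]]; rewrite in_setI => /andP[yb ya] sub1.
  have yD1 : y \in ch (rcons s a ++ l1) by apply: (subsetP sub1); rewrite in_setI yb.
  exists [:: b; y]; split=> //=; first by rewrite bD yb.
  exists a => // l' wl' l'h.
  have [u uSa uSb] : exists2 u, u \in ch (rcons s a) & u \notin ch (rcons s b).
    apply/subsetPn; apply: contra Sab => sub; by rewrite eqEcard sub ca cb.
  have ua : u \in av (rcons s a) by apply: (subsetP (ch_sub _)).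
  exists u; last by move: uSa; rewrite in_ch last_rcons => /andP[].
  pose s1 := rcons (rcons s a ++ l1) y; pose s2 := rcons (rcons s b) y.
  have s2E : s ++ [:: b; y] = s2 by rewrite /s2 -!cats1 -catA.
  rewrite s2E in wl'; rewrite -[b :: _]/([:: b; y] ++ l') catA s2E.
  have abE : av (rcons s b) = av (rcons s a) by rewrite !av_rcons.
  have sub12 : av s1 \subset av s2.
    apply/subsetP => z; rewrite /s1 /s2 !(av_rcons _ y) !in_setD => /andP[nz z1].
    have z1' := subsetP (walk_av w1) _ z1.
    rewrite abE z1' andbT; apply: contra nz => zb'; apply: (subsetP sub1).
    by rewrite in_setI zb'.
  have z1 : zone h s1.
    rewrite /s1 -cats1 -catA; apply: zone_walk.
      by rewrite walk_cat w1 /= yD1.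
    rewrite size_cat /=; apply: (@zoneW _ (h + h).+1 _ _ (zs a aD)).
    by move: l1h; clear; lia.
  have z2 : zone h s2 by apply: (@zoneW _ (h + h) _ (leq_addr h h) (zb y yb)).
  have s12 : last p s1 = last p s2 by rewrite /s1 /s2 !last_rcons.
  apply: (subsetP (zone_nested s12 sub12 z1 z2 wl' l'h)).
  rewrite /s1 /s2 !(av_rcons _ y) !in_setD abE ua uSb !andbT negb_and negbK.
  apply/orP; right.
  case: l1 w1 {l1h z1 s1 s12 sub12 ya yD1} sub1 => [|c l1] /=.
    rewrite cats0 => _ sub1; case/negP: Sab; rewrite eq_sym eqEcard ca cb leqnn andbT.
    apply: subset_trans sub1; rewrite subsetI subxx -abE; exact: ch_sub.
  case/andP=> _ w1 _; rewrite -cat_rcons; apply/negP => /(subsetP (walk_av w1)).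
  by rewrite [av (rcons _ c)]av_rcons in_setD uSa.
move=> nex; exists [:: a]; split=> //=; first by rewrite aD.
exists b => // l' wl' l'h; rewrite cats1 in wl'; rewrite -cat_rcons.
have : ch (rcons s b) :&: av (rcons s a ++ l') != set0.
  elim/last_ind: l' wl' l'h => [|l' y IH].
    move=> _ _; rewrite cats0 (setIidPl _) -?card_gt0 ?cb //.
    by rewrite av_rcons -(av_rcons s b); exact: ch_sub.
  rewrite walk_rcons size_rcons => /andP[wl' yl'] l'h; have IH' := IH wl' (ltnW l'h).
  have : ~~ (ch (rcons s b) :&: av (rcons s a ++ l') \subset ch (rcons s a ++ l')).
    by apply/negP => sub; apply: nex; exists l'; split=> //; apply: ltnW.
  case/subsetPn => u; rewrite in_setI => /andP[ub ua] un.
  by apply/set0Pn; exists u; rewrite -rcons_cat av_rcons !in_setI in_setD ub ua un.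
case/set0Pn => u; rewrite in_setI => /andP[ub ua]; exists u => //.
by move: ub; rewrite in_ch last_rcons => /andP[].
Qed.

(** These are the vertices at which a later path can touch the neighbourhood of what has been
    discarded. *)
Definition bdry s := [set u in av s | [exists v, (v \notin av s) && e u v]].

(** Each non-uniform node yields, within [L + 2] further steps, a new discarded vertex that keeps an
    available neighbour during the next [h] steps. After [k] rounds there are [k] of them at one
    node, which forces a large boundary when degrees are bounded. *)
Lemma not_uniform_iter L H h k s0 : (H <= h)%N -> zone (H + L + h + h + 4) s0 ->
  (forall l, walk s0 l -> (size l <= H)%N ->
     exists2 l2, walk (s0 ++ l) l2 /\ (size l2 <= L)%N & ~ uniform (s0 ++ l ++ l2)) ->
  (k * (L + 2) <= H)%N ->
  exists l X, [/\ walk s0 l, (size l <= k * (L + 2))%N, #|X| = k,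
    [disjoint X & av (s0 ++ l)] &
    forall l', walk (s0 ++ l) l' -> (size l + size l' <= h)%N ->
      forall a, a \in X -> exists2 u, u \in av (s0 ++ l ++ l') & e a u].
Proof.
move=> Hh z0 nu; elim: k => [|k IH] kH.
  by exists [::], set0; rewrite cards0 disjoints_subset sub0set; split=> // l' _ _ a; rewrite inE.
have kH' : (k * (L + 2) <= H)%N by rewrite mulSn in kH; lia.
have [l [X [wl szl cX dX perX]]] := IH kH'.
have szlH : (size l <= H)%N by lia.
have [l2 [wl2 szl2] nul2] := nu l wl szlH.
have w12 : walk s0 (l ++ l2) by rewrite walk_cat wl.
have z2 : zone (h + h + 2) (s0 ++ l ++ l2).
  by apply: zone_walk => //; apply: zoneW z0; rewrite size_cat; lia.
have [l3 [wl3 szl3 [a ach per3]]] := not_uniform_leaves z2 nul2.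
have w123 : walk s0 ((l ++ l2) ++ l3) by rewrite walk_cat w12.
have aX : a \notin X.
  have aA : a \in av (s0 ++ l).
    have := subsetP (walk_av wl2) a; rewrite -catA; apply.
    by apply: (subsetP (ch_sub _)).
  by apply: contraL aA => /(disjointFr dX) ->.
exists ((l ++ l2) ++ l3), (a |: X); split=> //.
- by move: szl szl2 szl3; rewrite !size_cat mulSn; clear; lia.
- by rewrite cardsU1 aX cX.
- rewrite disjoints_subset; apply/subsetP => b; rewrite inE in_set1 in_setC.
  case/predU1P=> [->|bX].
    by rewrite catA; apply: walk_ch => //; case/andP: szl3.
  apply/negP => bA; have w23 : walk (s0 ++ l) (l2 ++ l3) by rewrite walk_cat wl2 -catA.
  have := subsetP (walk_av w23) b; rewrite -!catA in bA *.
  by move=> /(_ bA) bA'; rewrite (disjointFr dX bX) in bA'.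
move=> l' wl' szl' b; rewrite inE in_set1 => /predU1P[->|bX].
  have wl'' : walk ((s0 ++ l ++ l2) ++ l3) l' by rewrite -catA.
  have [|u uA eau] := per3 l' wl''; first by move: szl'; rewrite !size_cat; clear; lia.
  by exists u => //; rewrite -!catA in uA *.
have w23 : walk (s0 ++ l) (l2 ++ l3 ++ l').
  by rewrite !walk_cat wl2 -!catA wl3 /=; rewrite -!catA in wl'.
have [|u uA eau] := perX _ w23 _ b bX; first by move: szl'; rewrite !size_cat; clear; lia.
by exists u => //; rewrite -!catA in uA *.
Qed.

End Zone.

Lemma bernoulli (R : realFieldType) (x : R) k : 1 < x -> 1 + k%:R * (x - 1) <= x ^+ k.
Proof.
move=> x1; elim: k => [|k IH]; first by rewrite mul0r addr0 expr0.
rewrite exprS -addn1 natrD.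
have k0 : 0 <= k%:R :> R by rewrite ler0n.
apply: le_trans (_ : x * (1 + k%:R * (x - 1)) <= _); last first.
  by rewrite ler_wpM2l //; lra.
have : 0 <= k%:R * (x - 1) ^+ 2 by rewrite mulr_ge0 ?exprn_ge0 //; lra.
lra.
Qed.

Lemma expr_unbounded (R : archiRealFieldType) (x B : R) : 1 < x -> exists k, B < x ^+ k.
Proof.
move=> x1; pose y := `|B| / (x - 1); have y0 : 0 <= y by rewrite divr_ge0 // subr_ge0 ltW.
exists (Num.bound y); apply: lt_le_trans (bernoulli _ x1).
have := archi_boundP y0; rewrite /y ltr_pdivrMr ?subr_gt0 // => h.
apply: le_lt_trans (ler_norm B) _; lra.
Qed.

Lemma expr_small (R : archiRealFieldType) (x d : R) : 0 < x < 1 -> 0 < d ->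
  exists k, x ^+ k < d.
Proof.
case/andP=> x0 x1 d0; have [|k hk] := @expr_unbounded R x^-1 d^-1.
  by rewrite invf_gt1.
by exists k; rewrite exprVn ltf_pV2 ?posrE ?exprn_gt0 // in hk.
Qed.

Lemma card_bigcup_sum (I J : finType) (P : pred I) (F : I -> {set J}) :
  (#|\bigcup_(i | P i) F i| <= \sum_(i | P i) #|F i|)%N.
Proof.
apply: (big_ind2 (fun (X : {set J}) k => #|X| <= k)%N) => //; first by rewrite cards0.
by move=> X a Y b hX hY; apply: leq_trans (leq_card_setU _ _) (leq_add hX hY).
Qed.

Lemma card_bigcup_le (V : finType) (U : {set V}) (f : V -> {set V}) d :
  (forall u, u \in U -> #|f u| <= d)%N -> (#|\bigcup_(u in U) f u| <= #|U| * d)%N.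
Proof.
move=> fd; apply: leq_trans (card_bigcup_sum _ _) _.
by rewrite -sum_nat_const; apply: leq_sum.
Qed.

(** * Density of good paths at a node of the search tree *)

Section GoodPaths.

Variables (V : finType) (e : rel V) (p q : V).
Hypothesis e_sym : symmetric e.
Variables (R : archiRealFieldType) (t : R).
Hypotheses (t_gt0 : 0 < t) (t3 : t ^+ 3 = 3).
Variable (G : pred (seq V)).
Implicit Types (s l F : seq V).

Local Notation av := (av e p).
Local Notation ch := (ch e p).
Local Notation walk := (walk e p).
Local Notation zone := (zone e p q).

Definition npaths s : R := \sum_(F <- ipaths e q (last p s) (av s)) (G (s ++ F))%:R.
Definition density s := npaths s / t ^+ #|av s|.

Lemma npaths_step s : q \notin ch s -> npaths s = \sum_(y in ch s) npaths (rcons s y).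
Proof.
move=> qs; rewrite /npaths sum_ipaths //; apply: eq_bigr => y _.
by rewrite last_rcons av_rcons; apply: eq_bigr => F _; rewrite cat_rcons.
Qed.

Lemma npaths_ge0 s : 0 <= npaths s.
Proof. by apply: sumr_ge0 => F _; rewrite ler0n. Qed.

Lemma npaths_le s : npaths s <= t ^+ #|av s|.
Proof.
apply: le_trans (size_ipaths_le e q t_gt0 t3 (last p s) (av s)).
rewrite -sum1_size natr_sum; apply: ler_sum => F _.
by case: (G _); rewrite ?ler0n ?lerr.
Qed.

Lemma npaths_end s : q \in ch s -> npaths s <= 1.
Proof. by move=> qs; rewrite /npaths sum_ipaths_end //; case: (G _); rewrite ?ler01. Qed.

Lemma npathsE s : npaths s = density s * t ^+ #|av s|.
Proof. by rewrite /density divfK // expf_neq0 // gt_eqF. Qed.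

Lemma density_le1 s : density s <= 1.
Proof. by rewrite /density ler_pdivrMr ?exprn_gt0 // mul1r npaths_le. Qed.

(** Densities are at most 1, so one can pass to a descendant whose density is larger by a factor
    [1 + d] fewer than [i] times. *)
Lemma max_node h d i s : 0 < d -> 1 < (1 + d) ^+ i * density s ->
  exists l, [/\ (size l <= i * h)%N, walk s l, density s <= density (s ++ l) &
   forall l', walk (s ++ l) l' -> (size l' <= h)%N ->
      density (s ++ l ++ l') <= (1 + d) * density (s ++ l)].
Proof.
move=> d0; elim: i s => [|i IH] s.
  by rewrite expr0 mul1r ltNge density_le1.
rewrite exprSr -mulrA => hi.
case: (classic (exists l', [/\ walk s l', (size l' <= h)%N &
                              (1 + d) * density s < density (s ++ l')])).
  case=> l' [wl' szl' rl'].
  have [|l [szl wl rl max]] := IH (s ++ l').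
    by apply: lt_trans hi _; rewrite ltr_pM2l // exprn_gt0 //; lra.
  exists (l' ++ l); split.
  - by rewrite size_cat mulSn; lia.
  - by rewrite walk_cat wl'.
  - rewrite catA; apply: le_trans rl; apply: le_trans (ltW rl').
    have : 0 <= density s by rewrite divr_ge0 ?npaths_ge0 // exprn_ge0 // ltW.
    by move=> ?; rewrite ler_peMl //; lra.
  by move=> l''; rewrite -!catA catA => w sz; rewrite catA max.
move=> nex; exists [::]; split; rewrite ?cats0 // => l' wl' szl'.
by rewrite leNgt; apply/negP => lt; apply: nex; exists l'.
Qed.

(** [density s * t ^ #|ch s|] is the sum of the densities of the children, each at most
    [(1 + d) * r0]. A degree other than 3 would lose the factor [101 / 100] of [loss_step], more
    than the deficits of order [1 / 1000] can make up. For degree 3 the density is a mean of three;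
    as two of them are at most [(1 + d) * r0], the third is at least [3 * (1 - b * d) - 2 * (1 + d)]
    times [r0]. The bound with [M] keeps [q] from being a child, since then there would be at most
    one path. *)
Lemma zone_step h d M s r0 : 0 < r0 -> 0 <= d -> 3 ^+ h * d <= 1 / 1000 ->
  (1 - 3 ^+ h * d) * r0 <= density s -> 1 < r0 / 2 * t ^+ M -> (M <= #|av s|)%N ->
  (forall y, y \in ch s -> density (rcons s y) <= (1 + d) * r0) ->
  [/\ q \notin ch s, #|ch s| = 3 &
   forall y b, y \in ch s -> (1 - b * d) * r0 <= density s ->
     (1 - (3 * b + 2) * d) * r0 <= density (rcons s y)].
Proof.
move=> r00 d0 hd rs hM Mav rch.
have h3 : 1 <= 3 ^+ h :> R by rewrite exprn_ege1 //; lra.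
have d_small : d <= 1 / 1000 by apply: le_trans hd; rewrite ler_peMl.
have rs' : 999 / 1000 * r0 <= density s.
  by apply: le_trans rs; rewrite ler_wpM2r ?(ltW r00) //; lra.
have tpos k : 0 < t ^+ k by rewrite exprn_gt0.
have qs : q \notin ch s.
  apply/negP => /npaths_end; rewrite npathsE; apply/negP; rewrite -ltNge.
  apply: lt_le_trans hM _.
  have r2 : 0 <= r0 / 2 by lra.
  apply: ler_pM => //; rewrite ?exprn_ge0 ?(ltW t_gt0) //; first by lra.
  by rewrite ler_weXn2l // (t_ge1 t_gt0 t3).
have avE : (#|av s| = #|ch s| + (#|av s| - #|ch s|))%N.
  by rewrite subnKC // subset_leq_card // ch_sub.
have av_ch y : y \in ch s -> (#|av (rcons s y)| = #|av s| - #|ch s|)%N.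
  by move=> _; rewrite av_rcons -(card_fwdD e (last p s) (av s)) addnK.
set m := (#|av s| - #|ch s|)%N in avE av_ch.
have nE : npaths s = (\sum_(y in ch s) density (rcons s y)) * t ^+ m.
  rewrite npaths_step // big_distrl /=; apply: eq_bigr => y ys.
  by rewrite npathsE av_ch.
have rE : density s * t ^+ #|ch s| = \sum_(y in ch s) density (rcons s y).
  apply: (mulIf (lt0r_neq0 (tpos m))); rewrite -nE npathsE -mulrA -exprD.
  by rewrite -avE.
have c3 : #|ch s| = 3.
  apply/eqP; apply: contraT => c3.
  have sum_le : \sum_(y in ch s) density (rcons s y) <= #|ch s|%:R * ((1 + d) * r0).
    rewrite mulr_natl -sumr_const; exact: ler_sum.
  have := loss_step t_gt0 t3 #|ch s|.
  set D := #|ch s| in c3 rE sum_le *.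
  have : (101 / 100 : R) <= (101 / 100) ^+ (D - 3 + (3 - D)).
    by rewrite -[leLHS]expr1 ler_weXn2l //; [lra | move: c3; clear; lia].
  set b := _ ^+ _; set T := t ^+ D in rE *; set S := \sum_(_ in _) _ in rE sum_le.
  have T0 : 0 < T := tpos D; have D0 : 0 <= D%:R :> R by rewrite ler0n.
  move=> hb hDb.
  have h1 : D%:R * (101 / 100) <= T by apply: le_trans hDb; rewrite ler_wpM2l.
  have h2 : 999 / 1000 * r0 * T <= D%:R * ((1 + d) * r0).
    by apply: le_trans sum_le; rewrite -rE ler_wpM2r // ltW.
  have h4 : 999 / 1000 * T <= D%:R * (1 + d).
    by rewrite -(ler_pM2r r00); lra.
  have h5 : D%:R * (1 + d) <= D%:R * (1001 / 1000) by rewrite ler_wpM2l //; lra.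
  lra.
split=> // y b ys hb.
have sum2 : \sum_(z in ch s :\ y) density (rcons s z) <= 2 * ((1 + d) * r0).
  have -> : 2 * ((1 + d) * r0) = \sum_(z in ch s :\ y) ((1 + d) * r0).
    have c2 : #|ch s :\ y| = 2 by move: (cardsD1 y (ch s)); rewrite ys c3 => -[].
    by rewrite sumr_const c2 mulr_natl.
  by apply: ler_sum => z; rewrite in_setD1 => /andP[_ /rch].
move: rE; rewrite c3 t3 (big_setD1 y) //= => rE.
lra.
Qed.

Lemma zone_near h d M s : 0 < density s -> 0 <= d -> 3 ^+ h * d <= 1 / 1000 ->
  (forall l, walk s l -> (size l <= h)%N -> density (s ++ l) <= (1 + d) * density s) ->
  1 < density s / 2 * t ^+ M -> (M + 3 * h <= #|av s|)%N ->
  zone h s /\ forall l, walk s l -> (size l <= h)%N -> density s / 2 <= density (s ++ l).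
Proof.
set r0 := density s => r00 d0 hd max hM Mav.
have h3 j : (j <= h)%N -> 3 ^+ j * d <= 3 ^+ h * d.
  by move=> jh; rewrite ler_wpM2r // ler_weXn2l //; lra.
(* The recursion from [b] to [3 * b + 2], started at 0, gives [3 ^ j - 1] after [j] steps. *)
have key l : walk s l -> (size l <= h)%N ->
    (1 - (3 ^+ size l - 1) * d) * r0 <= density (s ++ l) /\
    (#|av (s ++ l)| + 3 * size l = #|av s|)%N.
  elim/last_ind: l => [|l y IH].
    by rewrite cats0 /= expr0 subrr mul0r subr0 mul1r; split=> //; lia.
  rewrite walk_rcons size_rcons => /andP[wl yl] szl.
  have [IH1 IH2] := IH wl (ltnW szl).
  have := @zone_step h d M (s ++ l) r0 r00 d0 hd.
  case=> [|//||z zl|qs c3 rch].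
  - apply: le_trans IH1; rewrite ler_wpM2r ?(ltW r00) //.
    by have := h3 _ (ltnW szl); lra.
  - by move: IH2 Mav szl; clear; lia.
  - rewrite rcons_cat max ?walk_rcons ?wl ?size_rcons //.
  split; last first.
    rewrite -rcons_cat av_rcons; have := card_fwdD e (last p (s ++ l)) (av (s ++ l)).
    by rewrite -/(ch (s ++ l)) c3; move: IH2; clear; lia.
  rewrite -rcons_cat; have := rch y _ yl IH1.
  by rewrite exprS; congr (_ <= _); ring.
split=> [|l wl szl]; last first.
  have [k1 _] := key l wl szl; apply: le_trans k1; rewrite mulrC ler_wpM2r ?(ltW r00) //.
  by have := h3 _ szl; lra.
suff zs k l : walk s l -> (size l + k <= h)%N -> zone k (s ++ l).
  by rewrite -[s]cats0; apply: zs.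
elim: k l => //= k IH l wl szl.
have szl' : (size l <= h)%N by move: szl; clear; lia.
have [k1 k2] := key l wl szl'.
have := @zone_step h d M (s ++ l) r0 r00 d0 hd.
case=> [|//||z zl|qs c3 rch].
- apply: le_trans k1; rewrite ler_wpM2r ?(ltW r00) //.
  by have := h3 _ szl'; lra.
- by move: k2 Mav szl'; clear; lia.
- by rewrite rcons_cat max ?walk_rcons ?wl ?size_rcons //; move: szl; clear; lia.
split=> // y ys; rewrite rcons_cat; apply: IH; rewrite ?walk_rcons ?wl ?size_rcons //.
by move: szl; clear; lia.
Qed.

Lemma bdry_bound K0 Dl K1 b s : (forall x, #|nbhd e x| <= Dl)%N ->
  (forall F, F != [::] -> F \in ipaths e q (last p s) (av s) -> G (s ++ F) ->
     #|nbs e F :\: av s| <= K0)%N ->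
  b * t ^+ #|av s| <= npaths s -> (99 / 100) ^+ K1.+1 < b * (97 / 100) ^+ (K0 * Dl) ->
  (#|bdry e p s| <= K1)%N.
Proof.
move=> deg over bn hK1; rewrite leqNgt; apply/negP => K1b.
have bdry_sub : bdry e p s \subset av s by apply/subsetP => u; rewrite inE => /andP[].
have := sum_mark_le e q t_gt0 t3 (bdry e p s) (last p s) (av s).
rewrite (setIidPr bdry_sub); apply/negP; rewrite -ltNge.
apply: lt_le_trans (_ : npaths s * (97 / 100) ^+ (K0 * Dl) <= _).
  apply: lt_le_trans (_ : b * t ^+ #|av s| * (97 / 100) ^+ (K0 * Dl) <= _).
    rewrite mulrAC ltr_pM2r ?exprn_gt0 //; apply: le_lt_trans hK1.
    by rewrite ler_wiXn2l //; lra.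
  by rewrite ler_wpM2r ?exprn_ge0 //; lra.
rewrite big_distrl /= big_seq [leRHS]big_seq; apply: ler_sum => F Fin.
case: (boolP (G (s ++ F))) => GF; last by rewrite mul0r exprn_ge0 //; lra.
rewrite mul1r ler_wiXn2l //; try lra.
have [F0 _] := mem_ipaths Fin.
apply: leq_trans (_ : #|nbs e F :\: av s| * Dl <= _)%N; last by rewrite leq_mul2r over ?orbT.
have -> : count (mem (bdry e p s)) F = #|[set u in F | u \in bdry e p s]|.
  rewrite -size_filter -(card_uniqP _) ?filter_uniq ?(ipath_uniq Fin) //.
  by apply: eq_card => u; rewrite mem_filter in_set andbC.
apply: leq_trans (card_bigcup_le (f := nbhd e) (fun u _ => deg u)).
apply/subset_leq_card/subsetP => u; rewrite inE => /andP[uF].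
rewrite inE => /andP[_ /existsP[v /andP[vs euv]]].
apply/bigcupP; exists v; last by rewrite inE e_sym.
by rewrite in_setD vs inE; apply/hasP; exists u.
Qed.

End GoodPaths.

(** The two end clusters may have arbitrary further neighbours, and edges inside clusters are left
    open. *)
Definition segment (V : finType) (e : rel V) L (T : nat -> {set V}) :=
  [/\ forall i, (i <= L.+1)%N -> #|T i| = 3%N,
      forall i j, (i < j <= L.+1)%N -> [disjoint T i & T j] &
      forall i x z, (0 < i <= L)%N -> x \in T i ->
        (e x z -> z \in T i.-1 :|: T i :|: T i.+1) /\
        (z \in T i.-1 :|: T i.+1 -> e x z)].

Lemma block_inj W x y k k' : (k < W)%N -> (k' < W)%N ->
  (x * W + k = y * W + k')%N -> x = y.
Proof.
move=> kW k'W E; have W0 : (0 < W)%N by apply: leq_trans kW.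
have := congr1 (fun n => n %/ W)%N E.
by rewrite !divnMDl // !divn_small // !addn0.
Qed.

(** * From uniform zones to segments of a braid *)

Section Clusters.

Variables (V : finType) (e : rel V) (p q : V).
Hypothesis e_sym : symmetric e.
Implicit Types (s l F : seq V).

Lemma uniform_clusters M s : zone e p q M.+1 s ->
  (forall l, walk e p s l -> (size l <= M)%N -> uniform e p (s ++ l)) ->
  exists T A : nat -> {set V},
    [/\ A 0%N = av e p s, forall i, A i.+1 = A i :\: T i,
        forall i, (i <= M)%N -> [/\ T i \subset A i, #|T i| = 3 & q \notin T i] &
        forall i y, (i < M)%N -> y \in T i -> fwd e y (A i.+1) = T i.+1].
Proof.
move=> zs us.
(* An arbitrary branch of the tree; within the zone every node has three children, so the default
   [p] is not taken there. *)
pose fix nx i := if i is j.+1 then rcons (nx j) (odflt p [pick y in ch e p (s ++ nx j)])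
                 else [::].
have nxP i : (i <= M.+1)%N -> [/\ walk e p s (nx i) & size (nx i) = i].
  elim: i => //= i IH iM; have [w sz] := IH (ltnW iM).
  have zi : zone e p q 1 (s ++ nx i).
    by apply: zone_walk => //; apply: zoneW zs; rewrite sz; move: iM; clear; lia.
  case: zi => _ c3 _; rewrite size_rcons sz walk_rcons w.
  case: pickP => [y /= -> //|none]; move: c3; rewrite eq_card0 // => y; exact: none.
exists (fun i => ch e p (s ++ nx i)), (fun i => av e p (s ++ nx i)); split.
- by rewrite cats0.
- by move=> i; rewrite /= -rcons_cat av_rcons.
- move=> i iM; have [w sz] := nxP i (leqW iM).
  have : zone e p q 1 (s ++ nx i).
    by apply: zone_walk => //; apply: zoneW zs; rewrite sz; move: iM; clear; lia.
  by case=> qn c3 _; split=> //; apply: ch_sub.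
move=> i y iM yT; have [w sz] := nxP i (leqW (ltnW iM)).
have /= [w' _] := nxP i.+1 (leqW iM).
rewrite walk_rcons in w'; case/andP: w' => _ zT.
have ui := us _ w; rewrite sz in ui.
rewrite /= -rcons_cat -(ui (ltnW iM) y _ yT zT).
by rewrite av_rcons -(av_rcons e p _ y) /ch last_rcons.
Qed.

(** Among [K1.+1] disjoint blocks of [L + 2] successive clusters, one contains none of the at most
    [K1] boundary vertices. The vertices of that block have no neighbours outside [av e p s], and
    the branch determines their neighbours inside. *)
Lemma clusters_segment L K1 s : (#|bdry e p s| <= K1)%N ->
  zone e p q (K1.+1 * (L + 2)).+1 s ->
  (forall l, walk e p s l -> (size l <= K1.+1 * (L + 2))%N -> uniform e p (s ++ l)) ->
  exists2 T, segment e L T & forall i, (i <= L.+1)%N -> p \notin T i /\ q \notin T i.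
Proof.
set W := (L + 2)%N; set M := (K1.+1 * W)%N => bK zs us.
have [T [A [A0 AS TA TS]]] := uniform_clusters zs us.
have A_mono i j : (i <= j)%N -> A j \subset A i.
  elim: j => [|j IH]; first by rewrite leqn0 => /eqP ->.
  rewrite leq_eqVlt => /predU1P[-> //|/IH ij].
  by apply: subset_trans ij; rewrite AS subsetDl.
have T_disj i j : (i < j <= M)%N -> [disjoint T i & T j].
  move=> /andP[ij jM]; have [sub _ _] := TA j jM.
  rewrite disjoint_sym disjoints_subset; apply: subset_trans sub _.
  by apply: subset_trans (A_mono _ _ ij) _; rewrite AS; apply/subsetP => x;
    rewrite in_setD in_setC => /andP[].
have TA0 i x : (i <= M)%N -> x \in T i -> x \in av e p s.
  by move=> iM xT; have [sub _ _] := TA i iM; rewrite -A0; apply: (subsetP (A_mono 0%N i isT));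
    apply: (subsetP sub).
have T_inj i j x : (i <= M)%N -> (j <= M)%N -> x \in T i -> x \in T j -> i = j.
  move=> iM jM xi xj; case: (ltngtP i j) => // ij.
    by have := T_disj i j; rewrite ij jM => /(_ isT) /disjointFr /(_ xi); rewrite xj.
  by have := T_disj j i; rewrite ij iM => /(_ isT) /disjointFr /(_ xj); rewrite xi.
have T_cover i z : z \in A 0%N -> z \notin A i -> exists2 j, (j < i)%N & z \in T j.
  move=> zA; elim: i => [|i IH]; first by rewrite zA.
  rewrite AS in_setD negb_and negbK => /orP[zT|/IH[j ji zT]]; first by exists i.
  by exists j => //; apply: ltnW.
have idxM (b : 'I_K1.+1) k : (k < W)%N -> ((b * W + k).+1 <= M)%N.
  have := ltn_ord b; rewrite /M => bK1 kW.
  have : (b.+1 * W <= K1.+1 * W)%N by rewrite leq_mul2r bK1 orbT.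
  by rewrite mulSn; move: kW; clear; lia.
have [b bclean] : exists b : 'I_K1.+1,
    forall k, (k < W)%N -> [disjoint T (b * W + k).+1 & bdry e p s].
  apply: NNPP => nex.
  pose Pb (b : 'I_K1.+1) x := x \in bdry e p s /\
      exists2 k, (k < W)%N & x \in T (b * W + k).+1.
  have [|f fP] := @fin_all_exists _ (fun _ => V) Pb.
    move=> b; apply: NNPP => nx; apply: nex; exists b => k kW.
    rewrite disjoint_subset; apply/subsetP => x xT; rewrite inE; apply/negP => xb.
    by apply: nx; exists x; split=> //; exists k.
  have f_inj : injective f.
    move=> b c fbc; have [_ [k kW]] := fP b; have [_ [k' k'W]] := fP c.
    rewrite fbc => h1 h2; apply/val_inj/(block_inj kW k'W).
    by have [] := T_inj _ _ _ (idxM b k kW) (idxM c k' k'W) h2 h1.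
  have : (K1.+1 <= #|bdry e p s|)%N.
    rewrite -[K1.+1]card_ord -(card_imset _ f_inj); apply/subset_leq_card/subsetP.
    by move=> _ /imsetP[c _ ->]; have [] := fP c.
  by move: bK; clear; lia.
exists (fun k => T (b * W + k).+1); last first.
  move=> k kL; have kW : (k < W)%N by rewrite /W addn2.
  have kM := idxM b k kW; have [_ _ qT] := TA _ kM; split=> //.
  by apply/negP => /(TA0 _ _ kM); rewrite /av availE !inE eqxx andbF.
split.
- by move=> k kL; have [] := TA _ (idxM b k _) => //; rewrite /W addn2.
- by move=> i j /andP[ij jL]; apply: T_disj; rewrite ltnS ltn_add2l ij (idxM b) // /W addn2.
move=> [//|k] x z /= kL; rewrite !addnS; set i := (b * W + k).+1.
have kW : (k.+2 < W)%N by rewrite /W addn2 !ltnS.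
have iM : (i.+2 <= M)%N by have := idxM b _ kW; rewrite /i !addnS.
move=> xT; have xA := TA0 _ _ (ltnW iM) xT; split.
  move=> exz; have zA : z \in A 0%N.
    rewrite A0; apply: contraT => zn.
    have := bclean k.+1 (ltnW kW); rewrite addnS -/i => /disjointFr /(_ xT).
    by rewrite inE xA => /negbT /existsPn /(_ z); rewrite zn exz.
  rewrite !in_setU; case: (boolP (z \in A i.+2)) => zi.
    by rewrite -(TS i.+1 x iM xT) in_fwd zi exz orbT.
  have [j ji zT] := T_cover _ _ zA zi; move: ji; rewrite ltnS leq_eqVlt.
  case/predU1P=> [ji|ji]; first by rewrite -ji zT orbT.
  (* A vertex of an earlier cluster [T j] has exactly [T j.+1] as its neighbours further on, so [x]
     must lie there. *)
  have jM : (j < M)%N by apply: leq_trans iM; apply: leqW.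
  have xj : x \in T j.+1.
    rewrite -(TS j z jM zT) in_fwd e_sym exz andbT.
    apply: (subsetP (A_mono _ _ ji)); have [sub _ _] := TA i.+1 (ltnW iM).
    exact: (subsetP sub).
  by have [<-] := T_inj _ _ _ jM (ltnW iM) xj xT; rewrite zT.
rewrite in_setU => /orP[zT|].
  have := TS i z (ltnW iM) zT => E; move: xT; rewrite -E in_fwd e_sym.
  by case/andP.
by rewrite -(TS i.+1 x iM xT) in_fwd => /andP[].
Qed.

End Clusters.

Lemma sum_seq_le (T : eqType) (R : realFieldType) (s1 s2 : seq T) (f : T -> R) :
  uniq s1 -> uniq s2 -> {subset s1 <= s2} -> (forall x, 0 <= f x) ->
  \sum_(x <- s1) f x <= \sum_(x <- s2) f x.
Proof.
move=> u1 u2 s12 f0; have pf : perm_eq s1 [seq x <- s2 | x \in s1].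
  apply: uniq_perm; rewrite ?filter_uniq // => x; rewrite mem_filter.
  by case: (boolP (x \in s1)) => // /s12 ->.
rewrite (perm_big _ pf) /= big_filter big_mkcond /=; apply: ler_sum => x _.
by case: ifP.
Qed.

(** * A segment from a positive proportion of induced paths *)

Section Config.

Variables (R : archiRealFieldType) (t : R).
Hypotheses (t_gt0 : 0 < t) (t3 : t ^+ 3 = 3).

Lemma config_segment (eps : R) (Dl L : nat) : 0 < eps ->
  exists n1, forall (V : finType) (e : rel V) (p q : V),
    symmetric e -> p != q -> (forall x, #|nbhd e x| <= Dl)%N -> (n1 <= #|V|)%N ->
    eps * t ^+ #|V|.-1 <= (size (ipaths e q p [set~ p]))%:R ->
  exists2 T, segment e L T & forall i, (i <= L.+1)%N -> p \notin T i /\ q \notin T i.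
Proof.
move=> eps0.
(* In each of the two directions, paths of waste above [K] make up at most a quarter of
   [eps * t ^ (n - 1)]; half of the paths remain good, whence [eps1]. *)
have [K hK] : exists K, 4 / eps < (101 / 100 : R) ^+ K by apply: expr_unbounded; lra.
pose K0 := (4 * K + 6 + Dl)%N; pose eps1 := eps / 2.
have eps10 : 0 < eps1 by rewrite /eps1; lra.
have [K1 hK1] : exists K1, (99 / 100 : R) ^+ K1.+1 < eps1 / 2 * (97 / 100) ^+ (K0 * Dl).
  have [||k hk] := @expr_small R (99 / 100) (eps1 / 2 * (97 / 100) ^+ (K0 * Dl)).
  - lra.
  - by rewrite mulr_gt0 ?exprn_gt0 //; lra.
  exists k; apply: le_lt_trans hk; rewrite exprSr ler_piMr ?exprn_ge0 //; lra.
(* [M] levels of uniform nodes contain a segment; [k] is one more than the number of discarded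
   vertices that a boundary of size [K1] can account for; [H] steps suffice to collect [k] of
   them. *)
pose M := (K1.+1 * (L + 2))%N; pose k := (K1 * Dl).+1; pose H := (k * (M + 2))%N.
pose Z := (H + M + H + H + 4)%N; pose d : R := (1 / 1000) / 3 ^+ Z.
have Z3 : 0 < 3 ^+ Z :> R by rewrite exprn_gt0.
have d0 : 0 < d by rewrite divr_gt0 //; lra.
have hd : 3 ^+ Z * d <= 1 / 1000 by rewrite /d mulrC divfK // gt_eqF.
have [i hi] : exists i, eps1^-1 < (1 + d) ^+ i by apply: expr_unbounded; lra.
have [m hm] : exists m, (eps1 / 2)^-1 < t ^+ m.
  by apply: expr_unbounded; have /andP[] := t_bounds t_gt0 t3; lra.
exists (m + 3 * Z + 3 * (i * Z) + K).+1 => V e p q e_sym pq deg nV sz.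
have cp : #|[set~ p]| = #|V|.-1 by rewrite cardsC1.
have cq : #|[set~ q]| = #|V|.-1 by rewrite cardsC1.
pose bk F := rev (belast p F).
pose G := [pred F | [&& F \in ipaths e q p [set~ p], (loss e q p [set~ p] F <= K)%N &
                     (loss e p q [set~ q] (bk F) <= K)%N]].
have over s F : F != [::] -> G (s ++ F) ->
    (#|nbs e F :\: av e p s| <= K0)%N.
  by move=> F0 /and3P[Fin l1 l2]; apply: overlap_bound Fin l1 l2 (deg _).
have markov (I : seq (seq V)) (f : seq V -> nat) :
    \sum_(F <- I) (101 / 100) ^+ f F <= t ^+ #|V|.-1 ->
    \sum_(F <- I) (~~ (f F <= K)%N)%:R <= eps / 4 * t ^+ #|V|.-1.
  move=> hI; have B0 : 0 < (101 / 100) ^+ K :> R by rewrite exprn_gt0 //; lra.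
  rewrite -(ler_pM2l B0); apply: le_trans (_ : \sum_(F <- I) (101 / 100) ^+ f F <= _).
    rewrite big_distrr /=; apply: ler_sum => F _; case: leqP => fK /=.
      by rewrite mulr0 exprn_ge0 //; lra.
    by rewrite mulr1 ler_weXn2l //; [lra | apply: ltnW].
  apply: le_trans hI _; rewrite mulrA ler_peMl ?exprn_ge0 ?(ltW t_gt0) //.
  by rewrite ltr_pdivrMr // in hK; lra.
have n0 : eps1 <= density e p q t G [::].
  have tn : 0 < t ^+ #|V|.-1 by rewrite exprn_gt0.
  rewrite /density /npaths /av /= cp ler_pdivlMr //.
  have : \sum_(F <- ipaths e q p [set~ p]) (101 / 100) ^+ loss e q p [set~ p] F <= t ^+ #|V|.-1.
    by rewrite -cp; apply: sum_loss_le.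
  move=> /markov lo1.
  have : \sum_(F <- ipaths e q p [set~ p]) (101 / 100) ^+ loss e p q [set~ q] (bk F) <= t ^+ #|V|.-1.
    rewrite -cq;
      apply: le_trans (_ : \sum_(F <- ipaths e p q [set~ q]) (101 / 100) ^+ loss e p q [set~ q] F
        <= _); last exact: sum_loss_le.
    rewrite -(big_map bk xpredT (fun F => (101 / 100) ^+ loss e p q [set~ q] F)).
    apply: sum_seq_le; rewrite ?ipaths_uniq //.
    - rewrite map_inj_in_uniq ?ipaths_uniq // => F F' Fin F'in /(can_inj revK) E.
      have : p :: F = p :: F'.
        by rewrite lastI [RHS]lastI E (ipaths_last p Fin) (ipaths_last p F'in).
      by case.
    - by move=> _ /mapP[F Fin ->]; apply: rev_ipaths.
    - by move=> F; rewrite exprn_ge0 //; lra.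
  move=> /markov lo2.
  have : (size (ipaths e q p [set~ p]))%:R <= (
    \sum_(F <- ipaths e q p [set~ p]) (G F)%:R +
    \sum_(F <- ipaths e q p [set~ p]) (~~ (loss e q p [set~ p] F <= K)%N)%:R +
    \sum_(F <- ipaths e q p [set~ p]) (~~ (loss e p q [set~ q] (bk F) <= K)%N)%:R : R).
    have -> : (size (ipaths e q p [set~ p]))%:R = \sum_(F <- ipaths e q p [set~ p]) (1 : R).
      by rewrite -sum1_size natr_sum.
    rewrite -!big_split /= big_seq [leRHS]big_seq; apply: ler_sum => F Fin.
    rewrite Fin; case: leqP => _ /=; case: leqP => _ /=; lra.
  rewrite /eps1; by move: sz lo1 lo2; lra.
have [|l0 [szl0 wl0 rl0 max0]] := @max_node V e p q R t t_gt0 t3 G Z d i [::] d0.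
  rewrite -(ler_pM2l (_ : 0 < (1 + d) ^+ i)) in n0; last by rewrite exprn_gt0 //; lra.
  by apply: lt_le_trans n0; rewrite -ltr_pdivrMr // div1r.
rewrite /= in rl0 max0.
have r0 : eps1 <= density e p q t G l0 by apply: le_trans rl0.
have r00 : 0 < density e p q t G l0 by apply: lt_le_trans r0.
have av0 : (m + 3 * Z <= #|av e p l0|)%N.
  have n0' : 0 < npaths e p q R G l0 by rewrite (npathsE e p q t_gt0) mulr_gt0 // exprn_gt0.
  case: (classic (exists2 F, F != [::] & G (l0 ++ F))) => [[F F0 /and3P[Fin lo _]]|nF].
    have [+ _] := loss_avail F0 Fin; rewrite cp -/(av e p l0) => h.
    have h3 : (3 * size l0 <= 3 * (i * Z))%N by rewrite leq_mul2l szl0.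
    by move: nV h h3 lo; clear; lia.
  move: n0'; rewrite ltNge /npaths big_seq big1 ?lexx // => F Fin.
  case: (boolP (G _)) => // GF; case: nF; exists F => //.
  by have [] := mem_ipaths Fin.
have hm' : 1 < density e p q t G l0 / 2 * t ^+ m.
  apply: lt_le_trans (_ : eps1 / 2 * t ^+ m <= _); last first.
    by rewrite ler_pM2r ?exprn_gt0 //; lra.
  by rewrite mulrC -ltr_pdivrMr ?div1r //; lra.
have [z0 zr] := zone_near t_gt0 t3 r00 (ltW d0) hd max0 hm' av0.
have bd l : walk e p l0 l -> (size l <= Z)%N -> (#|bdry e p (l0 ++ l)| <= K1)%N.
  move=> wl szl; apply: (@bdry_bound _ e p q e_sym R t t_gt0 t3 G K0 Dl K1 (eps1 / 2)) => //.
    by move=> F F0 _; apply: over.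
  rewrite (npathsE e p q t_gt0) ler_wpM2r ?exprn_ge0 ?(ltW t_gt0) //.
  by have := zr l wl szl; lra.
(* If a non-uniform node were always within reach, [k] discarded vertices with available neighbours
   would contradict the bound on the boundary. Otherwise all nodes within [M] steps below some node
   are uniform. *)
case: (classic (forall l, walk e p l0 l -> (size l <= H)%N ->
     exists2 l2, walk e p (l0 ++ l) l2 /\ (size l2 <= M)%N & ~ uniform e p (l0 ++ l ++ l2))).
  move=> nu; have [|l [X [wl szl cX dX per]]] := @not_uniform_iter V e p q M H H k l0 (leqnn H) z0 nu.
    by rewrite /H.
  have : (#|X| <= #|bdry e p (l0 ++ l)| * Dl)%N.
    apply: leq_trans (card_bigcup_le (f := nbhd e) (fun u _ => deg u)).
    apply/subset_leq_card/subsetP => a aX.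
    have [|u uA eau] := per [::] isT _ a aX; first by rewrite addn0.
    rewrite cats0 in uA; apply/bigcupP; exists u; last by rewrite inE e_sym.
    rewrite inE uA; apply/existsP; exists a; rewrite e_sym eau andbT.
    by rewrite (disjointFr dX aX).
  rewrite cX /k => h; have : (#|bdry e p (l0 ++ l)| * Dl <= K1 * Dl)%N.
    by rewrite leq_mul2r bd ?orbT //; move: szl; rewrite -/H /Z; clear; lia.
  by move: h; clear; lia.
move=> /not_all_ex_not[l nl].
have [wl nl2] := imply_to_and _ _ nl; have [szl nl3] := imply_to_and _ _ nl2.
apply: (@clusters_segment V e p q e_sym L K1 (l0 ++ l)).
- by apply: bd => //; move: szl; rewrite /Z; clear; lia.
- by apply: zone_walk => //; apply: zoneW z0; rewrite -/M /Z; move: szl; clear; lia.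
move=> l2 wl2 szl2; apply: NNPP => nu; apply: nl3; exists l2 => //.
by rewrite catA.
Qed.

End Config.

(** * Induced cycles through an edge *)

(** For [a = n %/ k.+1], Bernoulli's inequality bounds [x ^ n] below by [(a * (x - 1)) ^ k.+1],
    whose degree exceeds [k]. *)
Lemma poly_exp (R : archiRealFieldType) (x d : R) k : 1 < x -> 0 < d ->
  exists n0, forall n, (n0 <= n)%N -> n%:R ^+ k <= d * x ^+ n.
Proof.
move=> x1 d0; have y0 : 0 < x - 1 by lra.
pose C : R := (2 * k.+1)%:R ^+ k / (d * (x - 1) ^+ k.+1).
have C0 : 0 <= C by rewrite divr_ge0 ?exprn_ge0 ?ler0n // mulr_ge0 ?exprn_ge0 // ltW.
pose a0 := (Num.bound C).+1; exists (k.+1 * a0)%N => n n0.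
pose a := (n %/ k.+1)%N.
have aa0 : (a0 <= a)%N by rewrite leq_divRL // mulnC.
have na : (k.+1 * a <= n)%N by rewrite mulnC leq_trunc_div.
have na' : (n <= 2 * k.+1 * a)%N.
  have : (n < k.+1 * a.+1)%N by rewrite mulnC ltn_ceil.
  have : (k.+1 <= k.+1 * a)%N by rewrite leq_pmulr //; apply: leq_trans aa0.
  by rewrite mulnS; clear; lia.
apply: le_trans (_ : ((2 * k.+1)%:R * a%:R) ^+ k <= _).
  by rewrite lerXn2r ?nnegrE ?mulr_ge0 ?ler0n // -natrM ler_nat.
apply: le_trans (_ : d * ((x ^+ a) ^+ k.+1) <= _); last first.
  by rewrite ler_pM2l // -exprM mulnC ler_weXn2l // ltW.
apply: le_trans (_ : d * ((a%:R * (x - 1)) ^+ k.+1) <= _); last first.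
  rewrite ler_pM2l // lerXn2r ?nnegrE ?mulr_ge0 ?ler0n ?exprn_ge0 ?(ltW y0) //; first by lra.
  by apply: le_trans (bernoulli a x1); lra.
rewrite !exprMn mulrCA [a%:R ^+ k.+1]exprS -mulrA.
have Ca : C <= a%:R.
  apply: ltW; apply: lt_le_trans (archi_boundP C0) _; rewrite ler_nat.
  by apply: leq_trans aa0; rewrite /a0.
rewrite /C ler_pdivrMr ?mulr_gt0 ?exprn_gt0 // in Ca.
rewrite mulrC [X in _ <= a%:R * X]mulrA -mulrA mulrCA.
have ak : 0 <= a%:R ^+ k :> R by rewrite exprn_ge0 // ler0n.
have := ler_wpM2l ak Ca; congr (_ <= _); ring.
Qed.

Section CycleLists.

Variables (V : finType) (e : rel V).
Hypothesis e_simple : simple_graph e.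
Implicit Types (x y : V) (A S : {set V}).

Lemma simple_sym : symmetric e.
Proof. by move=> x y; apply/eqP; case/andP: e_simple => _ /forallP /(_ x) /forallP. Qed.

Lemma simple_irr x : e x x = false.
Proof. by case/andP: e_simple => /forallP /(_ x) /negPf. Qed.

Definition del_edge p q : rel V :=
  fun x y => e x y && ~~ [|| (x == p) && (y == q) | (x == q) && (y == p)].

Lemma del_edge_sym p q : symmetric (del_edge p q).
Proof.
move=> x y; rewrite /del_edge simple_sym.
by case: (x == p); case: (y == q); case: (x == q); case: (y == p); case: (e y x).
Qed.

Lemma cycle_walk S p : induces_cycle e S -> p \in S ->
  exists g : nat -> V, [/\ g 0%N = p,
    forall v, v \in S -> exists2 a, (a < #|S|)%N & v = g a,
    forall a, (a < #|S|)%N -> g a \in S &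
    forall a b, (a < #|S|)%N -> (b < #|S|)%N ->
      (g a = g b -> a = b) /\
      e (g a) (g b) = (b == a.+1 %% #|S|)%N || (a == b.+1 %% #|S|)%N].
Proof.
case/andP=> m2 /existsP[f /and3P[/injectiveP f_inj /eqP fS /forallP fe]].
have {}fe i j : e (f i) (f j) = cycle_adj i j by apply/eqP; move/forallP: (fe i).
have fS1 v : v \in S -> v \in f @: setT by rewrite fS.
have fS2 i : f i \in S by have := imset_f f (in_setT i); rewrite fS.
move=> /fS1/imsetP[i0 _ pE].
have m0 : (0 < #|S|)%N by apply: leq_trans m2.
pose idx a := Ordinal (ltn_pmod (i0 + a) m0).
have valD a b : (a < #|S|)%N -> (b < #|S|)%N -> ((i0 + a) %% #|S| == (i0 + b) %% #|S|)%N = (a == b).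
  by move=> aS bS; rewrite eqn_modDl !modn_small.
exists (fun a => f (idx a)); split.
- by rewrite pE; congr (f _); apply: val_inj; rewrite /= addn0 modn_small.
- move=> v /fS1/imsetP[j _ ->].
  exists ((j + (#|S| - i0)) %% #|S|)%N; first by rewrite ltn_pmod.
  congr (f _); apply: val_inj; rewrite /= modnDmr addnCA subnKC ?modnDr ?modn_small //.
  exact: ltnW.
- by move=> a _; apply: fS2.
move=> a b aS bS; split=> [/f_inj /(congr1 val) /= /eqP|]; first by rewrite valD // => /eqP.
rewrite fe /cycle_adj -!val_eqE /=.
have sE c : (((i0 + c) %% #|S|).+1 %% #|S| = (i0 + c.+1 %% #|S|) %% #|S|)%N.
  by rewrite modnDmr -addn1 modnDml addn1 addnS.
by rewrite !sE !valD ?ltn_pmod.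
Qed.

(** The rest of the cycle is a path with adjacent ends, which becomes induced once the edge [p q] is
    deleted. *)
Lemma cycle_ipath S p q A : induces_cycle e S -> p \in S -> q \in S -> e p q ->
  S :\ p \subset A ->
  exists F, [/\ F \in ipaths (del_edge p q) q p A, S = [set x in p :: F] &
               (size F).+1 = #|S|].
Proof.
move=> cS pS qS epq SA; have m2 : (2 < #|S|)%N by case/andP: cS.
have [g0 [g0p g0S g0in g0e]] := cycle_walk cS pS.
set m := #|S| in m2 g0S g0in g0e *.
have m0 : (0 < m)%N by apply: leq_trans m2.
have sm a : (a < m)%N -> (a.+1 %% m)%N = if a.+1 == m then 0%N else a.+1.
  rewrite leq_eqVlt; case: eqP => [->|_] /=; first by rewrite modnn.
  by move/modn_small.
have [g [gp gq gS gin ge]] : exists g : nat -> V, [/\ g 0%N = p, g m.-1 = q,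
    forall v, v \in S -> exists2 a, (a < m)%N & v = g a,
    forall a, (a < m)%N -> g a \in S &
    forall a b, (a < m)%N -> (b < m)%N ->
      (g a = g b -> a = b) /\
      e (g a) (g b) = (b == a.+1 %% m)%N || (a == b.+1 %% m)%N].
  have [a am qE] := g0S q qS.
  move: epq; rewrite -g0p qE; have [_ ->] := g0e 0%N a m0 am.
  rewrite !sm // => /orP[a1|aN]; last first.
    exists g0; split=> //; rewrite ?qE //; congr (g0 _).
    by move: aN am m2; clear; case: ifP => [/eqP <- //|_] //.
  have {}a1 : a = 1%N by move: a1 m2; clear; case: ifP => [/eqP <- //|_ /eqP -> //].
  (* The cycle has to be traversed so that [q] comes last; here it comes second, so the direction is
     reversed. *)
  pose r b := if b == 0%N then 0%N else (m - b)%N.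
  have rm b : (b < m)%N -> (r b < m)%N by rewrite /r; case: eqP => //; lia.
  exists (fun b => g0 (r b)); split; first by rewrite /r.
  - rewrite a1; congr (g0 _); rewrite /r; move: m2; clear; case: eqP; lia.
  - move=> v /g0S[b bm ->]; exists (r b); first exact: rm.
    by congr (g0 _); rewrite /r; move: bm; clear; case: (b =P 0%N) => [-> //|]; case: eqP; lia.
  - by move=> b bm; apply/g0in/rm.
  move=> b c bm cm; have [inj ->] := g0e _ _ (rm b bm) (rm c cm); split.
    by move/inj; rewrite /r; move: bm cm; clear; case: eqP; case: eqP; lia.
  rewrite !sm ?rm //; move: bm cm m2; rewrite /r; clear.
  move=> bm cm m2; apply/idP/idP; do ![case: ifP]; lia.
have g_inj a b : (a < m)%N -> (b < m)%N -> g a = g b -> a = b by move=> am bm; have [] := ge a b am bm.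
have qp : q != p by apply: contraTneq epq => ->; rewrite simple_irr.
pose F := [seq g i | i <- iota 1 m.-1].
have szF : (size F).+1 = m by rewrite size_map size_iota prednK.
have nthF x i : (i < m)%N -> nth x (p :: F) i = g i.
  move=> im; have -> : p :: F = [seq g i | i <- iota 0 m].
    by rewrite -(prednK m0) /= gp.
  by rewrite (nth_map 0%N) ?size_iota // nth_iota.
exists F; split=> //; last first.
  apply/setP => v; rewrite inE; apply/idP/idP => [/gS[a am ->]|].
    by rewrite -(nthF p) // mem_nth //= szF.
  by case/(nthP p) => i; rewrite /= szF => im <-; rewrite nthF // gin.
apply/ipathsP.
- by apply: (subsetP SA); rewrite !inE qp.
- exact: qp.
split.
- by rewrite (last_nth p) nthF -?gq -?szF.
- move=> v /mapP[i]; rewrite mem_iota => im ->; apply: (subsetP SA).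
  have im' : (i < m)%N by move: im m0; clear; lia.
  rewrite !inE gin // andbT -gp; apply/eqP => /g_inj E.
  by have := E im' m0; move: im; clear; lia.
move=> i j /andP[ij jm]; rewrite -ltnS szF in jm.
have im : (i < m)%N by apply: ltn_trans jm.
rewrite !nthF // /del_edge; have [_ ->] := ge i j im jm.
have gE a b : (a < m)%N -> (b < m)%N -> (g a == g b) = (a == b).
  by move=> am bm; apply/eqP/eqP => [/g_inj|-> //]; apply.
have m1 : (m.-1 < m)%N by rewrite prednK.
rewrite -gp -gq !gE // !sm //; move: ij jm m2; clear => ij jm m2.
by apply/idP/idP; do ![case: ifP]; lia.
Qed.

Variables (R : archiRealFieldType) (t : R).
Hypotheses (t_gt0 : 0 < t) (t3 : t ^+ 3 = 3).

Definition cycles A := [set S | induces_cycle e S & S \subset A].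

Lemma card_list_le (I : eqType) (s : seq I) (f : I -> {set V}) (X : {set {set V}}) :
  (forall S, S \in X -> exists2 F, F \in s & S = f F) -> (#|X| <= size s)%N.
Proof.
move=> Xs; rewrite -(size_map f); apply: leq_trans (card_size _).
by apply/subset_leq_card/subsetP => S /Xs[F Fs ->]; apply: map_f.
Qed.

(** With [d] the degree of [p] in [A], the first step has [d - 1] choices besides [q] and leaves
    [#|A| - d] vertices. *)
Lemma edge_cycles_le A p q : e p q -> p \in A -> q \in A ->
  (#|[set S in cycles A | (p \in S) && (q \in S)]|%:R : R) <=
  #|nbhd e p :&: A|%:R * t ^+ (#|A| - #|nbhd e p :&: A|).
Proof.
move=> epq pA qA; set d := #|nbhd e p :&: A|.
apply: le_trans (_ : (size (ipaths (del_edge p q) q p (A :\ p)))%:R <= _).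
  rewrite ler_nat; apply: (@card_list_le _ _ (fun F => [set x in p :: F])) => S.
  rewrite !inE => /andP[/andP[cS SA] /andP[pS qS]].
  by have [F [Fin -> _]] := cycle_ipath cS pS qS epq (setSD _ SA); exists F.
have dE : #|fwd (del_edge p q) p (A :\ p)| = d.-1.
  rewrite /d (cardsD1 q (nbhd e p :&: A)) !inE epq qA /=.
  apply: eq_card => y; rewrite !inE /del_edge eqxx /=.
  case: (eqVneq y p) => [->|yp] /=; first by rewrite simple_irr !andbF.
  by case: (p == q); case: (y == q); case: (e p y); case: (y \in A).
have qn : q \notin fwd (del_edge p q) p (A :\ p).
  by rewrite !inE /del_edge !eqxx /= !andbF.
have d0 : (0 < d)%N by rewrite card_gt0; apply/set0Pn; exists q; rewrite !inE epq.
have dA : (d <= #|A|)%N by rewrite subset_leq_card // subsetIr.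
rewrite -sum1_size natr_sum sum_ipaths //.
apply: le_trans (_ : \sum_(y in fwd (del_edge p q) p (A :\ p)) t ^+ (#|A| - d) <= _).
  apply: ler_sum => y _; rewrite -natr_sum sum1_size.
  apply: le_trans (size_ipaths_le _ _ t_gt0 t3 _ _) _.
  have := card_fwdD (del_edge p q) p (A :\ p); rewrite dE.
  have := cardsD1 p A; rewrite pA /= => h1 h2.
  suff -> : #|A :\ p :\: fwd (del_edge p q) p (A :\ p)| = (#|A| - d)%N by [].
  by move: h1 h2 d0 dA; clear; lia.
rewrite sumr_const dE -[t ^+ _ *+ _]mulr_natl ler_wpM2r ?exprn_ge0 ?(ltW t_gt0) // ler_nat.
exact: leq_pred.
Qed.

Lemma cycle_nbr S x : induces_cycle e S -> x \in S -> exists2 y, y \in S & e x y.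
Proof.
move=> cS xS; have m2 : (2 < #|S|)%N by case/andP: cS.
have [g [g0 _ gin ge]] := cycle_walk cS xS.
have h1 : (1 < #|S|)%N by apply: ltn_trans m2.
have h0 : (0 < #|S|)%N by apply: ltn_trans m2.
exists (g 1%N); first exact: gin.
by rewrite -g0; have [_ ->] := ge 0%N 1%N h0 h1; rewrite modn_small.
Qed.

Lemma vertex_cycles_sum A p : p \in A ->
  (#|[set S in cycles A | p \in S]| <=
   \sum_(q in nbhd e p :&: A) #|[set S in cycles A | (p \in S) && (q \in S)]|)%N.
Proof.
move=> pA; apply: leq_trans (_ : #|\bigcup_(q in nbhd e p :&: A)
     [set S in cycles A | (p \in S) && (q \in S)]| <= _)%N; last exact: card_bigcup_sum.
apply/subset_leq_card/subsetP => S; rewrite !inE => /andP[/andP[cS SA] pS].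
have [q qS epq] := cycle_nbr cS pS; apply/bigcupP; exists q.
  by rewrite !inE epq (subsetP SA).
by rewrite !inE cS SA pS qS.
Qed.

Lemma vertex_cycles_le A p : p \in A ->
  (#|[set S in cycles A | p \in S]|%:R : R) <=
  #|nbhd e p :&: A|%:R ^+ 2 * t ^+ (#|A| - #|nbhd e p :&: A|).
Proof.
move=> pA; set d := #|nbhd e p :&: A|.
apply: le_trans (_ : (\sum_(q in nbhd e p :&: A)
  #|[set S in cycles A | (p \in S) && (q \in S)]|)%:R <= _).
  by rewrite ler_nat vertex_cycles_sum.
rewrite natr_sum; apply: le_trans (_ : \sum_(q in nbhd e p :&: A) d%:R * t ^+ (#|A| - d) <= _).
  by apply: ler_sum => q; rewrite !inE => /andP[epq qA]; apply: edge_cycles_le.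
by rewrite sumr_const -/d -[_ *+ d]mulr_natl expr2 mulrA.
Qed.

(** Deleting one vertex costs at most [5 * t ^ #|A|] cycles by [vertex_cycles_le] and [sq_le_tpow];
    the constant 17 satisfies [17 / 1.44 + 5 <= 17]. *)
Lemma cycles_le A : (#|cycles A|%:R : R) <= 17 * t ^+ #|A|.
Proof.
have /andP[t1 _] := t_bounds t_gt0 t3.
elim: {A}#|A| {-2}A (erefl #|A|) => [|n IH] A cA.
  rewrite (_ : cycles A = set0) ?cards0 ?mulr_ge0 ?exprn_ge0 ?(ltW t_gt0) //.
  apply/setP => S; rewrite !inE (cards0_eq cA) subset0; apply/negP => /andP[cS /eqP S0].
  by move: cS; rewrite S0 /induces_cycle cards0.
have [p pA] : exists p, p \in A by apply/card_gt0P; rewrite cA.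
have cA' : #|A :\ p| = n by have := cardsD1 p A; rewrite pA cA => -[].
have split_le : (#|cycles A| <= #|cycles (A :\ p)| + #|[set S in cycles A | p \in S]|)%N.
  apply: leq_trans (leq_card_setU _ _); apply/subset_leq_card/subsetP => S.
  rewrite !inE => /andP[-> SA]; rewrite SA /=.
  by case: (boolP (p \in S)) => pS; rewrite ?orbT // subsetD1 SA pS.
apply: le_trans (_ : (#|cycles (A :\ p)| + #|[set S in cycles A | p \in S]|)%:R <= _).
  by rewrite ler_nat.
rewrite natrD; have h1 := IH _ cA'; rewrite cA' in h1.
have h2 := vertex_cycles_le pA; set d := #|_ :&: A| in h2.
have dA : (d <= n.+1)%N by rewrite -cA subset_leq_card // subsetIr.
have h3 : d%:R ^+ 2 * t ^+ (#|A| - d) <= 5 * t ^+ n.+1.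
  rewrite cA -[in leRHS](subnKC dA) exprD mulrA ler_wpM2r ?exprn_ge0 ?(ltW t_gt0) //.
  exact: sq_le_tpow.
have : (144 / 100) * t ^+ n <= t ^+ n.+1 by rewrite exprS ler_wpM2r ?exprn_ge0 ?(ltW t_gt0) // ltW.
rewrite cA; move: h1 h2 h3; set u := t ^+ n; set v := t ^+ n.+1.
have u0 : 0 <= u by rewrite exprn_ge0 // ltW.
by move: u0; clear; lra.
Qed.

(** At three vertices per step, a cycle with at most [n / 6] vertices accounts for only half of the
    graph. The other half is wasted on the way or left over at the end, and both are bounded by
    [loss], which is therefore about [n / 4] or more. *)
Lemma short_cycles_le :
  (#|[set S in cycles [set: V] | (6 * #|S| <= #|V|)%N]|%:R : R) * (101 / 100) ^+ ((#|V| - 2) %/ 4)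
    <= #|V|%:R ^+ 2 * t ^+ #|V|.
Proof.
pose X := [set S in cycles [set: V] | (6 * #|S| <= #|V|)%N].
pose Y (z : V * V) := [set S in X | [&& e z.1 z.2, z.1 \in S & z.2 \in S]].
have B0 : 0 < (101 / 100) ^+ ((#|V| - 2) %/ 4) :> R by rewrite exprn_gt0 //; lra.
have XY : (#|X| <= \sum_(z : V * V) #|Y z|)%N.
  apply: leq_trans (_ : #|\bigcup_(z : V * V) Y z| <= _)%N; last exact: card_bigcup_sum.
  apply/subset_leq_card/subsetP => S; rewrite inE => /andP[cS sS].
  move: (cS); rewrite inE => /andP[cS' _]; have : (0 < #|S|)%N by case/andP: cS'; case: #|S|.
  case/card_gt0P=> x xS; have [y yS exy] := cycle_nbr cS' xS.
  by apply/bigcupP; exists (x, y) => //; rewrite !inE cS' subsetT sS exy xS yS.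
have YB z : (#|Y z|%:R : R) * (101 / 100) ^+ ((#|V| - 2) %/ 4) <= t ^+ #|V|.
  case: (boolP (e z.1 z.2)) => ez; last first.
    rewrite (_ : Y z = set0) ?cards0 ?mul0r ?exprn_ge0 ?(ltW t_gt0) //.
    by apply/setP => S; rewrite !inE (negPf ez) andbF.
  set q := z.2; set p := z.1; set e' := del_edge p q.
  pose s := [seq F <- ipaths e' q p [set~ p] | (6 * (size F).+1 <= #|V|)%N].
  apply: le_trans (_ : (size s)%:R * (101 / 100) ^+ ((#|V| - 2) %/ 4) <= _).
    rewrite ler_wpM2r ?(ltW B0) // ler_nat.
    apply: (@card_list_le _ _ (fun F => [set x in p :: F])) => S.
    rewrite !inE => /andP[/andP[/andP[cS _] sS] /and3P[_ pS qS]].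
    have [|F [Fin SE szF]] := cycle_ipath (A := [set~ p]) cS pS qS ez.
      by apply/subsetP => x; rewrite !inE => /andP[].
    by exists F => //; rewrite mem_filter Fin szF sS.
  apply: le_trans (_ : t ^+ #|[set~ p]| <= _); last first.
    by rewrite ler_weXn2l ?max_card // (t_ge1 t_gt0 t3).
  apply: le_trans (sum_loss_le e' q t_gt0 t3 p [set~ p]).
  rewrite -sum1_size natr_sum big_distrl big_filter big_mkcond /=.
  rewrite big_seq [leRHS]big_seq; apply: ler_sum => F Fin.
  case: ifP => [szF|_]; last by rewrite exprn_ge0 //; lra.
  rewrite mul1r ler_weXn2l //; first by lra.
  have [F0 _] := mem_ipaths Fin; case/lastP: F F0 Fin szF => // F y _ Fin szF.
  have := loss_end Fin; have := @loss_avail _ e' q p [set~ p] F [:: y] isT.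
  rewrite cats1 => /(_ Fin)[+ _] h2; have -> : #|[set~ p]| = (#|V| - 1)%N by rewrite cardsC1 subn1.
  move: h2 szF; rewrite size_rcons; move: (loss _ _ _ _ _) #|avail _ _ _ _| (#|V|) (size F).
  by clear; lia.
rewrite -/X; apply: le_trans (_ : (\sum_(z : V * V) #|Y z|)%:R * (101 / 100) ^+ ((#|V| - 2) %/ 4) <= _).
  by rewrite ler_wpM2r ?(ltW B0) // ler_nat.
rewrite natr_sum big_distrl /=; apply: le_trans (_ : \sum_(z : V * V) t ^+ #|V| <= _).
  by apply: ler_sum => z _; apply: YB.
by rewrite sumr_const card_prod -[_ *+ _]mulr_natl natrM expr2.
Qed.

End CycleLists.

(** * Extremal graphs *)

Lemma induces_cycleI (V : finType) (e : rel V) m (f : 'I_m -> V) :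
  (2 < m)%N -> injective f -> (forall i j, e (f i) (f j) = cycle_adj i j) ->
  induces_cycle e [set f i | i : 'I_m].
Proof.
move=> m2 f_inj fe; set S := [set f i | i : 'I_m].
have cS : #|S| = m by rewrite card_imset // card_ord.
rewrite /induces_cycle cS m2 /=.
suff [g gP] : exists g : {ffun 'I_m -> V}, [&& injectiveb g, g @: setT == S &
    [forall i, forall j, e (g i) (g j) == cycle_adj i j]] by apply/existsP; exists g.
exists (finfun f); apply/and3P; split.
- by apply/injectiveP => i j; rewrite !ffunE => /f_inj.
- apply/eqP/setP => v; apply/imsetP/imsetP => -[i _ ->]; exists i; rewrite ?ffunE //.
by apply/forallP => i; apply/forallP => j; rewrite !ffunE fe.
Qed.

Lemma induces_cycleE (V : finType) (e : rel V) S : induces_cycle e S ->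
  exists f : 'I_#|S| -> V, [/\ (2 < #|S|)%N, injective f, S = [set f i | i : 'I_#|S|] &
    forall i j, e (f i) (f j) = cycle_adj i j].
Proof.
case/andP=> m2 /existsP[f /and3P[/injectiveP f_inj /eqP fS /forallP fe]].
exists f; split=> //.
  by rewrite -[LHS]fS; apply/setP => v; apply/imsetP/imsetP => -[i _ ->]; exists i.
by move=> i j; apply/eqP; move/forallP: (fe i).
Qed.

Lemma induces_cycle_img (V W : finType) (e : rel V) (g : rel W) (h : V -> W) (S : {set V}) :
  {in S &, injective h} -> {in S &, forall u v, g (h u) (h v) = e u v} ->
  induces_cycle e S -> induces_cycle g (h @: S) && (#|h @: S| == #|S|).
Proof.
move=> h_inj hg cS; rewrite card_in_imset // eqxx andbT.
have [f [m2 f_inj SE fe]] := induces_cycleE cS.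
have fS i : f i \in S by rewrite [in X in _ \in X]SE imset_f.
have -> : h @: S = [set h (f i) | i : 'I_#|S|].
  by rewrite [in LHS]SE -imset_comp.
apply: induces_cycleI => //.
  by move=> i j /h_inj /f_inj; apply; apply: fS.
by move=> i j; rewrite hg ?fe.
Qed.

Section Cloning.

Variables (V : finType) (e : rel V).
Implicit Types (x y : V) (S : {set V}).

Definition even_cycles := [set S : {set V} | induces_cycle e S && ~~ odd #|S|].

Definition extremal := simple_graph e /\
  forall g : rel V, simple_graph g -> (nb_induced_even_cycles g <= nb_induced_even_cycles e)%N.

Hypothesis e_ext : extremal.

(* Compare [e] with the graph in which [x] is replaced by a nonadjacent twin of [y]. *)
Lemma clone_le x y : x != y ->
  (#|[set S in even_cycles | (y \in S) && (x \notin S)]| <=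
   #|[set S in even_cycles | x \in S]|)%N.
Proof.
case: e_ext => e_simple max xy.
pose phi u := if u == x then y else u.
pose g u v := e (phi u) (phi v).
pose psi u := if u == y then x else u.
have g_simple : simple_graph g.
  apply/andP; split; first by apply/forallP => u; rewrite /g simple_irr.
  by apply/forallP => u; apply/forallP => v; rewrite /g (simple_sym e_simple).
have phiK u : u != x -> phi (psi u) = u.
  rewrite /phi /psi; case: (eqVneq u y) => [->|uy] ux; first by rewrite eqxx.
  by rewrite (negPf ux).
have := max g g_simple; rewrite /nb_induced_even_cycles.
set A1 := [set S in even_cycles | x \notin S].
set A2 := [set S in even_cycles | _ && _]; set A3 := [set S in even_cycles | x \in S].
have -> : #|[set S | induces_cycle e S && ~~ odd #|S|]| = (#|A3| + #|A1|)%N.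
  rewrite -/even_cycles -(cardsID [set S : {set V} | x \in S]); congr (_ + _)%N.
    by apply: eq_card => S; rewrite !inE.
  by apply: eq_card => S; rewrite !inE andbC.
rewrite addnC => le_g; rewrite -(leq_add2l #|A1|); apply: leq_trans le_g.
have xS (S : {set V}) u : S \in A2 -> u \in S -> u != x.
  by rewrite inE => /and3P[_ _ xS] uS; apply: contraNneq xS => <-.
have psi_inj : {in A2 &, injective (fun S : {set V} => psi @: S)}.
  move=> S S' SA S'A E; have K (T : {set V}) : T \in A2 -> phi @: (psi @: T) = T.
    move=> TA; rewrite -imset_comp -[RHS]imset_id; apply: eq_in_imset => u uT /=.
    by rewrite phiK // (xS T).
  by rewrite -(K S) // E K.
rewrite -(card_in_imset psi_inj) -[X in (X <= _)%N]cardsUI.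
have -> : A1 :&: [set psi @: (S : {set V}) | S in A2] = set0.
  apply/setP => S; rewrite !inE; apply/negP => /andP[/andP[_ xnS] /imsetP[T TA ST]].
  case/negP: xnS; rewrite ST; apply/imsetP; exists y; last by rewrite /psi eqxx.
  by move: TA; rewrite inE => /and3P[].
rewrite cards0 addn0; apply/subset_leq_card/subsetP => S; rewrite in_setU => /orP[].
  rewrite !inE => /andP[/andP[cS oS] xnS].
  have hg : {in S &, forall u v, g (id u) (id v) = e u v}.
    move=> u v uS vS; rewrite /g /phi.
    by rewrite (negPf (memPn xnS u uS)) (negPf (memPn xnS v vS)).
  by have := induces_cycle_img (in2W (fun _ _ => id)) hg cS; rewrite imset_id oS => /andP[->].
case/imsetP=> T TA ->; move: (TA); rewrite !inE => /and3P[/andP[cT oT] yT xnT].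
have psi_injT : {in T &, injective psi}.
  by move=> u v uT vT E; rewrite -(phiK u) ?(xS T) // E phiK ?(xS T).
have hg : {in T &, forall u v, g (psi u) (psi v) = e u v}.
  by move=> u v uT vT; rewrite /g !phiK ?(xS T).
by have /andP[-> /eqP ->] := induces_cycle_img psi_injT hg cT.
Qed.

(** Let [c] be the number of even cycles through [x]. By [clone_le] every other vertex lies in at
    most [c] even cycles avoiding [x], so the sizes of these cycles add up to at most [#|V| * c],
    and at most [6 * c] of them have more than [#|V| / 6] vertices. *)
Lemma extremal_vertex x : (0 < #|V|)%N ->
  (nb_induced_even_cycles e <= 7 * #|[set S in even_cycles | x \in S]| +
     #|[set S in cycles e [set: V] | 6 * #|S| <= #|V|]|)%N.
Proof.
move=> V0; set c := #|[set S in even_cycles | x \in S]|; set sh := #|_|.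
pose A1 := [set S in even_cycles | x \notin S].
pose lg := [set S in A1 | (#|V| < 6 * #|S|)%N].
have split1 : nb_induced_even_cycles e = (c + #|A1|)%N.
  rewrite /nb_induced_even_cycles -/even_cycles -(cardsID [set S : {set V} | x \in S]).
  by congr (_ + _)%N; apply: eq_card => S; rewrite !inE // andbC.
have split2 : (#|A1| <= #|lg| + sh)%N.
  apply: leq_trans (leq_card_setU _ _); apply/subset_leq_card/subsetP => S.
  rewrite !inE => /andP[/andP[cS oS] xS]; rewrite cS oS xS subsetT /=.
  by case: leqP.
have dc : (\sum_(S in A1) #|S| <= #|V| * c)%N.
  have -> : (\sum_(S in A1) #|S| = \sum_(y : V) #|[set S in A1 | y \in S]|)%N.
    rewrite (eq_bigr (fun S : {set V} => \sum_(y in S) 1)%N); last by move=> S _; rewrite sum1_card.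
    rewrite (exchange_big_dep xpredT) //=; apply: eq_bigr => y _.
    by rewrite -[RHS]sum1_card; apply: eq_bigl => S; rewrite [RHS]in_set.
  rewrite -sum_nat_const; apply: leq_sum => y _; case: (eqVneq x y) => [<-|xy].
    rewrite (_ : [set S in A1 | x \in S] = set0) ?cards0 //.
    by apply/setP => S; rewrite !inE; case: (x \in S); rewrite ?andbF.
  apply: leq_trans (clone_le xy); apply/subset_leq_card/subsetP => S.
  by rewrite !inE => /andP[/andP[-> ->] ->].
have : (#|V| * #|lg| <= #|V| * (6 * c))%N.
  rewrite mulnCA; apply: leq_trans (_ : 6 * \sum_(S in A1) #|S| <= _)%N; last by rewrite leq_mul2l dc.
  rewrite big_distrr /= mulnC -sum_nat_const.
  rewrite [leqRHS](bigID (fun S : {set V} => #|V| < 6 * #|S|)%N) /=.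
  apply: leq_trans (leq_addr _ _); rewrite big_mkcond [leqRHS]big_mkcond.
  by apply: leq_sum => S _; rewrite inE; case: ifP => // /andP[_ /ltnW].
rewrite leq_pmul2l // split1; move: split2; clear; lia.
Qed.

End Cloning.

Section ExtremalSegment.

Variables (R : archiRealFieldType) (t : R).
Hypotheses (t_gt0 : 0 < t) (t3 : t ^+ 3 = 3).

Lemma extremal_segment L : exists n2, forall (V : finType) (e : rel V),
  extremal e -> (n2 <= #|V|)%N -> t ^+ #|V| / 2 <= (nb_induced_even_cycles e)%:R ->
  exists T, segment e L T.
Proof.
have /andP[t1 _] := t_bounds t_gt0 t3.
(* With [a = (n - 2) %/ 4] and [n <= 9 * a], the constant [324 = 4 * 81] makes the short cycles at
   most a quarter of [t ^ n]. *)
have [a0 ha0] : exists a0, forall a, (a0 <= a)%N -> a%:R ^+ 2 <= (1 / 324) * (101 / 100) ^+ a :> R.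
  by apply: poly_exp; lra.
(* Every vertex lies in at least [t ^ n / 28] even cycles, where [1 / 28 = (1 / 2 - 1 / 4) / 7]; one
   of degree at least [Dl] would lie in at most [t ^ n / 29]. *)
have [Dl hDl] : exists D, forall d, (D <= d)%N -> d%:R ^+ 2 <= (1 / 29) * t ^+ d.
  by apply: poly_exp; lra.
have Dl0 : 0 < Dl.+1%:R :> R by rewrite ltr0n.
pose eps : R := 1 / 28 / Dl.+1%:R.
have eps0 : 0 < eps by rewrite divr_gt0 //; lra.
have [n1 hn1] := @config_segment R t t_gt0 t3 eps Dl L eps0.
exists (n1 + 4 * a0 + 10)%N => V e e_ext nV fe; have [e_simple _] := e_ext.
have V0 : (0 < #|V|)%N by apply: leq_trans nV; rewrite addnS.
set n := #|V| in nV fe V0 *.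
have tn k : 0 < t ^+ k by rewrite exprn_gt0.
have short : #|[set S in cycles e [set: V] | (6 * #|S| <= n)%N]|%:R <= t ^+ n / 4.
  have := short_cycles_le e_simple t_gt0 t3; rewrite -/n.
  set sh := _%:R; set a := ((n - 2) %/ 4)%N; set B := _ ^+ a => hsh.
  have B0 : 0 < B by rewrite exprn_gt0 //; lra.
  have aa0 : (a0 <= a)%N by rewrite /a leq_divRL //; move: nV; clear; lia.
  have na : (n <= 9 * a)%N.
    have : (1 <= a)%N by rewrite /a leq_divRL //; move: nV; clear; lia.
    by rewrite /a; clear; lia.
  rewrite -(ler_pM2r B0); apply: le_trans hsh _.
  have h9 : n%:R ^+ 2 <= 81 * a%:R ^+ 2 :> R.
    have -> : 81 * a%:R ^+ 2 = (9 * a%:R) ^+ 2 :> R by ring.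
    by rewrite lerXn2r ?nnegrE ?mulr_ge0 ?ler0n // -natrM ler_nat.
  have ha := ha0 a aa0; rewrite -/B in ha.
  have -> : t ^+ n / 4 * B = (B / 4) * t ^+ n by ring.
  by rewrite ler_pM2r //; lra.
have cx x : t ^+ n / 28 <= #|[set S in even_cycles e | x \in S]|%:R.
  have := extremal_vertex e_ext x V0; rewrite -/n -(ler_nat R) natrD natrM.
  by have := tn n; lra.
have cx' x : #|[set S in even_cycles e | x \in S]|%:R <=
             #|[set S in cycles e [set: V] | x \in S]|%:R :> R.
  rewrite ler_nat; apply/subset_leq_card/subsetP => S.
  by rewrite !inE subsetT andbT => /andP[/andP[-> _] ->].
have deg x : (#|nbhd e x| < Dl)%N.
  rewrite ltnNge; apply/negP => dx; have := hDl _ dx.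
  have := vertex_cycles_le e_simple t_gt0 t3 (in_setT x).
  rewrite setIT cardsT -/n; set d := #|nbhd e x|.
  have dn : (d <= n)%N by rewrite max_card.
  move=> h1 h2; have h3 : d%:R ^+ 2 * t ^+ (n - d) <= t ^+ n / 29.
    have -> : t ^+ n / 29 = (1 / 29 * t ^+ d) * t ^+ (n - d).
      by rewrite -{1}(subnKC dn) exprD; ring.
    by rewrite ler_pM2r.
  have := cx x; have := cx' x; have := tn n; move: h1 h3; clear; lra.
have [x _] : exists x : V, true by case/card_gt0P: V0 => x; exists x.
have [z exz hz] : exists2 z, e x z &
    eps * t ^+ n.-1 <= (size (ipaths (del_edge e x z) z x [set~ x]))%:R.
  apply: NNPP => nex.
  have : #|[set S in cycles e [set: V] | x \in S]|%:R <= Dl%:R * (eps * t ^+ n.-1).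
    apply: le_trans (_ : (\sum_(z in nbhd e x :&: [set: V])
      #|[set S in cycles e [set: V] | (x \in S) && (z \in S)]|)%:R <= _).
      by rewrite ler_nat (vertex_cycles_sum e (in_setT x)).
    rewrite natr_sum setIT; apply: le_trans (_ : \sum_(z in nbhd e x) (eps * t ^+ n.-1) <= _).
      apply: ler_sum => z; rewrite inE => exz;
        apply: le_trans (_ : (size (ipaths (del_edge e x z) z x [set~ x]))%:R <= _).
        rewrite ler_nat; apply: (@card_list_le _ _ _ (fun F => [set v in x :: F])) => S.
        rewrite !inE => /andP[/andP[cS _] /andP[xS zS]].
        have [|F [Fin SE _]] := cycle_ipath e_simple (A := [set~ x]) cS xS zS exz.
          by apply/subsetP => v; rewrite !inE => /andP[].
        by exists F.
      by rewrite leNgt; apply/negP => h; apply: nex; exists z => //; apply: ltW.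
    have et : 0 <= eps * t ^+ n.-1 by apply: mulr_ge0; apply: ltW.
    by rewrite sumr_const -[_ *+ #|_|]mulr_natl ler_wpM2r // ler_nat ltnW.
  apply/negP; rewrite -ltNge; apply: lt_le_trans (cx' x); apply: lt_le_trans (cx x).
  apply: lt_le_trans (_ : Dl.+1%:R * (eps * t ^+ n.-1) <= _).
    by rewrite ltr_pM2r ?ltr_nat //; apply: mulr_gt0.
  have -> : Dl.+1%:R * (eps * t ^+ n.-1) = t ^+ n.-1 / 28.
    by move: Dl0; rewrite /eps; move: (Dl.+1%:R) => D D0; field; rewrite gt_eqF.
  rewrite ler_pM2r ?invr_gt0 ?ltr0n //.
  by rewrite ler_weXn2l ?leq_pred //; lra.
have xz : x != z by apply: contraTneq exz => ->; rewrite simple_irr.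
have [|||||T segT Txz] := hn1 V (del_edge e x z) x z.
- exact: del_edge_sym.
- exact: xz.
- move=> v; apply: leq_trans (ltnW (deg v)); apply/subset_leq_card/subsetP => w.
  by rewrite !inE => /andP[].
- by move: nV; clear; lia.
- exact: hz.
exists T; case: segT => T3 Td Te; split=> // i u v iL uT.
have [uv vu] := Te i u v iL uT; have iL' : (i <= L.+1)%N by case/andP: iL => _ /leqW.
have [xT zT] := Txz i iL'.
(* The segment avoids [x] and [z], so restoring the edge changes nothing for its vertices. *)
have E : del_edge e x z u v = e u v.
  rewrite /del_edge; case: (eqVneq u x) => [ux|_]; first by rewrite -ux uT in xT.
  by case: (eqVneq u z) => [uz|_]; [rewrite -uz uT in zT | rewrite andbT].
by rewrite E in uv vu.
Qed.

End ExtremalSegment.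

(** * Optimal products *)

(* [opt u d]: a cluster of size [d] may occur in an optimal product of an even
   number of clusters with total size [u] modulo 6; each cluster shifts [u] by
   [3 - d], and [5 * d] is [- d] modulo 6. *)
Definition opt (u d : nat) : bool :=
  (d == 3) || match (u %% 6)%N with
              | 0 => false | 1 => d == 4 | 2 => (d == 4) || (d == 2) | _ => d == 2 end.

Fixpoint optseq (u : nat) (ds : seq nat) : bool :=
  if ds is d :: ds' then opt u d && optseq (u + 3 + 5 * d) ds' else (u %% 6 == 0)%N.

Section Optimum.

Variables (R : realFieldType) (t : R).
Hypotheses (t_gt0 : 0 < t) (t3 : t ^+ 3 = 3).

(* The largest value of a product of an even number of parts with sum [n],
   divided by [t ^+ n], depends only on [n] modulo 6. *)
Definition optval (u : nat) : R :=
  match (u %% 6)%N with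
  | 0 => 1 | 1 => 4 / 9 * t ^+ 2 | 2 => 16 / 27 * t | 3 => 8 / 9
  | 4 => 4 / 9 * t ^+ 2 | _ => 2 / 3 * t end.

Lemma optval_mod u v : u = v %[mod 6] -> optval u = optval v.
Proof. by rewrite /optval => ->. Qed.

Lemma opt_mod u v d : u = v %[mod 6] -> opt u d = opt v d.
Proof. by rewrite /opt => ->. Qed.

Lemma optseq_mod u v ds : u = v %[mod 6] -> optseq u ds = optseq v ds.
Proof.
elim: ds u v => [|d ds IH] u v uv /=; first by rewrite uv.
rewrite (opt_mod d uv) (IH (u + 3 + 5 * d)%N (v + 3 + 5 * d)%N) //.
by rewrite -!addnA -modnDml uv modnDml.
Qed.

Lemma optval_bounds u : 85 / 100 <= optval u <= 1.
Proof.
have /andP[t1 t1'] := t_bounds t_gt0 t3; have /andP[t2 t2'] := t2_bounds t_gt0 t3.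
rewrite /optval; have := ltn_pmod u (isT : (0 < 6)%N).
by case: (u %% 6)%N => [|[|[|[|[|[|?]]]]]] // _; apply/andP; split; lra.
Qed.

Lemma big_part d : (6 <= d)%N -> d%:R <= 76 / 100 * t ^+ d.
Proof.
have /andP[t1 _] := t_bounds t_gt0 t3.
move=> d6; rewrite -(subnK d6); elim: (d - 6)%N => [|n IH].
  by rewrite (exprM t 3 2) t3; lra.
rewrite addSn [t ^+ _.+1]exprS mulrCA.
apply: le_trans (_ : (14 / 10) * (n + 6)%:R <= _).
  rewrite -addn1 !natrD; have : 0 <= n%:R :> R by rewrite ler0n.
  lra.
by apply: ler_pM => //; rewrite ?ler0n //; lra.
Qed.

(** A finite check on the residue and [d < 6]; larger parts are excluded by [big_part]. The factor
    [19 / 20] for every other part is what makes the optimum stable. *)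
Lemma opt_step u d :
  if opt u d then d%:R * optval (u + 3 + 5 * d) = optval u * t ^+ d
  else d%:R * optval (u + 3 + 5 * d) <= 19 / 20 * (optval u * t ^+ d).
Proof.
have /andP[t1 t1'] := t_bounds t_gt0 t3; have /andP[t2 t2'] := t2_bounds t_gt0 t3.
have [d6|d6] := leqP 6 d.
  have -> : opt u d = false.
    by rewrite /opt; case: (u %% 6)%N => [|[|[|?]]]; move: d6; clear; case: d => [|[|[|[|[|?]]]]].
  have /andP[_ c1] := optval_bounds (u + 3 + 5 * d); have /andP[c2 _] := optval_bounds u.
  apply: le_trans (_ : d%:R * 1 <= _); first by rewrite ler_wpM2l ?ler0n.
  rewrite mulr1; apply: le_trans (big_part d6) _.
  rewrite mulrA ler_wpM2r ?exprn_ge0 ?(ltW t_gt0) //; lra.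
have um : (u %% 6 < 6)%N by rewrite ltn_pmod.
have uE : u = u %% 6 %[mod 6] by rewrite modn_mod.
have uE' : (u + 3 + 5 * d = u %% 6 + 3 + 5 * d %[mod 6])%N.
  by rewrite -!addnA -modnDml.
rewrite (opt_mod d uE) (optval_mod uE) (optval_mod uE').
have e3 : t * t ^+ 2 = 3 by rewrite -t3 exprS.
have e4 : t ^+ 2 * t ^+ 2 = 3 * t by rewrite -t3 -exprD -exprSr.
have e4' : t * t = t ^+ 2 by rewrite expr2.
move: (u %% 6)%N um => {uE uE'}v; case: v => [|[|[|[|[|[|//]]]]]] _;
case: d d6 => [|[|[|[|[|[|//]]]]]] _; rewrite /opt /optval /= ?expr0 ?expr1 ?t3
  ?[t ^+ 4]exprSr ?[t ^+ 5](exprD t 3 2) ?t3; lra.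
Qed.

Lemma optseq_prod u ds : optseq u ds ->
  (\prod_(d <- ds) d)%:R = optval u * t ^+ sumn ds.
Proof.
elim: ds u => [|d ds IH] u /=.
  by move=> /eqP u0; rewrite big_nil /optval u0 mulr1.
case/andP=> ou /IH h; rewrite big_cons natrM h.
by have := opt_step u d; rewrite ou mulrA => ->; rewrite exprD mulrA.
Qed.

End Optimum.

(** * Counting induced paths through a chain of clusters *)

Section CountSelections.

Variable (V : finType).
Implicit Types (S D : {set V}) (Ds : seq {set V}) (l : seq V).

Fixpoint selections Ds : seq (seq V) :=
  if Ds is D :: Ds' then [seq y :: l | y <- enum D, l <- selections Ds'] else [:: [::]].

Lemma size_selections Ds : size (selections Ds) = \prod_(D <- Ds) #|D|.
Proof.
elim: Ds => [|D Ds IH] /=; first by rewrite big_nil.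
by rewrite size_allpairs IH big_cons cardE.
Qed.

Lemma mem_selections Ds l :
  all2 (fun y (D : {set V}) => y \in D) l Ds -> l \in selections Ds.
Proof.
elim: Ds l => [|D Ds IH] [|y l] //= /andP[yD /IH lDs].
by apply/allpairsP; exists (y, l); rewrite mem_enum.
Qed.

(** Candidates for the paths from a vertex whose neighbourhood in the chain [Ds] is [S]: the path
    enters the chain in a vertex of [S] and, as all of [S] is then removed, avoids [S]
    afterwards. *)
Fixpoint entries S Ds : seq (seq V) :=
  if Ds is D :: Ds' then
    [seq y :: l | y <- enum (S :&: D), l <- selections [seq D' :\: S | D' <- Ds']] ++
    entries S Ds'
  else [::].

Lemma prod_setD_le S Ds :
  (\prod_(D <- Ds) #|D :\: S| <= \prod_(D <- Ds) #|D|)%N.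
Proof. by apply: leq_prod => D _; rewrite subset_leq_card ?subsetDl. Qed.

Lemma size_entries S Ds : all (fun D : {set V} => D != set0) Ds ->
  (size (entries S Ds) + \prod_(D <- Ds) #|D :\: S| <= \prod_(D <- Ds) #|D|)%N.
Proof.
elim: Ds => [|D Ds IH] /=; first by rewrite !big_nil.
case/andP=> D0 /IH; rewrite size_cat size_allpairs size_selections big_map !big_cons -cardE.
have := prod_setD_le S Ds.
have dE : #|D| = (#|S :&: D| + #|D :\: S|)%N by rewrite -(cardsID S D) setIC.
rewrite -card_gt0 in D0; rewrite dE in D0 *.
move: D0; set X := (\prod_(D <- Ds) #|D :\: S|)%N; set Y := (\prod_(D <- Ds) #|D|)%N.
move: #|S :&: D| #|D :\: S| (size _) => a b n; move: X Y; clear => X Y ab XY nX.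
have : ((a + b).-1 * X <= (a + b).-1 * Y)%N by rewrite leq_mul2l XY orbT.
have -> : (a + b = (a + b).-1.+1)%N by rewrite prednK.
rewrite mulSn;
  have : (a * X + b * X = (a + b).-1 * X + X)%N by rewrite -mulnDl -{1}(prednK ab) mulSn addnC.
by lia.
Qed.

Lemma entries_congr S S' Ds : {in Ds, forall D, S :&: D = S' :&: D} ->
  entries S Ds = entries S' Ds.
Proof.
elim: Ds => //= D Ds IH H; rewrite H ?mem_head // IH => [|D' D'in]; last first.
  by apply: H; rewrite inE D'in orbT.
congr (_ ++ _); suff -> : [seq D' :\: S | D' <- Ds] = [seq D' :\: S' | D' <- Ds] by [].
apply/eq_in_map => D' D'in; apply/setP => z; rewrite !in_setD.
have /setP/(_ z) := H D' (mem_behead (s := D :: Ds) D'in).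
by rewrite !in_setI; case: (z \in D'); rewrite ?andbF ?andbT // => ->.
Qed.

(** If [S] meets no later cluster, it is a proper subset of [D], which costs a factor [3 / 4].
    Otherwise avoiding [S] costs a factor [3 / 4] in the later clusters, and by [size_entries] the
    total is at most [(3 * d + 1) / 4] times their product, where [d = #|D|]; this is at most
    [7 * d / 8] since [d >= 2]. *)
Lemma entries_small S D Ds : S != D -> (forall y, y \in S ->
  has (fun D' : {set V} => y \in D') (D :: Ds)) ->
  all (fun D' : {set V} => 2 <= #|D'| <= 4)%N (D :: Ds) ->
  (8 * size (entries S (D :: Ds)) <= 7 * \prod_(D' <- D :: Ds) #|D'|)%N.
Proof.
move=> SD Sin /= /andP[/andP[D2 D4] DsP].
have Ds0 : all (fun D : {set V} => D != set0) Ds.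
  by apply: sub_all DsP => D'; rewrite -card_gt0; case: #|D'|.
have := size_entries S Ds0; have := prod_setD_le S Ds.
rewrite size_cat size_allpairs size_selections big_map big_cons -cardE.
set X := (\prod_(D <- Ds) #|D :\: S|)%N; set Y := (\prod_(D <- Ds) #|D|)%N => XY NX.
have s_le : (#|S :&: D| <= #|D|)%N by rewrite subset_leq_card ?subsetIr.
case: (boolP (all (fun D' => S :&: D' == set0) Ds)) => [Sall|].
  have XE : X = Y.
    rewrite /X /Y; elim: (Ds) Sall => [|D' Ds' IH] /=; first by rewrite !big_nil.
    case/andP=> /eqP SD' /IH h; rewrite !big_cons h; congr (_ * _)%N.
    by rewrite -[in RHS](cardsID S D') setIC SD' cards0.
  have SsubD : S \subset D.
    apply/subsetP => y yS; have := Sin y yS => /= /orP[//|/hasP[D' D'in yD']].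
    by have /eqP/setP/(_ y) := allP Sall _ D'in; rewrite !inE yS yD'.
  have s_lt : (#|S :&: D| < #|D|)%N.
    by rewrite (setIidPl SsubD) proper_card // properEneq SD.
  move: XE NX s_lt D2 D4 s_le {XY}; move: #|S :&: D| #|D| (size _) => s d n; move: X Y;
    clear => X Y -> h sd d2 d4 _.
  have n0 : n = 0%N by lia.
  have : (s * Y <= d.-1 * Y)%N by rewrite leq_mul2r; apply/orP; right; lia.
  rewrite n0 addn0; move: d2 d4; case: d {sd} => [|[|[|[|[|//]]]]] //= _ _; lia.
rewrite -has_predC => /hasP[D' D'in /= SD'0].
have X34 : (4 * X <= 3 * Y)%N.
  rewrite /X /Y (big_rem D') //= [in X in (_ <= X)%N](big_rem D') //=.
  have c1 : (4 * #|D' :\: S| <= 3 * #|D'|)%N.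
    have /andP[_ h4] := allP DsP _ D'in; rewrite -card_gt0 in SD'0.
    by have := cardsID S D'; rewrite setIC; move: h4 SD'0; clear; lia.
  by rewrite !mulnA leq_mul // prod_setD_le.
have XY1 : (#|S :&: D| * X <= #|D| * X)%N by rewrite leq_mul2r s_le orbT.
move: X34 XY NX D2 D4 s_le XY1; move: #|S :&: D| #|D| (size _) => s d n; move: X Y; clear => X Y.
by move=> h1 h2 h3; case: d => [|[|[|[|[|//]]]]] //= _ _ _ h4; lia.
Qed.

End CountSelections.

Section Chains.

Variables (V : finType) (e : rel V) (q : V).
Hypothesis e_sym : symmetric e.
Implicit Types (x y b : V) (A B D S : {set V}) (Ds : seq {set V}) (F l : seq V).

(** Imposed along every branch, the condition makes consecutive clusters completely joined and
    forbids other edges between clusters. Edges inside a cluster are left open: each step discards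
    the whole cluster. *)
Fixpoint chain x A Ds : Prop :=
  if Ds is D :: Ds' then
    [/\ q \notin D, fwd e x A = D & forall y, y \in D -> chain y (A :\: D) Ds']
  else A = [set q] /\ e x q.

Lemma chain_fwd x y A Ds : chain x A Ds -> chain y A Ds -> fwd e x A = fwd e y A.
Proof.
case: Ds => [|D Ds] /=; last by move=> [_ -> _] [_ -> _].
move=> [-> ex] [_ ey]; apply/setP => z; rewrite !in_fwd in_set1.
by case: eqP => // ->; rewrite ex ey.
Qed.

Lemma chain_congr x y A Ds : chain x A Ds -> fwd e y A = fwd e x A -> chain y A Ds.
Proof.
case: Ds => [|D Ds] /=; last by move=> [qD DE h] E; split=> //; rewrite E.
move=> [-> ex] E; split=> //.
have : q \in fwd e x [set q] by rewrite in_fwd in_set1 eqxx.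
by rewrite -E in_fwd => /andP[].
Qed.

Lemma chain_q x A Ds : all (fun D => D != set0) Ds -> chain x A Ds -> q \in A.
Proof.
elim: Ds x A => [|D Ds IH] x A /=; first by move=> _ [-> _]; rewrite in_set1.
case/andP=> /set0Pn[y yD] Ds0 [_ _ /(_ y yD) /(IH _ _ Ds0)].
by rewrite in_setD => /andP[].
Qed.

Lemma chain_cover x A Ds z : all (fun D => D != set0) Ds -> chain x A Ds -> z \in A ->
  z = q \/ has (fun D => z \in D) Ds.
Proof.
elim: Ds x A => [|D Ds IH] x A /=; first by move=> _ [-> _] /set1P; left.
case/andP=> /set0Pn[y yD] Ds0 [_ _ /(_ y yD) h] zA.
case: (boolP (z \in D)) => zD; first by right.
by apply: (IH _ _ Ds0 h); rewrite in_setD zD.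
Qed.

Lemma chain_sub x A Ds D : all (fun D => D != set0) Ds -> chain x A Ds -> D \in Ds ->
  D \subset A.
Proof.
elim: Ds x A => //= D' Ds IH x A; case/andP=> /set0Pn[y yD] Ds0 [_ DE /(_ y yD) h].
rewrite inE => /predU1P[->|/(IH _ _ Ds0 h) sub]; first by rewrite -DE fwd_sub.
by apply: subset_trans sub (subsetDl _ _).
Qed.

Lemma chain_card x A Ds : all (fun D => D != set0) Ds -> chain x A Ds ->
  #|A| = (sumn [seq #|D| | D <- Ds]).+1.
Proof.
elim: Ds x A => [|D Ds IH] x A /=; first by move=> _ [-> _]; rewrite cards1.
case/andP=> /set0Pn[y yD] Ds0 [_ DE /(_ y yD) /(IH _ _ Ds0) cA].
by rewrite -addnS -cA -DE addnC card_fwdD.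
Qed.

Lemma chain_ipath y A B Ds F : chain y A Ds -> B \subset A -> F \in ipaths e q y B ->
  exists l, [/\ F = rcons l q, all2 (fun z D => z \in D) l Ds & {subset l <= B}].
Proof.
elim: Ds y A B F => [|D Ds IH] y A B F /=.
  move=> [-> eyq] Bq Fin; exists [::]; split=> //=.
  have [F0 _] := mem_ipaths Fin; have := ipaths_sub Fin; have := ipath_uniq Fin.
  case: F F0 Fin => // z [|z' F] _ Fin uF sF.
    by have /(subsetP Bq) /set1P -> := sF z (mem_head _ _).
  have /(subsetP Bq) /set1P zq := sF z (mem_head _ _).
  have /(subsetP Bq) /set1P zq' : z' \in B by apply: sF; rewrite !inE eqxx orbT.
  by move: uF; rewrite zq zq' /= inE eqxx.
move=> [qD DE chD] BA /mem_ipaths[_].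
have fB : fwd e y B = D :&: B.
  apply/setP => z; rewrite -DE in_setI !in_fwd; case: (boolP (z \in B)) => zB; rewrite ?andbF //.
  by rewrite (subsetP BA) // andbT.
rewrite fB in_setI (negPf qD) /= => -[z [F' [-> /setIP[zD zB] F'in]]].
have [|l [-> al lB]] := IH z _ _ _ (chD z zD) _ F'in.
  by apply/subsetP => w; rewrite !in_setD in_setI negb_and => /andP[+ wB];
    rewrite wB orbF (subsetP BA) // => ->.
exists (z :: l); split=> //=; first by rewrite zD.
move=> w; rewrite inE => /predU1P[-> //|/lB]; by rewrite in_setD => /andP[].
Qed.

Lemma last_occurrence (P : pred V) F : has P F ->
  exists F1 z F2, [/\ F = F1 ++ z :: F2, P z & ~~ has P F2].
Proof.
elim: F => //= y F IH; case: (boolP (has P F)) => [/IH[F1 [z [F2 [-> Pz nF2]]]] _|nF].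
  by exists (y :: F1), z, F2.
by rewrite orbF => Py; exists [::], y, F.
Qed.

Lemma is_ipath_cat b F L M : is_ipath e b F -> b :: F = L ++ M ->
  forall i j, (i < j < size M)%N -> e (nth b M i) (nth b M j) = (j == i.+1).
Proof.
move=> ip bF i j /andP[ij jM]; have szF : (size F).+1 = (size L + size M)%N.
  by rewrite -size_cat -bF.
have cnd : (size L + i < size L + j <= size F)%N.
  by rewrite ltn_add2l ij -ltnS szF ltn_add2l.
have := ip _ _ cnd; rewrite bF !nth_cat.
by rewrite !ltnNge !leq_addr /= !addKn -addnS eqn_add2l.
Qed.

(** Let [z] be the last vertex of [F] in the first cluster [D]. If [z] comes first in [F], the rest
    picks one vertex from each later cluster. If [z] is preceded in [F] by [y], then [y] lies in [D]
    or in the next cluster and is adjacent to one of the two vertices that follow [z], against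
    inducedness. If [F] misses [D], the induction applies to the shorter chain. *)
Lemma ipath_entries y0 b A Ds F : all (fun D => D != set0) Ds ->
  chain y0 A Ds -> q != b -> q \notin fwd e b A -> F \in ipaths e q b A ->
  exists2 l, F = rcons l q & l \in entries (fwd e b A) Ds.
Proof.
elim: Ds y0 A F => [|D Ds IH] y0 A F.
  move=> _ [-> _] _ qf /mem_ipaths[_]; rewrite (negPf qf) => -[y [F' [_ yf _]]].
  by move: (yf); rewrite in_fwd => /andP[/set1P yq _]; case/negP: qf; rewrite -{1}yq.
move=> Ds0' chA; have qA := chain_q Ds0' chA.
move: Ds0' chA => /= /andP[D0 Ds0] [qD DE chD] qb qf Fin.
have [y1 y1D] := set0Pn _ D0.
have [lastF FA ipF] : [/\ last b F = q, {subset F <= A} & is_ipath e b F].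
  by apply/ipathsP.
case: (boolP (has (mem D) F)) => hasD; last first.
  have F'in : F \in ipaths e q b (A :\: D).
    apply/ipathsP; rewrite // ?in_setD ?qD //; split=> // z zF.
    rewrite in_setD FA // andbT; apply: contra hasD => zD; by apply/hasP; exists z.
  have qf' : q \notin fwd e b (A :\: D).
    by apply: contra qf; rewrite !in_fwd in_setD => /andP[/andP[_ ->] ->].
  have [l -> lin] := IH y1 _ F Ds0 (chD _ y1D) qb qf' F'in; exists l => //.
  rewrite mem_cat; apply/orP; right; move: lin.
  rewrite (@entries_congr _ (fwd e b (A :\: D)) (fwd e b A)) // => D' D'in.
  have sub := chain_sub Ds0 (chD _ y1D) D'in.
  apply/setP => z; rewrite !in_setI !in_fwd in_setD.
  case: (boolP (z \in D')) => zD'; rewrite ?andbF // !andbT.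
  by have := subsetP sub z zD'; rewrite in_setD => /andP[-> _].
have [F1 [z [F2 [FE zD nF2]]]] := last_occurrence hasD.
have {}zD : z \in D := zD.
have uF := ipath_uniq Fin.
have nD w : w \in F2 -> w \notin D by move=> wF2; apply: contra nF2 => wD; apply/hasP; exists w.
case: F2 FE nF2 nD => [|a F3] FE nF2 nD.
  by move: lastF qD; rewrite FE last_cat /= => <-; rewrite zD.
have aA : a \in A by apply: FA; rewrite FE mem_cat !inE eqxx !orbT.
have aAD : a \in A :\: D by rewrite in_setD aA nD ?mem_head.
case/lastP: F1 FE => [|F1 y] FE.
  move: (FE) => /= FE'; have := Fin; rewrite FE' => /mem_ipaths[_].
  rewrite (negPf qf) => -[z' [F' [[<- <-] zf F2in]]].
  have qz : q != z by apply: contraNneq qD => ->.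
  set S := fwd e b A in qf zf F2in *.
  have qAS : q \in A :\: S by rewrite in_setD qf.
  have [_ FAS ipF2] : [/\ last z (a :: F3) = q, {subset a :: F3 <= A :\: S} & is_ipath e z (a :: F3)].
    by apply/ipathsP.
  have F2in' : a :: F3 \in ipaths e q z (A :\: D :\: S).
    apply/ipathsP; rewrite ?in_setD ?qf ?qD //; split=> //.
      by move: lastF; rewrite FE'.
    by move=> w wF; have := FAS w wF; rewrite !in_setD nD // => /andP[-> ->].
  have [l [lE al lB]] := chain_ipath (chD z zD) (subsetDl _ _) F2in'.
  exists (z :: l); first by rewrite lE.
  rewrite mem_cat; apply/orP; left; apply/allpairsP; exists (z, l).
  rewrite mem_enum in_setI zf zD /=; split=> //; apply: mem_selections.
  elim: (Ds) l al lB {lE} => [|D' Ds' IHl] [|w l] //= /andP[wD' al] lB.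
  rewrite in_setD wD' andbT IHl //; last by move=> v vl; apply: lB; rewrite inE vl orbT.
  by have := lB w (mem_head _ _); rewrite in_setD => /andP[-> _].
exfalso; rewrite cat_rcons in FE.
have ipM := @is_ipath_cat b F (b :: F1) [:: y, z, a & F3] ipF.
have {}ipM := ipM ltac:(by rewrite FE).
have eyz : e z y by rewrite e_sym; have := ipM 0%N 1%N isT.
have eya : e y a = false by have := ipM 0%N 2%N isT.
have eza : e z a by have := ipM 1%N 2%N isT.
have yA : y \in A by apply: FA; rewrite FE mem_cat !inE eqxx !orbT.
have ya : y != a.
  move: uF; rewrite FE cat_uniq => /and3P[_ _ /= /andP[]].
  by rewrite !inE !negb_or => /and3P[_ ya _] _.
case: Ds IH Ds0 chD => [|D2 Ds2] IH Ds0 chD.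
  have [Aq _] := chD z zD; rewrite Aq in_set1 in aAD; move/eqP: aAD => aq.
  case: (boolP (y \in D)) => yD; first by have [_ eyq] := chD y yD; rewrite aq eyq in eya.
  have : y \in A :\: D by rewrite in_setD yD.
  by rewrite Aq in_set1 -aq (negPf ya).
have [q2 f2 ch2] := chD z zD.
have aD2 : a \in D2 by rewrite -f2 in_fwd aAD.
have yD : y \notin D.
  apply/negP => yD; have [_ fy _] := chD y yD.
  by move: aD2; rewrite -fy in_fwd eya andbF.
have yD2 : y \in D2 by rewrite -f2 in_fwd in_setD yD yA.
case: F3 FE nF2 nD ipM => [|c F4] FE nF2 nD ipM.
  by move: lastF q2; rewrite FE last_cat /= => <-; rewrite aD2.
have cA : c \in A by apply: FA; rewrite FE mem_cat !inE eqxx !orbT.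
have cAD : c \in A :\: D by rewrite in_setD cA nD // !inE eqxx orbT.
have eyc : e y c = false by have := ipM 0%N 3%N isT.
have ezc : e z c = false by have := ipM 1%N 3%N isT.
have eac : e a c by have := ipM 2%N 3%N isT.
have cD2 : c \notin D2 by rewrite -f2 in_fwd ezc andbF.
have : c \in fwd e y (A :\: D :\: D2).
  by rewrite (chain_fwd (ch2 y yD2) (ch2 a aD2)) in_fwd in_setD cD2 cAD.
by rewrite in_fwd eyc andbF.
Qed.

End Chains.

(** * Paths of given parity: the optimal bound and its stability *)

Section Gap.

Variables (V : finType) (e : rel V) (q : V).
Hypothesis e_sym : symmetric e.
Variables (R : realFieldType) (t : R).
Hypotheses (t_gt0 : 0 < t) (t3 : t ^+ 3 = 3).
Implicit Types (x y b : V) (A B D S : {set V}) (Ds : seq {set V}) (F l : seq V).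

(* [size F] exceeds the number of internal vertices of the path by one. *)
Definition par_paths (odd_ : bool) x A : R :=
  \sum_(F <- ipaths e q x A) (odd (size F) == ~~ odd_)%:R.

Lemma par_paths_step s x A : q \notin fwd e x A ->
  par_paths s x A = \sum_(y in fwd e x A) par_paths (~~ s) y (A :\: fwd e x A).
Proof.
move=> qD; rewrite /par_paths sum_ipaths //; apply: eq_bigr => y _.
by apply: eq_bigr => F _ /=; case: (odd _); case: s.
Qed.

Lemma par_paths_end s x A : q \in fwd e x A -> par_paths s x A = (~~ s)%:R.
Proof. by move=> qD; rewrite /par_paths sum_ipaths_end //=; case: s. Qed.

Lemma par_paths_size s x A : par_paths s x A <= (size (ipaths e q x A))%:R.
Proof.
rewrite -sum1_size natr_sum; apply: ler_sum => F _.
by case: (_ == _); rewrite ?ler01.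
Qed.

(** An odd number of parts with sum [w] is treated as an even number by adding a part 3, whence
    [u = w + 3 * s]. Splitting off a part [d] flips the parity, so [u] changes by [3 - d]. *)
Lemma residue_step (u : nat) (s : bool) (w d w' : nat) :
  (u = w + 3 * s %[mod 6])%N -> w = (w' + d)%N ->
  (u + 3 + 5 * d = w' + 3 * ~~ s %[mod 6])%N.
Proof. by move=> h wE; subst w; case: s h => /=; lia. Qed.

Lemma par_paths_le (s : bool) x A u : q \in A -> (u = #|A|.-1 + 3 * s %[mod 6])%N ->
  par_paths s x A <= optval t u * t ^+ #|A|.-1.
Proof.
have /andP[t1 _] := t_bounds t_gt0 t3.
have tp k : 0 <= t ^+ k by rewrite exprn_ge0 ?(ltW t_gt0).
have cb v := optval_bounds t_gt0 t3 v.
move: x A s u; apply: (@ipaths_ind _ e q) => [x A qD|x A qD IH] s u qA uE.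
  rewrite par_paths_end //; have /andP[c0 _] := cb u.
  have c0' : 0 <= optval t u by apply: le_trans c0; lra.
  case: s uE => /=; first by move=> _; apply: mulr_ge0.
  rewrite muln0 addn0; case: #|A|.-1 => [|w] uE.
    by rewrite (optval_mod t uE) /optval /= expr0 mulr1.
  have : t <= t ^+ w.+1 by rewrite -[leLHS]expr1 ler_weXn2l //; lra.
  by move=> h; apply: le_trans (_ : 85 / 100 * t <= _); [lra | apply: ler_pM => //; lra].
rewrite par_paths_step //.
have cA := card_fwdD e x A; set D := fwd e x A in qD cA IH *.
have qA' : q \in A :\: D by rewrite in_setD qD.
have A'0 : (0 < #|A :\: D|)%N by apply/card_gt0P; exists q.
have wE : #|A|.-1 = (#|A :\: D|.-1 + #|D|)%N by rewrite -cA; move: A'0; clear; case: #|_|.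
have u'E := residue_step uE wE.
apply: le_trans (_ : \sum_(y in D) optval t (u + 3 + 5 * #|D|) * t ^+ #|A :\: D|.-1 <= _).
  by apply: ler_sum => y yD; apply: IH.
have -> : t ^+ #|A|.-1 = t ^+ #|D| * t ^+ #|A :\: D|.-1 by rewrite wE addnC exprD.
rewrite sumr_const -[_ *+ #|_|]mulr_natl [leLHS]mulrA [leRHS]mulrA.
apply: ler_wpM2r => //; have := opt_step t_gt0 t3 u #|D|; case: ifP => _ h; first by rewrite h.
apply: le_trans h _; have /andP[c0 _] := cb u.
have : 0 <= optval t u * t ^+ #|D| by apply: mulr_ge0 => //; apply: le_trans c0; lra.
lra.
Qed.

Lemma optseq_sizes u ds : optseq u ds -> all (fun d => 2 <= d <= 4)%N ds.
Proof.
elim: ds u => //= d ds IH u /andP[od /IH ->]; rewrite andbT.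
by move: od; rewrite /opt; case: (u %% 6)%N => [|[|[|?]]]; case: d => [|[|[|[|[|?]]]]].
Qed.

(** Some child is within the same factor of its optimum and, by induction, starts a chain. A sibling
    with other neighbours has at most [7 / 8] of the optimum by [entries_small]; as there are at
    most four children, the total would lose a share of [1 / 32], more than [1 / 200]. *)
Lemma par_paths_gap (s : bool) x A u : q \in A -> x \notin A ->
  (u = #|A|.-1 + 3 * s %[mod 6])%N ->
  199 / 200 * (optval t u * t ^+ #|A|.-1) < par_paths s x A ->
  exists2 Ds, chain e q x A Ds & optseq u [seq #|D : {set V}| | D <- Ds].
Proof.
have /andP[t1 _] := t_bounds t_gt0 t3.
have tp k : 0 <= t ^+ k by rewrite exprn_ge0 ?(ltW t_gt0).
have cb v := optval_bounds t_gt0 t3 v.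
move: x A s u; apply: (@ipaths_ind _ e q) => [x A qD|x A qD IH] s u qA xA uE gap.
  move: gap; rewrite par_paths_end //; have /andP[c0 _] := cb u.
  have c0' : 0 <= optval t u by apply: le_trans c0; lra.
  have p0 k : 0 <= optval t u * t ^+ k by apply: mulr_ge0.
  case: s uE => /= uE.
    by move=> gap; have := p0 #|A|.-1; lra.
  case cA: #|A|.-1 uE => [|w] uE gap.
    have Aq : A = [set q].
      apply/eqP; rewrite eq_sym eqEcard sub1set qA cards1.
      by move: cA; case: #|A| => [|[|]].
    exists [::]; last by rewrite /= uE.
    by split=> //; move: qD; rewrite in_fwd => /andP[].
  have h : t <= t ^+ w.+1 by rewrite -[leLHS]expr1 ler_weXn2l //; lra.
  have : 85 / 100 * t <= optval t u * t ^+ w.+1 by apply: ler_pM => //; lra.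
  by move: gap; lra.
move: gap; rewrite par_paths_step //.
have cA := card_fwdD e x A; have DA := fwd_sub e x A.
set D := fwd e x A in qD cA IH DA *.
have qA' : q \in A :\: D by rewrite in_setD qD.
have A'0 : (0 < #|A :\: D|)%N by apply/card_gt0P; exists q.
have wE : #|A|.-1 = (#|A :\: D|.-1 + #|D|)%N by rewrite -cA; move: A'0; clear; case: #|_|.
have u'E := residue_step uE wE.
set u' := (u + 3 + 5 * #|D|)%N in u'E *.
set P := optval t u' * t ^+ #|A :\: D|.-1.
have P0 : 0 <= P by have /andP[c0 _] := cb u'; apply: mulr_ge0 => //; apply: le_trans c0; lra.
have le_P y : par_paths (~~ s) y (A :\: D) <= P by apply: par_paths_le.
have step := opt_step t_gt0 t3 u #|D|; rewrite -/u' in step.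
have -> : t ^+ #|A|.-1 = t ^+ #|D| * t ^+ #|A :\: D|.-1 by rewrite wE addnC exprD.
rewrite [optval t u * _]mulrA => gap.
have od : opt u #|D|.
  case: ifP step => // _ step; exfalso.
  have : \sum_(y in D) par_paths (~~ s) y (A :\: D) <= 19 / 20 * (optval t u * t ^+ #|D|) * t ^+
    #|A :\: D|.-1.
    apply: le_trans (_ : \sum_(y in D) P <= _); first by apply: ler_sum => y _.
    rewrite sumr_const -[_ *+ #|_|]mulr_natl mulrA; exact: ler_wpM2r.
  have : 0 <= optval t u * t ^+ #|D| * t ^+ #|A :\: D|.-1.
    have /andP[c0 _] := cb u; apply: mulr_ge0 => //; apply: mulr_ge0 => //.
    by apply: le_trans c0; lra.
  by move: gap; set X := _ * _ * _; rewrite -!mulrA; rewrite /X -!mulrA; lra.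
rewrite od in step; rewrite -step -[_ * optval t u' * _]mulrA -/P in gap.
have D24 : (2 <= #|D| <= 4)%N.
  by have := @optseq_sizes u [:: #|D|]; move: od; rewrite /opt; case: (u %% 6)%N => [|[|[|?]]];
    case: #|D| => [|[|[|[|[|?]]]]].
have sumC (c : R) : \sum_(y in D) c = #|D|%:R * c by rewrite sumr_const -[_ *+ #|_|]mulr_natl.
have [y0 y0D gap0] : exists2 y0, y0 \in D & 199 / 200 * P < par_paths (~~ s) y0 (A :\: D).
  apply: NNPP => nex; suff : \sum_(y in D) par_paths (~~ s) y (A :\: D) <= 199 / 200 * (#|D|%:R * P).
    by rewrite leNgt gap.
  rewrite mulrCA -sumC; apply: ler_sum => y yD; rewrite leNgt; apply/negP => h.
  by apply: nex; exists y.
have y0A' : y0 \notin A :\: D by rewrite in_setD y0D.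
have [Ds chDs oDs] := IH y0 y0D (~~ s) u' qA' y0A' u'E gap0.
have sizesDs := optseq_sizes oDs; rewrite all_map in sizesDs.
have Ds0 : all (fun D => D != set0) Ds.
  by apply: sub_all sizesDs => D' /=; rewrite -card_gt0; case: #|D'|.
have PE : P = (\prod_(D <- Ds) #|D|)%:R.
  by rewrite /P (chain_card Ds0 chDs) -(optseq_prod t_gt0 t3 oDs) big_map.
exists (D :: Ds); last by rewrite /= od.
split=> // b bD; apply: (chain_congr chDs); apply/eqP; apply: contraT => neq.
have bA' : b \notin A :\: D by rewrite in_setD bD.
have qb : q != b by apply: contraNneq bA' => <-.
have small : (8 * size (ipaths e q b (A :\: D)) <= 7 * \prod_(D <- Ds) #|D|)%N.
  case: (boolP (q \in fwd e b (A :\: D))) => qf.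
    rewrite ipathsE qf /=; case: Ds chDs oDs sizesDs Ds0 PE {gap0} => [|D1 Ds] /=.
      move=> [A'E ey0] _ _ _ _; case/eqP: neq; rewrite A'E; apply/setP => z.
      rewrite A'E in qf; move: qf; rewrite !in_fwd !in_set1 eqxx /= => eb.
      by case: eqP => // ->; rewrite eb ey0.
    move=> _ _ /andP[/andP[D12 _] dsP] _ _; rewrite big_cons.
    have : (0 < \prod_(D <- Ds) #|D|)%N.
      rewrite big_seq prodn_cond_gt0 // => D' D'in.
      by have /andP[h _] := allP dsP _ D'in; apply: leq_trans h.
    by move: D12; move: #|D1| (\prod_(_ <- _) _)%N; clear => a m; case: a => [|[|a]] // _;
      case: m => // m _; rewrite mulSn mulSn; lia.
  have sub F : F \in ipaths e q b (A :\: D) ->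
      exists2 l, l \in entries (fwd e b (A :\: D)) Ds & F = rcons l q.
    by move=> Fin; have [l -> lin] := ipath_entries e_sym Ds0 chDs qb qf Fin; exists l.
  have szle : (size (ipaths e q b (A :\: D)) <= size (entries (fwd e b (A :\: D)) Ds))%N.
    rewrite -(size_map (rcons^~ q) (entries _ _)); apply: uniq_leq_size (ipaths_uniq _ _ _ _) _.
    by move=> F /sub[l lin ->]; apply: (map_f (rcons^~ q)).
  case: Ds chDs oDs sizesDs Ds0 PE szle {gap0 sub} => [|D1 Ds] chDs oDs sizesDs Ds0 PE szle.
    by move: szle; rewrite /= leqn0 => /eqP ->.
  have chDs' := chDs; case: chDs' => _ fy0 _.
  apply: leq_trans (_ : 8 * size (entries (fwd e b (A :\: D)) (D1 :: Ds)) <= _)%N.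
    by rewrite leq_mul2l szle.
  apply: entries_small => //; first by rewrite -fy0.
  move=> z zf; have zA : z \in A :\: D by apply: (subsetP (fwd_sub e b _)).
  have [zq|//] := chain_cover Ds0 chDs zA.
  by move: qf; rewrite -zq zf.
have small' : par_paths (~~ s) b (A :\: D) <= 7 / 8 * P.
  apply: le_trans (par_paths_size _ _ _) _; rewrite PE.
  by move: small; rewrite -(ler_nat R) !natrM; lra.
exfalso; move: gap; rewrite (bigD1 b) //=.
have : \sum_(i in D | i != b) par_paths (~~ s) i (A :\: D) <= (#|D|%:R - 1) * P.
  have := sumC P; rewrite (bigD1 b) //= => E.
  apply: le_trans (_ : \sum_(i in D | i != b) P <= _); first by apply: ler_sum.
  by rewrite mulrBl mul1r -E [leRHS]addrC addKr.
have d4 : #|D|%:R <= 4 :> R by rewrite ler_nat; case/andP: D24.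
have : #|D|%:R * P <= 4 * P by rewrite ler_wpM2r.
have P1 : 0 < P.
  rewrite PE ltr0n big_seq prodn_cond_gt0 // => D' D'in.
  by have /andP[h _] := allP sizesDs _ D'in; apply: leq_trans h.
move: small'; set X := \sum_(_ in _ | _) _; set Y := par_paths _ _ _; set Z := #|D|%:R.
by rewrite mulrBl mul1r; move: P1; clear; lra.
Qed.

End Gap.

(** * Cycles crossing a segment *)

Section CycleLocal.

Variables (V : finType) (e : rel V).
Hypothesis e_simple : simple_graph e.
Implicit Types (x y z : V) (S Q : {set V}).

Lemma cycle_deg S x y1 y2 y3 : induces_cycle e S -> x \in S ->
  [/\ y1 \in S, y2 \in S & y3 \in S] -> [/\ e x y1, e x y2 & e x y3] ->
  [|| y1 == y2, y1 == y3 | y2 == y3].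
Proof.
move=> cS xS [y1S y2S y3S] [e1 e2 e3]; have m2 : (2 < #|S|)%N by case/andP: cS.
have [g [g0 gS _ ge]] := cycle_walk cS xS.
have h0 : (0 < #|S|)%N by apply: ltn_trans m2.
have one y : y \in S -> e x y -> y = g 1%N \/ y = g #|S|.-1.
  move=> yS exy; have [a am yE] := gS y yS; move: exy; rewrite yE -g0.
  have [_ ->] := ge 0%N a h0 am; rewrite modn_small; last by apply: ltn_trans m2.
  case/orP=> /eqP h; first by left; rewrite h.
  right; congr g; case: (ltngtP a.+1 #|S|) => [lt|gt|<-] //.
    by move: h; rewrite modn_small.
  by move: gt; rewrite ltnS leqNgt am.
by case: (one _ y1S e1) => ->; case: (one _ y2S e2) => ->; case: (one _ y3S e3) => ->;
  rewrite eqxx ?orbT.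
Qed.

Lemma cycle_nbrs S x : induces_cycle e S -> x \in S -> (3 < #|S|)%N ->
  exists y y', [/\ y \in S, y' \in S, y != y', e x y & e x y' /\ ~~ e y y'].
Proof.
move=> cS xS m3.
have [g [g0 gS gin ge]] := cycle_walk cS xS.
have h0 : (0 < #|S|)%N by apply: ltn_trans m3.
have h1 : (1 < #|S|)%N by apply: ltn_trans m3.
have hm : (#|S|.-1 < #|S|)%N by rewrite prednK.
have h2 : (2 < #|S|)%N by apply: ltn_trans m3.
have mE : #|S|.-1.+1 = #|S| by rewrite prednK.
exists (g 1%N), (g #|S|.-1); split; rewrite ?gin //.
- by apply/eqP => /(proj1 (ge _ _ h1 hm)); move: m3; clear; case: #|S| => [|[|[|]]].
- by rewrite -g0 (proj2 (ge _ _ h0 h1)) modn_small.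
split; first by rewrite -g0 (proj2 (ge _ _ h0 hm)) mE modnn eqxx orbT.
rewrite (proj2 (ge _ _ h1 hm)) mE modnn modn_small // orbF.
by move: m3; clear; case: #|S| => [|[|[|[|]]]].
Qed.

Lemma cycle_closed S Q x : induces_cycle e S -> x \in S -> x \in Q ->
  (forall y z, y \in S -> y \in Q -> z \in S -> e y z -> z \in Q) -> S \subset Q.
Proof.
move=> cS xS xQ cl; have m2 : (2 < #|S|)%N by case/andP: cS.
have [g [g0 gS gin ge]] := cycle_walk cS xS.
have gQ a : (a < #|S|)%N -> g a \in Q.
  elim: a => [|a IH] am; first by rewrite g0.
  have am' := ltnW am; apply: (cl (g a)); rewrite ?gin ?IH //.
  by rewrite (proj2 (ge _ _ am' am)) modn_small // eqxx.
by apply/subsetP => v /gS[a am ->]; apply: gQ.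
Qed.

Lemma cycle_no_triangle S x y z : induces_cycle e S -> (3 < #|S|)%N ->
  [/\ x \in S, y \in S & z \in S] -> e x y -> e y z -> e z x -> False.
Proof.
move=> cS m3 [xS yS zS] exy eyz ezx; have sy := simple_sym e_simple.
have irr u v : e u v -> u != v by move=> h; apply: contraTneq h => ->; rewrite simple_irr.
have : S \subset [set x; y; z].
  apply: (cycle_closed cS xS); first by rewrite !inE eqxx.
  move=> u v uS uQ vS euv; move: uQ; rewrite !inE -orbA => /or3P[] /eqP uE.
  - have := @cycle_deg S u y z v cS uS (And3 yS zS vS);
      rewrite {1 2}uE exy sy ezx euv (negPf (irr _ _ eyz)) /=.
    by move/(_ (And3 isT isT isT))/orP=> -[] /eqP ->; rewrite eqxx ?orbT.
  - have := @cycle_deg S u x z v cS uS (And3 xS zS vS);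
      rewrite {1 2}uE sy exy eyz euv eq_sym (negPf (irr _ _ ezx)) /=.
    by move/(_ (And3 isT isT isT))/orP=> -[] /eqP ->; rewrite eqxx ?orbT.
  have := @cycle_deg S u x y v cS uS (And3 xS yS vS);
    rewrite {1 2}uE ezx sy eyz euv (negPf (irr _ _ exy)) /=.
  by move/(_ (And3 isT isT isT))/orP=> -[] /eqP ->; rewrite eqxx ?orbT.
move/subset_leq_card; rewrite leqNgt => /negP; apply; apply: leq_ltn_trans m3.
rewrite -setUA; apply: leq_trans (leq_card_setU _ _) _; rewrite cards1 cards2; by case: (_ != _).
Qed.

(** Each of the four vertices has both its neighbours on the cycle among the other three, so by
    connectivity they would be the whole cycle. Chords are not excluded by hypothesis. *)
Lemma cycle_no_square S x y z w : induces_cycle e S -> (4 < #|S|)%N ->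
  x \in S -> y \in S -> z \in S -> w \in S -> x != z -> y != w ->
  e x y -> e y z -> e z w -> e w x -> False.
Proof.
move=> cS m4 xS yS zS wS xz yw exy eyz ezw ewx; have sy := simple_sym e_simple.
have : S \subset [set x; y; z; w].
  apply: (cycle_closed cS xS); first by rewrite !inE eqxx.
  move=> u v uS uQ vS euv; move: uQ; rewrite !inE -!orbA => /or4P[] /eqP uE.
  - have := @cycle_deg S u y w v cS uS (And3 yS wS vS); rewrite {1 2}uE exy sy ewx euv (negPf yw) /=.
    by move/(_ (And3 isT isT isT))/orP=> -[] /eqP ->; rewrite eqxx ?orbT.
  - have := @cycle_deg S u x z v cS uS (And3 xS zS vS); rewrite {1 2}uE sy exy eyz euv (negPf xz) /=.
    by move/(_ (And3 isT isT isT))/orP=> -[] /eqP ->; rewrite eqxx ?orbT.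
  - have := @cycle_deg S u y w v cS uS (And3 yS wS vS); rewrite {1 2}uE sy eyz ezw euv (negPf yw) /=.
    by move/(_ (And3 isT isT isT))/orP=> -[] /eqP ->; rewrite eqxx ?orbT.
  have := @cycle_deg S u x z v cS uS (And3 xS zS vS); rewrite {1 2}uE ewx sy ezw euv (negPf xz) /=.
  by move/(_ (And3 isT isT isT))/orP=> -[] /eqP ->; rewrite eqxx ?orbT.
move/subset_leq_card; rewrite leqNgt => /negP; apply; apply: leq_ltn_trans m4.
rewrite -setUA; apply: leq_trans (leq_card_setU _ _) _.
by rewrite !cards2; case: (_ != _); case: (_ != _).
Qed.

Variables (L : nat) (T : nat -> {set V}).
Hypothesis segT : segment e L T.

Lemma segment_cycle S i x : induces_cycle e S -> (4 < #|S|)%N ->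
  (2 <= i < L)%N -> x \in S -> x \in T i ->
  [/\ S :&: T i = [set x], exists2 y, y \in S & y \in T i.-1 & exists2 y, y \in S & y \in T i.+1].
Proof.
move=> cS m4 iL xS xT; have sy := simple_sym e_simple; have m3 := ltnW m4.
have irr u v : e u v -> u != v by move=> h; apply: contraTneq h => ->; rewrite simple_irr.
case: segT => cT _ adj; move: i iL xT => [|[|i]] // iL xT.
have i0 : (0 < i.+2 <= L)%N by move: iL; clear; lia.
have i1 : (0 < i.+1 <= L)%N by move: iL; clear; lia.
have i2 : (0 < i.+3 <= L)%N by move: iL; clear; lia.
have [y [y' [yS y'S yy' exy [exy' nyy']]]] := cycle_nbrs cS xS m3.
rewrite /= in adj *.
(* If both neighbours of [x] lie in one adjacent cluster, the other neighbour of [u] on the cycle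
   closes a square with [u], [x], [v] or a triangle with [u], [x]. *)
have same j u v : (0 < j <= L)%N -> u \in T j -> v \in T j -> x \in T j.-1 :|: T j.+1 ->
    u \in S -> v \in S -> u != v -> ~~ e u v -> e x u -> e x v -> False.
  move=> jL uT vT xj uS vS uv nuv exu exv.
  have [w [w' [wS w'S ww' euw [euw' _]]]] := cycle_nbrs cS uS m3.
  have [v1 [v1S v1x euv1]] : exists v1, [/\ v1 \in S, v1 != x & e u v1].
    by case: (eqVneq w x) => [wx|wx]; [exists w'; rewrite -wx eq_sym | exists w].
  have := proj1 (adj j u v1 jL uT) euv1; rewrite setUAC in_setU => /orP[v1N|v1j].
    have evv1 := proj2 (adj j v v1 jL vT) v1N.
    apply: (@cycle_no_square S x u v1 v) => //; rewrite ?[x == _]eq_sym //.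
    - by rewrite sy.
    - by rewrite sy.
  have exv1 : e x v1 by rewrite sy; apply: (proj2 (adj j v1 x jL v1j)).
  by apply: (@cycle_no_triangle S x u v1) => //; rewrite sy.
(* A neighbour of [x] or [u] in an adjacent cluster would be common to both and give a triangle. So
   the cycle continues inside the cluster on either side, which makes four vertices in a set of
   three. *)
have inner u : u \in S -> u \in T i.+2 -> e x u -> False.
  move=> uS uT exu.
  have adjxu z : z \in T i.+1 :|: T i.+3 -> e x z /\ e u z.
    by move=> zN; split; [apply: (proj2 (adj i.+2 x z i0 xT)) | apply: (proj2 (adj i.+2 u z i0 uT))].
  have closed v w : v \in S -> v \in T i.+2 -> (v = x \/ v = u) -> w \in S -> e v w -> w \in T i.+2.
    move=> vS vT vxu wS evw; have := proj1 (adj _ v w i0 vT) evw.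
    rewrite setUAC in_setU => /orP[/adjxu[exw euw]|//]; exfalso.
    by apply: (@cycle_no_triangle S x u w) => //; rewrite sy.
  have [v1 [v1S v1u exv1]] : exists v1, [/\ v1 \in S, v1 != u & e x v1].
    by case: (eqVneq y u) => [yu|yu]; [exists y'; rewrite -yu eq_sym | exists y].
  have v1T := closed x v1 xS xT (or_introl erefl) v1S exv1.
  have [w [w' [wS w'S ww' euw [euw' _]]]] := cycle_nbrs cS uS m3.
  have [u1 [u1S u1x euu1]] : exists u1, [/\ u1 \in S, u1 != x & e u u1].
    by case: (eqVneq w x) => [wx|wx]; [exists w'; rewrite -wx eq_sym | exists w].
  have u1T := closed u u1 uS uT (or_intror erefl) u1S euu1.
  case: (eqVneq u1 v1) => [u1v1|nuv].
    by apply: (@cycle_no_triangle S x u u1) => //; rewrite sy u1v1.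
  have : (#|[set x; u; u1; v1]| <= 3)%N.
    rewrite -(cT i.+2); last by case/andP: i0 => _ /leqW.
    by apply/subset_leq_card/subsetP => z; rewrite !inE -!orbA => /or4P[] /eqP ->.
  rewrite -!setUA !cardsU1 cards1 !inE !negb_or.
  rewrite (irr _ _ exu) (irr _ _ exv1) [x == _]eq_sym u1x (irr _ _ euu1) [u == _]eq_sym v1u.
  by rewrite [u1 == _]eq_sym eq_sym nuv.
have nb u : u \in S -> e x u -> (u \in T i.+1) || (u \in T i.+3).
  move=> uS exu; have := proj1 (adj _ x u i0 xT) exu.
  by rewrite setUAC in_setU => /orP[|/(inner u uS)/(_ exu)[]//]; rewrite in_setU.
have key a b : a \in S -> b \in S -> a \in T i.+1 -> b \in T i.+3 -> 
  [/\ S :&: T i.+2 = [set x], exists2 y, y \in S & y \in T i.+1 & exists2 y, y \in S & y \in T i.+3].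
  move=> aS bS aT bT; split; [|by exists a|by exists b].
  apply/setP => z; rewrite in_setI in_set1; case: eqP => [->|/eqP zx]; first by rewrite xS xT.
  apply/negP => /andP[zS zT].
  have ez u : u \in T i.+1 :|: T i.+3 -> e z u by apply: (proj2 (adj _ z u i0 zT)).
  have ex u : u \in T i.+1 :|: T i.+3 -> e x u by apply: (proj2 (adj _ x u i0 xT)).
  have aN : a \in T i.+1 :|: T i.+3 by rewrite in_setU aT.
  have bN : b \in T i.+1 :|: T i.+3 by rewrite in_setU bT orbT.
  apply: (@cycle_no_square S x a z b) => //; rewrite 1?[x == _]eq_sym ?ex ?ez 1?sy ?ex ?ez //.
  case: segT => _ dj _; apply: contraTneq aT => ->.
  have /disjointFl -> // : [disjoint T i.+1 & T i.+3].
  by apply: dj; move: iL; clear; lia.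
have x1 : x \in T i :|: T i.+2 by rewrite in_setU xT orbT.
have x3 : x \in T i.+2 :|: T i.+4 by rewrite in_setU xT.
case/orP: (nb y yS exy) => yT; case/orP: (nb y' y'S exy') => y'T.
- by case: (@same i.+1 y y').
- exact: (key y y').
- exact: (key y' y).
- by case: (@same i.+3 y y').
Qed.

Lemma segment_crossing S i j : induces_cycle e S -> (4 < #|S|)%N ->
  (2 <= i < L)%N -> (2 <= j < L)%N -> S :&: T i != set0 -> exists x, S :&: T j = [set x].
Proof.
move=> cS m4 iL jL Si.
have down a : (a.+2 < L)%N -> S :&: T a.+2 != set0 -> S :&: T 2 != set0.
  elim: a => // a IH aL /set0Pn[x /setIP[xS xT]]; apply: IH; first exact: ltnW.
  have [|_ [y yS yT] _] := segment_cycle (i := a.+3) cS m4 _ xS xT; first by rewrite /= aL.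
  by apply/set0Pn; exists y; rewrite in_setI yS.
have up a : (a.+2 < L)%N -> S :&: T 2 != set0 -> S :&: T a.+2 != set0.
  elim: a => // a IH aL S2; have /set0Pn[x /setIP[xS xT]] := IH (ltnW aL) S2.
  have [|_ _ [y yS yT]] := segment_cycle (i := a.+2) cS m4 _ xS xT; first by rewrite /= ltnW.
  by apply/set0Pn; exists y; rewrite in_setI yS.
have [x /setIP[xS xT]] : exists x, x \in S :&: T j.
  apply/set0Pn; case: i iL Si => [|[|i]] // iL /down h.
  by case: j jL => [|[|j]] // jL; apply: up => //; apply: h; case/andP: iL.
by exists x; have [] := segment_cycle cS m4 jL xS xT.
Qed.

End CycleLocal.

Lemma cycle_adj_sym k : symmetric (@cycle_adj k).
Proof. by move=> i j; rewrite /cycle_adj orbC. Qed.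

Lemma cycle_adjE k (i j : 'I_k) : cycle_adj i j =
  (nat_of_ord j == i.+1 %% k)%N || (nat_of_ord i == j.+1 %% k)%N.
Proof. by []. Qed.

Lemma cycle_adj_lt k (i j : 'I_k) : (i < j)%N ->
  cycle_adj i j = (nat_of_ord j == i.+1) || (nat_of_ord i == 0%N) && (j.+1 == k).
Proof.
move=> ij; have jk := ltn_ord j; rewrite cycle_adjE modn_small; last by apply: leq_ltn_trans jk.
congr (_ || _); case: (eqVneq j.+1 k) => [jE|jE]; first by rewrite jE modnn andbT.
rewrite modn_small; last by rewrite ltn_neqAle jE.
rewrite andbF; apply/negbTE; apply: contraTneq ij => ->; by rewrite -leqNgt leqnSn.
Qed.

(** * Closing a chain through a segment into a cyclic colouring *)

Section ChainColour.

Variables (V : finType).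
Implicit Types (e : rel V) (x y z p q : V) (A D S : {set V}) (Ds : seq {set V}).

Lemma chain_nth_sub e q x A Ds j z : all (fun D => D != set0) Ds -> chain e q x A Ds ->
  (j <= size Ds)%N -> z \in nth set0 (rcons Ds [set q]) j -> z \in A.
Proof.
move=> Ds0 ch; rewrite nth_rcons; case: (ltnP j (size Ds)) => [jm _|jm jm']; last first.
  by rewrite eqn_leq jm jm' /= => /set1P ->; apply: chain_q ch.
by apply/subsetP; apply: chain_sub ch _; rewrite ?mem_nth.
Qed.

Lemma chain_adj e q x A Ds i j y z : all (fun D => D != set0) Ds -> chain e q x A Ds ->
  (i < j <= size Ds)%N -> y \in nth set0 (rcons Ds [set q]) i ->
  z \in nth set0 (rcons Ds [set q]) j -> e y z = (j == i.+1) /\ y != z.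
Proof.
elim: Ds x A i j y z => [|D Ds IH] x A i j y z /=.
  by move=> _ _ /andP[ij]; rewrite leqn0 => /eqP j0; rewrite j0 in ij.
case/andP=> D0 Ds0 [qD DE chD] /andP[ij jm]; case: j ij jm => // j ij jm.
have [y0 y0D] := set0Pn _ D0.
case: i ij => [|i] ij /= yi zj; last by have [|-> //] := IH y0 _ i j y z Ds0 (chD _ y0D) _ yi zj;
  rewrite -ltnS ij.
have chy := chD y yi; have zA := chain_nth_sub Ds0 chy jm zj.
split; last by apply: contraTneq zA => <-; rewrite in_setD yi.
case: Ds IH jm Ds0 chD zj chy => [|D2 Ds2] IH jm Ds0 chD zj chy.
  case: j jm zj {ij} => // _ /= /set1P ->; by case: chy.
case: (chy) => q2 D2E ch2; have -> : e y z = (z \in D2) by rewrite -D2E in_fwd zA.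
case: j jm zj {ij} => [|j] jm zj; first by rewrite zj.
apply/negP => zD2; have [|] := IH y _ 0%N j.+1 z z Ds0 chy _ zD2 zj; first by [].
by rewrite eqxx.
Qed.

(** The cyclic order is [T 3], [T 2], then [Ds]. The chain only describes the neighbours of [p] and
    [q]; by the segment property the other vertices of [T 2] and [T 3] have the same neighbours
    outside these two clusters. *)
Lemma segment_colour e L (T : nat -> {set V}) p q Ds : simple_graph e ->
  segment e L T -> (4 <= L)%N -> p \in T 2 -> q \in T 3 ->
  all (fun D => D != set0) Ds -> Ds != [::] ->
  chain (del_edge e p q) q p (q |: ~: (T 2 :|: T 3)) Ds ->
  exists c : V -> 'I_(size Ds).+2,
    (forall x y, c x != c y -> e x y = cycle_adj (c x) (c y)) /\
    [seq #|[set x | c x == i]| | i <- enum 'I_(size Ds).+2] = [:: 3, 3 & [seq #|D| | D <- Ds]]%N.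
Proof.
move=> e_simple [cT dT adj] L4 pT qT Ds0 Dsn; set A := q |: _ => ch.
have sy := simple_sym e_simple.
have d23 : [disjoint T 2 & T 3] by apply: dT; rewrite /= ltnW // ltnS (leq_trans _ L4).
have dis i j z : (i < j <= L.+1)%N -> z \in T i -> z \notin T j.
  by move=> ij zi; rewrite (disjointFr (dT _ _ ij)).
have Azq z : z \in A -> z != q -> (z \notin T 2) && (z \notin T 3).
  by rewrite !inE => /predU1P[->|]; rewrite ?eqxx // negb_or.
have pA : p \notin A.
  rewrite !inE pT /= orbF; apply: contraTneq qT => <-.
  by rewrite (disjointFr d23).
set m := size Ds in Dsn *.
have m0 : (0 < m)%N by rewrite /m; case: (Ds) Dsn.
have DsA j z : (j < m)%N -> z \in nth set0 Ds j -> z \in A /\ z != q.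
  move=> jm zj; have zE : z \in nth set0 (rcons Ds [set q]) j by rewrite nth_rcons jm.
  split; first by apply: chain_nth_sub ch (ltnW jm) zE.
  have qE : q \in nth set0 (rcons Ds [set q]) m by rewrite nth_rcons ltnn eqxx in_set1.
  by have [|] := chain_adj (i := j) (j := m) Ds0 ch _ zE qE; rewrite ?jm /=.
have delE x y : x \in A -> y \in A -> del_edge e p q x y = e x y.
  move=> xA yA; rewrite /del_edge.
  have [xp yp] : x != p /\ y != p by split; [apply: contraNneq pA => <-|apply: contraNneq pA => <-].
  by rewrite (negPf xp) (negPf yp) !andbF /= andbT.
pose Cs := [:: T 3, T 2 & Ds].
have disC i j z : (i < j < m.+2)%N -> z \in nth set0 Cs i -> z \notin nth set0 Cs j.
  case: j => // j /andP[]; case: i => [|[|i]]; case: j => [|j] //= ij jm zi.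
  - by rewrite (disjointFl d23).
  - apply/negP => zj; have [zA zq] := DsA j z jm zj.
    by have := Azq z zA zq; rewrite zi andbF.
  - apply/negP => zj; have [zA zq] := DsA j z jm zj.
    by have := Azq z zA zq; rewrite zi.
  apply/negP => zj; have jm' : (j < m)%N := jm; have ij' : (i < j)%N := ij.
  have iE : z \in nth set0 (rcons Ds [set q]) i by rewrite nth_rcons (ltn_trans ij' jm').
  have jE : z \in nth set0 (rcons Ds [set q]) j by rewrite nth_rcons jm'.
  have [|] := chain_adj (i := i) (j := j) Ds0 ch _ iE jE; last by rewrite eqxx.
  by rewrite ij' ltnW.
have cover z : has (fun D => z \in D) Cs.
  rewrite /=; case: (boolP (z \in T 3)) => //= z3; case: (boolP (z \in T 2)) => //= z2.
  have zA : z \in A by rewrite !inE negb_or z2 z3 orbT.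
  have [zq|//] := chain_cover Ds0 ch zA; by rewrite zq qT in z3.
have cP z : (find (fun D => z \in D) Cs < m.+2)%N by rewrite -[m.+2]/(size Cs) -has_find.
pose c z := Ordinal (cP z).
have cin z : z \in nth set0 Cs (c z) by apply: (nth_find set0 (cover z)).
have cuniq z i : (i < m.+2)%N -> z \in nth set0 Cs i -> nat_of_ord (c z) = i.
  move=> im zi; case: (ltngtP (c z) i) => // lt.
    by have := disC (c z) i z; rewrite lt im zi => /(_ isT (cin z)).
  by have := disC i (c z) z; rewrite lt ltn_ord cin => /(_ isT zi).
exists c; split; last first.
  have -> : [seq #|[set x | c x == i]| | i <- enum 'I_m.+2] =
            [seq #|nth set0 Cs i| | i <- map val (enum 'I_m.+2)].
    rewrite -map_comp; apply: eq_map => i; apply: eq_card => z; rewrite in_set.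
    apply/eqP/idP => [<-|zi]; first exact: cin z.
    by apply: val_inj; apply: (cuniq z i (ltn_ord i) zi).
  rewrite val_enum_ord (map_comp (fun D : {set V} => #|D|) (nth set0 Cs)).
  have -> : [seq nth set0 Cs i | i <- iota 0 m.+2] = Cs by have := mkseq_nth set0 Cs;
    rewrite /mkseq /Cs /= -/m.
  rewrite /= !cT //; exact: (leq_trans _ (leqW L4)).
have main x y : (c x < c y)%N -> e x y = cycle_adj (c x) (c y).
  move=> xy; rewrite cycle_adj_lt //; have := cin x; have := cin y.
  have := ltn_ord (c y); move: xy; move: (nat_of_ord (c x)) (nat_of_ord (c y)) => i j.
  case: i => [|[|i]]; case: j => [|[|j]] //= ij jm; rewrite ?eqSS /= in jm *.
  - move=> y2 x3; apply: (proj2 (adj 3 x y _ x3)); first by rewrite /= ltnW.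
    by rewrite /= in_setU y2.
  - move=> yj x3; have [yA yq] := DsA j y jm yj.
    have /andP[y2 y3] := Azq y yA yq.
    have i3 : (0 < 3 <= L)%N by rewrite /= ltnW.
    have one w : w \in T 3 -> e w y = (y \in T 4).
      move=> w3; apply/idP/idP => h; last by apply: (proj2 (adj 3 w y i3 w3)); rewrite in_setU h orbT.
      by have := proj1 (adj 3 w y i3 w3) h; rewrite /= !in_setU (negPf y2) (negPf y3).
    rewrite one // -(one q qT) sy -delE //; last by rewrite !inE eqxx.
    have [|||-> _] := chain_adj (i := j) (j := m) (y := y) (z := q) Ds0 ch.
    + by rewrite (jm : (j < m)%N) leqnn.
    + by rewrite nth_rcons (jm : (j < m)%N).
    + by rewrite nth_rcons ltnn eqxx in_set1.
    by rewrite eq_sym.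
  - move=> yj x2; have [yA yq] := DsA j y jm yj.
    have /andP[y2 y3] := Azq y yA yq.
    have i2 : (0 < 2 <= L)%N by rewrite /= (leq_trans _ L4).
    have one w : w \in T 2 -> e w y = (y \in T 1).
      move=> w2; apply/idP/idP => h; last by apply: (proj2 (adj 2 w y i2 w2)); rewrite in_setU h.
      by have := proj1 (adj 2 w y i2 w2) h; rewrite /= !in_setU (negPf y2) (negPf y3) !orbF.
    rewrite one // -(one p pT) orbF.
    have -> : e p y = del_edge e p q p y.
      by rewrite /del_edge (negPf yq) eqxx andbF /=; case: (eqVneq y p) pA => [<-|];
        rewrite ?yA // andbF andbT.
    have -> : del_edge e p q p y = (y \in nth set0 Ds 0).
      case: (Ds) Dsn ch => // D Ds' _ [_ <- _] /=; by rewrite in_fwd yA.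
    case: j ij jm yj => [|j] _ jm yj; first by rewrite yj.
    apply/negP => y0; have := disC 2 j.+3 y; rewrite /= jm => /(_ isT y0).
    by rewrite yj.
  move=> yj xi; have im : (i < m)%N := ltn_trans (ij : (i < j)%N) jm.
  have [yA yq] := DsA j y jm yj; have [xA xq] := DsA i x im xi.
  rewrite -delE //; have [|||-> _] := chain_adj (i := i) (j := j) (y := x) (z := y) Ds0 ch.
  - by rewrite (ij : (i < j)%N) ltnW.
  - by rewrite nth_rcons im.
  - by rewrite nth_rcons (jm : (j < m)%N).
  by rewrite orbF.
move=> x y; case: (ltngtP (c x) (c y)) => [lt _|gt _|E]; first exact: main.
  by rewrite sy cycle_adj_sym main.
by move/eqP; case; apply: val_inj.
Qed.

End ChainColour.

Lemma bin_le_exp n m : ('C(n, m) <= n ^ m)%N.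
Proof.
elim: n m => [|n IH] [|m] //=; rewrite binS.
apply: leq_trans (leq_add (IH _) (IH _)) _.
rewrite addnC expnS -mulSn expnS leq_mul //.
by case: m => // m; rewrite leq_exp2r.
Qed.

Section QuasiBlowup.

Variables (R : archiRealFieldType) (t : R).
Hypotheses (t_gt0 : 0 < t) (t3 : t ^+ 3 = 3).

Lemma crossing_cycles_le (V : finType) (e : rel V) p q (A : {set V}) : simple_graph e ->
  e p q ->
  #|[set S in even_cycles e | [&& p \in S, q \in S & S :\ p \subset A]]|%:R
    <= par_paths (del_edge e p q) q R false p A.
Proof.
move=> e_simple epq; pose fl := [seq F <- ipaths (del_edge e p q) q p A | odd (size F)].
have -> : par_paths (del_edge e p q) q R false p A = (size fl)%:R.
  rewrite /par_paths -sum1_size natr_sum big_filter [RHS]big_mkcond /=.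
  by apply: eq_bigr => F _; case: (odd _).
rewrite ler_nat; apply: (@card_list_le V _ _ (fun F => [set v in p :: F])) => S.
rewrite !inE => /andP[/andP[cS oS] /and3P[pS qS SA]].
have [F [Fin SE sF]] := cycle_ipath e_simple cS pS qS epq SA; exists F => //.
by rewrite mem_filter Fin andbT; move: oS; rewrite -sF /= negbK.
Qed.

Lemma extremal_quasi : exists n1, forall (V : finType) (e : rel V),
  extremal e -> (n1 <= #|V|)%N ->
  optval t #|V| * t ^+ #|V| <= (nb_induced_even_cycles e)%:R ->
  exists k (c : V -> 'I_k), [/\ (8 <= k)%N,
    forall x y, c x != c y -> e x y = cycle_adj (c x) (c y) &
    optseq #|V| [seq #|[set x | c x == i]| | i <- enum 'I_k]].
Proof.
have /andP[t1 t1'] := t_bounds t_gt0 t3.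
have [n2 hn2] := extremal_segment t_gt0 t3 12.
have [n4 hn4] : exists n0, forall n, (n0 <= n)%N -> n%:R ^+ 4 <= 1 / 1000 * t ^+ n.
  by apply: poly_exp; lra.
exists (n2 + n4 + 40)%N => V e e_ext nV fe; have [e_simple _] := e_ext.
set n := #|V| in nV fe *.
have tn k : 0 < t ^+ k by rewrite exprn_gt0.
have /andP[c0 c1] := optval_bounds t_gt0 t3 n.
have [||T segT] := hn2 V e e_ext.
- by rewrite -/n; move: nV; clear; lia.
- by rewrite -/n; apply: le_trans fe; have := tn n; rewrite mulrC ler_pM2r //; lra.
case: (segT) => cT dT adj.
(* Eight clusters, so that [cycles_le] leaves at most [17 * t ^ (n - 24)] cycles avoiding them, that
   is [17 / 6561] of [t ^ n]. *)
pose U := \bigcup_(i < 8) T i.+2.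
have cU : #|U| = 24%N.
  suff H m : (m <= 8)%N -> #|\bigcup_(i < m) T i.+2| = (3 * m)%N by exact: H.
  elim: m => [|m IH] m10; first by rewrite big_ord0 cards0.
  rewrite big_ord_recr /= cardsU (IH (ltnW m10)) cT; last by move: m10; clear; lia.
  rewrite (_ : _ :&: _ = set0) ?cards0; first by clear; lia.
  apply/eqP; rewrite setI_eq0 disjoint_sym; apply: bigcup_disjoint => i _.
  by rewrite disjoint_sym; apply: dT; have := ltn_ord i; move: m10; clear; lia.
pose Apq q := q |: ~: (T 2 :|: T 3).
pose crossing (z : V * V) :=
  [set S in even_cycles e | [&& z.1 \in S, z.2 \in S & S :\ z.1 \subset Apq z.2]].
pose pairs z := ((z : V * V).1 \in T 2) && (z.2 \in T 3).
have cover : even_cycles e \subset [set S : {set V} | #|S| == 4] :|: cycles e (~: U) :|: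
     \bigcup_(z | pairs z) crossing z.
  apply/subsetP => S Se; move: (Se); rewrite inE => /andP[cS oS].
  rewrite !in_setU inE; have m2 : (2 < #|S|)%N by case/andP: cS.
  case: (eqVneq #|S| 4) => //= n4S; have m4 : (4 < #|S|)%N.
    by move: m2 n4S oS; clear; case: #|S| => [|[|[|[|[|?]]]]].
  case: (boolP (S \subset ~: U)) => SU; first by rewrite inE cS SU.
  apply/orP; right; have [x xS] := subsetPn SU.
  rewrite inE negbK => /bigcupP[[i iL] _ /= xT].
  have iL' : (2 <= i.+2 < 12)%N by move: iL; clear; lia.
  have Si : S :&: T i.+2 != set0 by apply/set0Pn; exists x; rewrite in_setI xS.
  have [p pE] := segment_crossing (j := 2) e_simple segT cS m4 iL' isT Si.
  have [q qE] := segment_crossing (j := 3) e_simple segT cS m4 iL' isT Si.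
  have /setIP[pS pT] : p \in S :&: T 2 by rewrite pE in_set1.
  have /setIP[qS qT] : q \in S :&: T 3 by rewrite qE in_set1.
  apply/bigcupP; exists (p, q); first by rewrite /pairs /= pT qT.
  rewrite in_set Se pS qS /=; apply/subsetP => v /setD1P[vp vS].
  rewrite !inE; case: eqVneq => //= vq; rewrite negb_or.
  have : v \notin S :&: T 2 by rewrite pE in_set1.
  have : v \notin S :&: T 3 by rewrite qE in_set1.
  by rewrite !in_setI vS => -> ->.
have card6 : #|~: (T 2 :|: T 3)| = (n - 6)%N.
  have := cardsC (T 2 :|: T 3); rewrite -/n cardsU !cT // (_ : T 2 :&: T 3 = set0) ?cards0.
    by clear; lia.
  by apply/eqP; rewrite setI_eq0; apply: dT.
have cA q : q \in T 3 -> #|Apq q|.-1 = (n - 6)%N.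
  by move=> qT; rewrite cardsU1 card6 !inE qT orbT.
have [z /andP[zT2 zT3] gap] : exists2 z, pairs z &
    199 / 200 * (optval t n * t ^+ (n - 6)) < par_paths (del_edge e z.1 z.2) z.2 R false z.1 (Apq z.2).
  apply: NNPP => nex.
  (* As [t ^ 6 = 9], the nine pairs would give only [199 / 200] of the optimum. The missing
     [1 / 200 * 85 / 100] of [t ^ n] exceeds [1 / 1000] for the 4-cycles plus [17 / 6561] for the
     cycles avoiding [U]. *)
  have : (nb_induced_even_cycles e)%:R <= (n%:R ^+ 4 + 17 * t ^+ (n - 24)) +
      9 * (199 / 200 * (optval t n * t ^+ (n - 6))).
    apply: le_trans (_ : #|[set S : {set V} | #|S| == 4] :|: cycles e (~: U) :|:
     \bigcup_(z | pairs z) crossing z|%:R <= _); first by rewrite ler_nat subset_leq_card.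
    apply: le_trans (_ : (#|[set S : {set V} | #|S| == 4]| + #|cycles e (~: U)| +
        \sum_(z | pairs z) #|crossing z|)%:R <= _).
      rewrite ler_nat; apply: leq_trans (leq_card_setU _ _) _; apply: leq_add;
        last exact: card_bigcup_sum.
      exact: leq_card_setU.
    rewrite !natrD; apply: lerD; first apply: lerD.
    - by rewrite -natrX ler_nat card_draws bin_le_exp.
    - apply: le_trans (cycles_le e_simple t_gt0 t3 _) _.
      by rewrite (_ : #|~: U| = (n - 24)%N) //; have := cardsC U; rewrite -/n cU; clear; lia.
    rewrite natr_sum.
    apply: le_trans (_ : \sum_(z | pairs z) 199 / 200 * (optval t n * t ^+ (n - 6)) <= _).
      apply: ler_sum => z zP; case/andP: (zP) => z2 z3.
      have ez : e z.1 z.2 by apply: (proj2 (adj 2 z.1 z.2 isT z2)); rewrite /= in_setU z3 orbT.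
      apply: le_trans (_ : par_paths (del_edge e z.1 z.2) z.2 R false z.1 (Apq z.2) <= _);
        first exact: crossing_cycles_le.
      by rewrite leNgt; apply/negP => h; apply: nex; exists z.
    rewrite sumr_const -[_ *+ _]mulr_natl.
    rewrite (_ : #|[pred z | pairs z]| = 9%N) //.
    have -> : #|[pred z | pairs z]| = #|setX (T 2) (T 3)| by apply: eq_card => z; rewrite !inE.
    by rewrite cardsX !cT.
  apply/negP; rewrite -ltNge; apply: lt_le_trans fe.
  have h4 := hn4 n (leq_trans (leq_addl _ _) (leq_trans (leq_addr _ _) nV)).
  have -> : t ^+ (n - 6) = t ^+ n / 9.
    rewrite -[in RHS](subnK (_ : 6 <= n)%N) ?exprD; last by move: nV; clear; lia.
    by rewrite (exprM t 3 2) t3; field.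
  have -> : t ^+ (n - 24) = t ^+ n / 81 / 81.
    rewrite -[in RHS](subnK (_ : 24 <= n)%N) ?exprD; last by move: nV; clear; lia.
    by rewrite (exprM t 3 8) t3; field.
  have h5 : 85 / 100 * t ^+ n <= optval t n * t ^+ n by rewrite ler_pM2r.
  by have := tn n; move: h4 h5; clear; lra.
set p := z.1 in zT2 gap; set q := z.2 in zT3 gap.
have [||||Ds ch oDs] := par_paths_gap (del_edge_sym e_simple p q) t_gt0 t3 (u :=
  n) _ _ _ (_ : 199 / 200 * (optval t n * t ^+ #|Apq q|.-1) < par_paths (del_edge e p q) q R false
    p (Apq q)).
- by rewrite !inE eqxx.
- rewrite !inE zT2 /= orbF; apply: contraTneq zT3 => <-.
  by rewrite (disjointFr (dT 2 3 isT)).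
- by rewrite cA //; move: nV; clear; lia.
- by rewrite cA.
have sDs := optseq_sizes oDs; rewrite all_map in sDs.
have Ds0 : all (fun D => D != set0) Ds.
  by apply: sub_all sDs => D /=; rewrite -card_gt0; case: #|D|.
have := chain_card Ds0 ch; move/(congr1 predn); rewrite cA // => /= nE.
have szD : (n - 6 <= 4 * size Ds)%N.
  rewrite nE; elim: (Ds) sDs => //= D Ds' IH /andP[/andP[_ D4] /IH h].
  by rewrite mulnS leq_add.
have k8 : (6 <= size Ds)%N by move: szD nV; clear; lia.
have Dsn : Ds != [::] by case: (Ds) k8.
have [c [cadj csz]] := segment_colour e_simple segT isT zT2 zT3 Ds0 Dsn ch.
exists (size Ds).+2, c; split=> //.
rewrite csz /=.
by rewrite (@optseq_mod _ n) //; clear; lia.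
Qed.

End QuasiBlowup.

(** * Blow-ups of even cycles *)

Section FourCycles.

Variables (V : finType) (e : rel V).
Hypothesis e_simple : simple_graph e.

Lemma four_cycle x y z w : x != z -> y != w -> e x y -> e y z -> e z w -> e w x ->
  ~~ e x z -> ~~ e y w ->
  uniq [:: x; y; z; w] /\ [set v in [:: x; y; z; w]] \in even_cycles e.
Proof.
move=> xz yw exy eyz ezw ewx /negPf nxz /negPf nyw; have sy := simple_sym e_simple.
have irr u v : e u v -> u != v by move=> h; apply: contraTneq h => ->; rewrite simple_irr.
have un : uniq [:: x; y; z; w].
  rewrite /= !inE !negb_or xz yw (irr _ _ exy) (irr _ _ eyz) (irr _ _ ezw).
  by rewrite [x == w]eq_sym (irr _ _ ewx).
split=> //; set s := [:: x; y; z; w] in un *.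
have SE : [set v in s] = [set nth x s i | i : 'I_4].
  apply/setP => v; rewrite in_set; apply/idP/imsetP => [vs|[i _ ->]]; last exact: mem_nth.
  have iv : (index v s < 4)%N by rewrite -[4%N]/(size s) index_mem.
  by exists (Ordinal iv); rewrite ?nth_index.
have c4 : #|[set v in s]| = 4 by rewrite cardsE; apply/card_uniqP.
rewrite in_set c4 andbT SE; apply: induces_cycleI => //.
  by move=> i j /eqP; rewrite nth_uniq // => /eqP /val_inj.
move=> [[|[|[|[|//]]]] i4] [[|[|[|[|//]]]] j4]; rewrite cycle_adjE /= ?simple_irr //.
all: by rewrite ?nxz ?nyw // sy ?nxz ?nyw.
Qed.

Lemma four_cycleP S : S \in even_cycles e -> #|S| = 4 -> exists x y z w,
  [/\ uniq [:: x; y; z; w], S = [set v in [:: x; y; z; w]] & 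
      [/\ e x y, e y z, e z w & e w x]].
Proof.
rewrite inE => /andP[cS _] c4; have [x xS] : exists x, x \in S by apply/card_gt0P; rewrite c4.
have [g [_ gS gin ge]] := cycle_walk cS xS; rewrite c4 in gS gin ge.
have un : uniq [:: g 0%N; g 1%N; g 2%N; g 3%N].
  have ne a b : (a < b < 4)%N -> g a != g b.
    move=> /andP[ab b4]; apply/eqP => /(proj1 (ge a b (ltn_trans ab b4) b4)) E.
    by rewrite E ltnn in ab.
  by rewrite /= !inE !negb_or !ne.
exists (g 0%N), (g 1%N), (g 2%N), (g 3%N); split=> //.
  apply/setP => v; rewrite !inE; apply/idP/idP => [/gS[a a4 ->]|].
    by move: a4; case: a => [|[|[|[|//]]]] _; rewrite eqxx ?orbT.
  by case/or4P => /eqP ->; rewrite gin.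
split.
- by have [_ ->] := ge 0%N 1%N isT isT.
- by have [_ ->] := ge 1%N 2%N isT isT.
- by have [_ ->] := ge 2%N 3%N isT isT.
by have [_ ->] := ge 3%N 0%N isT isT.
Qed.

End FourCycles.

Lemma iter_ordS k (i : 'I_k) a : val (iter a (@ordS k) i) = ((i + a) %% k)%N.
Proof.
elim: a => [|a IH]; first by rewrite addn0 modn_small.
by rewrite iterS /= IH addnS -addn1 modnDml addn1.
Qed.

Lemma ordS_iter_neq k (i : 'I_k) a : (0 < a < k)%N -> iter a (@ordS k) i != i.
Proof.
case/andP=> a0 ak; apply/eqP => /(congr1 val); rewrite iter_ordS.
move/eqP; rewrite -[X in _ == X](modn_small (ltn_ord i)) -[X in _ == X %[mod _]]addn0 eqn_modDl.
by rewrite modn_small // mod0n; case: a a0 {ak}.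
Qed.

Lemma ordS_neq k (i : 'I_k) : (1 < k)%N -> (ordS i == i) = false.
Proof. by move=> k1; apply/negbTE/(@ordS_iter_neq k i 1). Qed.

Lemma ordSS_neq k (i : 'I_k) : (2 < k)%N -> (ordS (ordS i) == i) = false.
Proof. by move=> k2; apply/negbTE/(@ordS_iter_neq k i 2). Qed.

Section Blowup.

Variables (V : finType) (k : nat) (c : V -> 'I_k).
Hypotheses (k5 : (5 <= k)%N) (k_even : ~~ odd k).
Implicit Types (i j : 'I_k) (S : {set V}) (x y z w : V).

Definition blow : rel V := fun x y => cycle_adj (c x) (c y).
Definition cl i := [set x | c x == i].
Definition prof S := [ffun i => #|S :&: cl i|].

Lemma adjS i : cycle_adj i (ordS i). Proof. by rewrite /cycle_adj eqxx. Qed.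
Lemma adjP i : cycle_adj i (ord_pred i). Proof. by rewrite /cycle_adj ord_predK eqxx orbT. Qed.

Lemma adj_cases i j : cycle_adj i j -> j = ordS i \/ j = ord_pred i.
Proof. by case/orP=> /eqP ->; [left|right; rewrite ordSK]. Qed.

Lemma adj_irr i : cycle_adj i i = false.
Proof.
rewrite /cycle_adj orbb eq_sym; apply/negbTE.
by apply: (@ordS_iter_neq k i 1); rewrite (leq_trans _ k5).
Qed.

Lemma ordS_neq_pred i : ordS i != ord_pred i.
Proof.
apply: contra_neq (@ordS_iter_neq k (ord_pred i) 2 _); last by rewrite (leq_trans _ k5).
by move=> /= E; rewrite ord_predK.
Qed.

Lemma adj_SP i : cycle_adj (ordS i) (ord_pred i) = false.
Proof.
apply/negbTE/negP => /adj_cases[]; rewrite ?ordSK.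
  move=> E; have := @ordS_iter_neq k (ord_pred i) 3; rewrite /= ord_predK -E eqxx.
  by rewrite (leq_trans _ k5) // => /(_ isT).
by move=> E; have := @ordS_iter_neq k i 1;
  rewrite /= -{1}E ord_predK eqxx (leq_trans _ k5) // => /(_ isT).
Qed.

Lemma blow_simple : simple_graph blow.
Proof.
apply/andP; split; first by apply/forallP => x; rewrite /blow adj_irr.
by apply/forallP => x; apply/forallP => y; rewrite /blow cycle_adj_sym.
Qed.

Lemma card_prof (s : 'I_k -> nat) :
  #|[set S | prof S == [ffun i => s i]]| = (\prod_i 'C(#|cl i|, s i))%N.
Proof.
pose F i := [set D : {set V} | D \subset cl i & #|D| == s i].
pose h S : {ffun 'I_k -> {set V}} := [ffun i => S :&: cl i].
have h_inj : injective h.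
  move=> S S' /ffunP hh; apply/setP => x; have /setP/(_ x) := hh (c x).
  by rewrite !ffunE !inE eqxx !andbT.
rewrite -(card_imset _ h_inj) (eq_card (B := family F)); last first.
  move=> f; apply/imsetP/familyP => [[S]|fF].
    rewrite inE => /eqP/ffunP pS -> i; have := pS i; rewrite !ffunE => sE.
    by rewrite inE subsetIr sE eqxx.
  have hE : h (\bigcup_i f i) = f.
    apply/ffunP => i; rewrite ffunE; apply/setP => x; rewrite !inE.
    have fsub j : f j \subset cl j by have := fF j; rewrite inE => /andP[].
    apply/andP/idP => [[/bigcupP[j _ xj] /eqP <-]|xi].
      by have := subsetP (fsub j) x xj; rewrite inE => /eqP ->.
    by split; [apply/bigcupP; exists i | have := subsetP (fsub i) x xi; rewrite inE].
  exists (\bigcup_i f i); last by rewrite hE.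
  rewrite inE; apply/eqP/ffunP => i; have := congr1 (fun f : {ffun _} => f i) hE.
  by rewrite !ffunE => ->; have := fF i; rewrite inE => /andP[_ /eqP].
rewrite card_family foldrE big_map big_enum /=.
by apply: eq_bigr => i _; rewrite cards_draws.
Qed.

Lemma card_profs (ps : seq {ffun 'I_k -> nat}) : uniq ps ->
  #|[set S | prof S \in ps]| = (\sum_(s <- ps) \prod_i 'C(#|cl i|, s i))%N.
Proof.
elim: ps => [|s ps IH] /=; first by rewrite big_nil; move=> _; apply: eq_card0 => S; rewrite inE.
case/andP=> nin /IH {}IH; rewrite big_cons -IH -card_prof.
rewrite -[LHS](cardsID [set S | prof S == s]); congr (_ + _)%N; apply: eq_card => S; rewrite !inE.
  have -> : [ffun i => s i] = s by apply/ffunP => i; rewrite ffunE.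
  by case: eqP => _; rewrite ?andbF ?andbT.
by case: eqP => [->|_] //=; rewrite (negPf nin).
Qed.

(** [sq] and [dm] are the two kinds of profiles of 4-cycles: two vertices in each of two adjacent
    clusters, or two in one cluster and one in each cluster next to it. *)
Definition sq i : {ffun 'I_k -> nat} := [ffun j => 2 * (j == i) + 2 * (j == ordS i)]%N.
Definition dm i : {ffun 'I_k -> nat} := [ffun j => 2 * (j == i) + (j == ordS i) + (j == ord_pred i)]%N.

Lemma prof_uniq s i : uniq s -> prof [set v in s] i = count (fun v => c v == i) s.
Proof.
move=> us; rewrite ffunE -size_filter -(card_uniqP (filter_uniq _ us)).
by apply: eq_card => v; rewrite !inE mem_filter andbC.
Qed.

(** Since [k >= 5], four steps cannot wind around the cycle, so the walk backtracks. *)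
Lemma closed_walk4 i1 i2 i3 i4 : cycle_adj i1 i2 -> cycle_adj i2 i3 -> cycle_adj i3 i4 ->
  cycle_adj i4 i1 -> i1 = i3 \/ i2 = i4.
Proof.
have S4 i : ordS (ordS (ordS (ordS i))) != i by apply: (@ordS_iter_neq k i 4); rewrite (leq_trans _ k5).
have S2 i : ordS (ordS i) != i by apply: (@ordS_iter_neq k i 2); rewrite (leq_trans _ k5).
have Si := can_inj (@ordSK k).
case/orP=> /eqP E12; case/orP=> /eqP E23; case/orP=> /eqP E34; case/orP=> /eqP E41;
  try (by left; apply: Si; congruence); try (by right; apply: Si; congruence);
  try (by left; congruence); try (by right; congruence); exfalso.
all: try (by have /eqP := S4 i1; apply; congruence).
all: try (by have /eqP := S4 i4; apply; congruence).
all: try (by have /eqP := S2 i1; apply; apply: Si; congruence).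
all: try (by have /eqP := S2 i4; apply; apply: Si; congruence).
Qed.

Lemma quad_prof x y z w : uniq [:: x; y; z; w] -> c x = c z -> blow x y -> blow x w ->
  exists i, prof [set v in [:: x; y; z; w]] = sq i \/ prof [set v in [:: x; y; z; w]] = dm i.
Proof.
move=> us xz /adj_cases ey /adj_cases ew; set i := c x in xz ey ew *.
have P j : prof [set v in [:: x; y; z; w]] j = ((i == j) + ((c y == j) + ((i == j) + (c w == j))))%N.
  by rewrite prof_uniq //= -xz addn0.
case: ey ew => [ey|ey] [ew|ew].
- exists i; left; apply/ffunP => j; rewrite P ffunE ey ew [i == j]eq_sym [_ == j]eq_sym.
  by case: (j == i); case: (j == _).
- exists i; right; apply/ffunP => j; rewrite P ffunE ey ew [i == j]eq_sym ![_ == j]eq_sym.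
  by case: (j == i); case: (j == _); case: (j == _).
- exists i; right; apply/ffunP => j; rewrite P ffunE ey ew [i == j]eq_sym ![_ == j]eq_sym.
  by case: (j == i); case: (j == ordS _); case: (j == _).
- exists (ord_pred i); left; apply/ffunP => j;
    rewrite P ffunE ey ew ord_predK [i == j]eq_sym ![_ == j]eq_sym.
  by case: (j == i); case: (j == _).
Qed.

(** In a cycle longer than four, two vertices of one cluster would share two neighbours on the cycle
    and give a square. So it meets each cluster at most once, its two neighbours at any vertex lie
    on opposite sides, and it goes all the way round. *)
Lemma even_cycles_prof S : S \in even_cycles blow ->
  [\/ prof S = [ffun=> 1%N], exists i, prof S = sq i | exists i, prof S = dm i].
Proof.
move=> Sin; move: (Sin); rewrite in_set => /andP[cS oS].
have m2 : (2 < #|S|)%N by case/andP: cS.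
case: (eqVneq #|S| 4) => [c4|n4].
  have [x [y [z [w [un -> [exy eyz ezw ewx]]]]]] := four_cycleP Sin c4.
  have sy := simple_sym blow_simple.
  case: (closed_walk4 exy eyz ezw ewx) => E.
    have [|i [h|h]] := quad_prof un E exy; first by rewrite sy.
    - by apply: Or32; exists i.
    - by apply: Or33; exists i.
  have pE : [set v in [:: x; y; z; w]] = [set v in [:: y; z; w; x]].
    by apply/setP => v; rewrite !inE; do 4 case: (v == _).
  have un' : uniq [:: y; z; w; x] by rewrite -(rot_uniq 3).
  rewrite pE; have [|i [h|h]] := quad_prof un' E eyz; first by rewrite sy.
  - by apply: Or32; exists i.
  - by apply: Or33; exists i.
have m4 : (4 < #|S|)%N by move: m2 n4 oS; clear; case: #|S| => [|[|[|[|[|?]]]]].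
have [x0 x0S] : exists x, x \in S by apply/card_gt0P; apply: leq_trans m2.
have c_inj : {in S &, injective c}.
  move=> x x' xS x'S E; apply/eqP; apply: contraT => xx'.
  have [y [y' [yS y'S yy' exy [exy' _]]]] := cycle_nbrs cS xS (ltnW m4).
  case: (@cycle_no_square V blow blow_simple S x y x' y') => //.
  - by rewrite (simple_sym blow_simple) /blow -E.
  - by rewrite /blow -E.
  - by rewrite (simple_sym blow_simple).
have step x : x \in S -> exists2 y, y \in S & c y = ordS (c x).
  move=> xS; have [y [y' [yS y'S yy' exy [exy' _]]]] := cycle_nbrs cS xS (ltnW m4).
  case: (adj_cases exy) => [|ey]; first by exists y.
  case: (adj_cases exy') => [|ey']; first by exists y'.
  by case/eqP: yy'; apply: c_inj => //; rewrite ey ey'.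
have all_c i : exists2 y, y \in S & c y = i.
  have [a ->] : exists a, i = iter a (@ordS k) (c x0).
    exists (i + (k - c x0))%N; apply: val_inj; rewrite iter_ordS.
    rewrite addnCA subnKC; last by rewrite ltnW.
    by rewrite modnDr modn_small.
  elim: a => [|a [y yS yE]]; first by exists x0.
  by have [y' y'S y'E] := step y yS; exists y'; rewrite // y'E yE.
apply: Or31; apply/ffunP => i; rewrite !ffunE; have [y yS yE] := all_c i.
apply/eqP/cards1P; exists y; apply/setP => v; rewrite !inE; apply/andP/eqP => [[vS /eqP vi]|->].
  by apply: c_inj; rewrite // yE.
by rewrite yS yE.
Qed.

Lemma quad_cycle x y z w : x != z -> y != w -> c x = c z -> blow x y -> blow x w ->
  ~~ blow y w ->
  uniq [:: x; y; z; w] /\ [set v in [:: x; y; z; w]] \in even_cycles blow.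
Proof.
move=> xz yw cxz exy exw nyw; have sy := simple_sym blow_simple.
apply: (four_cycle blow_simple) => //.
- by rewrite sy /blow -cxz.
- by rewrite /blow -cxz.
- by rewrite sy.
- by rewrite /blow -cxz adj_irr.
Qed.

Lemma prof_set S (s : seq V) : {subset s <= S} ->
  (forall i, prof S i <= count (fun v => c v == i) s)%N -> uniq s -> S = [set v in s].
Proof.
move=> sS le us; apply/setP => v; rewrite inE; apply/idP/idP => [vS|]; last exact: sS.
have sub : [set v in s] :&: cl (c v) \subset S :&: cl (c v).
  by apply/setSI/subsetP => u; rewrite inE; apply: sS.
have : [set v in s] :&: cl (c v) == S :&: cl (c v).
  by rewrite eqEcard sub; have := le (c v); rewrite -prof_uniq // !ffunE.
move/eqP/setP/(_ v); by rewrite !inE vS eqxx andbT.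
Qed.

Lemma prof_even_cycles S :
  [\/ prof S = [ffun=> 1%N], exists i, prof S = sq i | exists i, prof S = dm i] ->
  S \in even_cycles blow.
Proof.
case=> [pS|[i pS]|[i pS]].
- have f_ex i : exists y, S :&: cl i == [set y].
    have /ffunP/(_ i) := pS; rewrite !ffunE => /eqP/cards1P[y ->]; by exists y.
  have fE i : S :&: cl i = [set xchoose (f_ex i)] by exact/eqP/(xchooseP (f_ex i)).
  pose f i := xchoose (f_ex i).
  have fS i : f i \in S :&: cl i by rewrite fE in_set1.
  have cf i : c (f i) = i by have := fS i; rewrite !inE => /andP[_ /eqP].
  have f_inj : injective f by move=> i j E; rewrite -[i]cf E cf.
  have SE : S = [set f i | i : 'I_k].
    apply/setP => v; apply/idP/imsetP => [vS|[i _ ->]]; last by have /setIP[] := fS i.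
    exists (c v) => //; have : v \in S :&: cl (c v) by rewrite !inE vS /=.
    by rewrite fE => /set1P.
  rewrite inE {2}SE card_imset // card_ord k_even andbT SE.
  apply: induces_cycleI => //; first by apply: leq_trans k5.
  by move=> i' j'; rewrite /blow !cf.
- have P j : #|S :&: cl j| = sq i j by rewrite -pS ffunE.
  have nS : ordS i != i by apply: (@ordS_iter_neq k i 1); rewrite (leq_trans _ k5).
  have /cards2P[x [z [xz xzE]]] : #|S :&: cl i| == 2%N.
    by rewrite P ffunE eqxx [i == _]eq_sym (negPf nS).
  have /cards2P[y [w [yw ywE]]] : #|S :&: cl (ordS i)| == 2%N.
    by rewrite P ffunE eqxx (negPf nS).
  have /setIP[xS] : x \in S :&: cl i by rewrite xzE !inE eqxx.
  have /setIP[zS] : z \in S :&: cl i by rewrite xzE !inE eqxx orbT.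
  have /setIP[yS] : y \in S :&: cl (ordS i) by rewrite ywE !inE eqxx.
  have /setIP[wS] : w \in S :&: cl (ordS i) by rewrite ywE !inE eqxx orbT.
  rewrite !inE => /eqP cw /eqP cy /eqP cz /eqP cx.
  have [||||un] := @quad_cycle x y z w xz yw.
  + by rewrite cx cz.
  + by rewrite /blow cx cy adjS.
  + by rewrite /blow cx cw adjS.
  + by rewrite /blow cy cw adj_irr.
  have sub : {subset [:: x; y; z; w] <= S} by move=> v; rewrite !inE => /or4P[] /eqP ->.
  have le j : (prof S j <= count (fun v => c v == j) [:: x; y; z; w])%N.
    rewrite pS ffunE /= cx cy cz cw [i == j]eq_sym [_ == j]eq_sym.
    by case: (j == i); case: (j == _).
  by rewrite -(prof_set sub le un) inE.
have P j : #|S :&: cl j| = dm i j by rewrite -pS ffunE.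
have nS : ordS i != i by apply: (@ordS_iter_neq k i 1); rewrite (leq_trans _ k5).
have nP : ord_pred i != i.
  by apply: contra_neq nS => E; rewrite -{1}E ord_predK.
have nSP := ordS_neq_pred i.
have /cards2P[x [z [xz xzE]]] : #|S :&: cl i| == 2%N.
  by rewrite P ffunE eqxx [i == _]eq_sym (negPf nS) [i == _]eq_sym (negPf nP).
have /cards1P[y yE] : #|S :&: cl (ordS i)| == 1%N.
  by rewrite P ffunE eqxx (negPf nS) (negPf nSP).
have /cards1P[w wE] : #|S :&: cl (ord_pred i)| == 1%N.
  by rewrite P ffunE eqxx (negPf nP) [_ == ordS i]eq_sym (negPf nSP).
have /setIP[xS] : x \in S :&: cl i by rewrite xzE !inE eqxx.
have /setIP[zS] : z \in S :&: cl i by rewrite xzE !inE eqxx orbT.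
have /setIP[yS] : y \in S :&: cl (ordS i) by rewrite yE !inE eqxx.
have /setIP[wS] : w \in S :&: cl (ord_pred i) by rewrite wE !inE eqxx.
rewrite !inE => /eqP cw /eqP cy /eqP cz /eqP cx.
have yw : y != w by apply: contraNneq nSP => yw; rewrite -cy -cw yw.
have [||||un] := @quad_cycle x y z w xz yw.
- by rewrite cx cz.
- by rewrite /blow cx cy adjS.
- by rewrite /blow cx cw adjP.
- by rewrite /blow cy cw adj_SP.
have sub : {subset [:: x; y; z; w] <= S} by move=> v; rewrite !inE => /or4P[] /eqP ->.
have le j : (prof S j <= count (fun v => c v == j) [:: x; y; z; w])%N.
  rewrite pS ffunE /= cx cy cz cw [i == j]eq_sym ![_ == j]eq_sym.
  by case: (j == i); case: (j == ordS _); case: (j == _).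
by rewrite -(prof_set sub le un) inE.
Qed.

Lemma card_even_cycles : #|even_cycles blow| =
  (\prod_i #|cl i| + \sum_i ('C(#|cl i|, 2) * 'C(#|cl (ordS i)|, 2) +
     'C(#|cl i|, 2) * (#|cl (ordS i)| * #|cl (ord_pred i)|)))%N.
Proof.
pose ps := [ffun=> 1%N] :: [seq sq i | i <- enum 'I_k] ++ [seq dm i | i <- enum 'I_k].
have nS i : (ordS i == i) = false.
  by apply/negbTE; apply: (@ordS_iter_neq k i 1); rewrite (leq_trans _ k5).
have nS' i : (i == ordS i) = false by rewrite eq_sym nS.
have nP i : (ord_pred i == i) = false by rewrite -{2}[i]ord_predK nS'.
have nP' i : (i == ord_pred i) = false by rewrite eq_sym nP.
have nSP i : (ordS i == ord_pred i) = false by apply/negbTE/ordS_neq_pred.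
have nSP' i : (ord_pred i == ordS i) = false by rewrite eq_sym nSP.
have ups : uniq ps.
  rewrite /= mem_cat negb_or cat_uniq; apply/and3P; split; first (apply/andP; split).
  - apply/mapP => -[i _ /ffunP/(_ i)]; by rewrite !ffunE eqxx nS'.
  - apply/mapP => -[i _ /ffunP/(_ i)]; by rewrite !ffunE eqxx nS' nP'.
  - rewrite map_inj_uniq ?enum_uniq // => i j E; apply/eqP; apply: contraT => /negPf ij.
    have := congr1 (fun f : {ffun _} => f i) E; have := congr1 (fun f : {ffun _} => f j) E.
    rewrite !ffunE !eqxx nS' nS' ij [j == i]eq_sym ij; case: eqP => //= ji _; case: eqP => //= ij' _.
    by have := @ordS_iter_neq k i 2; rewrite /= -ji -ij' eqxx (leq_trans _ k5) // => /(_ isT).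
  apply/andP; split.
    apply/hasPn => f /mapP[i _ ->]; apply/mapP => -[j _ E].
    have := congr1 (fun f : {ffun _} => f j) E; have := congr1 (fun f : {ffun _} => f (ordS j)) E.
    rewrite !ffunE !eqxx nS nS'; case: (eqVneq (ordS j) i) => [<- _|_].
      rewrite nS' ordSK eqxx; case: eqP => // jE _.
      by have := @ordS_iter_neq k j 2; rewrite /= -jE eqxx (leq_trans _ k5) // => /(_ isT).
    by case: (eqVneq (ordS j) (ordS i)) => [->|_]; rewrite ?nSP //; case: eqP.
  rewrite map_inj_uniq ?enum_uniq // => i j E; apply/eqP; apply: contraT => /negPf ij.
  have := congr1 (fun f : {ffun _} => f i) E.
  rewrite !ffunE !eqxx nS' nP' ij; case: (eqVneq i (ordS j)) => [->|_]; first by rewrite nSP.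
  by case: eqP.
have -> : even_cycles blow = [set S | prof S \in ps].
  apply/setP => S; rewrite [RHS]in_set /ps in_cons mem_cat; apply/idP/idP.
    case/even_cycles_prof => [->|[i ->]|[i ->]]; rewrite ?eqxx //.
      by rewrite map_f ?orbT // mem_enum.
    by rewrite orbA orbC map_f // mem_enum.
  case/or3P => [/eqP pS|/mapP[i _ pS]|/mapP[i _ pS]]; apply: prof_even_cycles.
  - exact: Or31.
  - by apply: Or32; exists i.
  - by apply: Or33; exists i.
rewrite card_profs // big_cons big_cat !big_map -!big_enum /= big_split /=; congr (_ + _)%N.
  by apply: eq_bigr => i _; rewrite ffunE bin1.
congr (_ + _)%N; apply: eq_bigr => i _.
  rewrite (bigD1 i) //= (bigD1 (ordS i)) /=; last by rewrite nS.
  rewrite !ffunE !eqxx nS nS' big1 ?muln1 // => j /andP[/negPf ji /negPf js].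
  by rewrite ffunE ji js bin0.
rewrite (bigD1 i) //= (bigD1 (ordS i)) /=; last by rewrite nS.
rewrite (bigD1 (ord_pred i)) /=; last by rewrite nP nSP'.
rewrite !ffunE !eqxx nS nS' nP nP' nSP nSP' !bin1 big1 ?muln1 // => j /andP[/andP[/negPf ji /negPf
  js] /negPf jp].
by rewrite ffunE ji js jp bin0.
Qed.

End Blowup.

Lemma extremal_blow (V : finType) (e : rel V) k (c : V -> 'I_k) :
  extremal e -> (5 <= k)%N -> ~~ odd k ->
  (forall x y, c x != c y -> e x y = cycle_adj (c x) (c y)) ->
  (forall i, 2 <= #|cl c i| <= 4)%N -> (#|[set i | #|cl c i| == 4]| <= 2)%N ->
  forall x y, e x y = blow c x y.
Proof.
move=> [e_simple max] k5 k_even cadj sz few.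
have sy := simple_sym e_simple; have b_simple := blow_simple c k5.
have blow_inner u v : c u = c v -> blow c u v = false by move=> E; rewrite /blow E adj_irr.
have bad u v : e u v != blow c u v -> c u = c v /\ e u v.
  case: (eqVneq (c u) (c v)) => [E|/cadj ->]; last by rewrite eqxx.
  by rewrite blow_inner //; case: (e u v).
(* An edge [x x'] inside a cluster destroys the cycles [S1], [S2], [S3] below, whereas a
   cycle with an edge inside a cluster is contained in it, so that it is a cluster of size 4. *)
suff no_inner x x' : c x = c x' -> ~~ e x x'.
  move=> x y; apply/eqP; apply: contraT => /bad[E exy].
  by have := no_inner x y E; rewrite exy.
move=> E; apply/negP => exx'; set i := c x in E.
have xx' : x != x' by apply: contraTneq exx' => ->; rewrite simple_irr.
have two j : exists y y', [/\ y != y', c y = j & c y' = j].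
  have /andP[/card_gt1P[y [y' [yj y'j yy']]] _] := sz j; exists y, y'.
  by move: yj y'j; rewrite !inE => /eqP -> /eqP ->.
have [y [y' [yy' cy cy']]] := two (ordS i); have [z [z' [zz' cz cz']]] := two (ord_pred i).
have bl j w : c w = j -> cycle_adj i j -> [/\ blow c x w, e x w & e x' w].
  move=> cw ij; have iw : c x != c w.
    by rewrite cw; apply: contraTneq ij => <-; rewrite adj_irr.
  by rewrite /blow !cadj -?E // cw.
have [bxy exy ex'y] := bl _ _ cy (adjS i); have [bxy' exy' ex'y'] := bl _ _ cy' (adjS i).
have [bxz exz ex'z] := bl _ _ cz (adjP i); have [bxz' exz' ex'z'] := bl _ _ cz' (adjP i).
have nSP := ordS_neq_pred k5 i.
have yz : y != z by apply: contraNneq nSP => yz; rewrite -cy -cz yz.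
set S1 := [set v in [:: x; y; x'; y']]; set S2 := [set v in [:: x; z; x'; z']].
set S3 := [set v in [:: x; y; x'; z]].
have [|u1 S1b] := @quad_cycle V k c k5 _ _ _ _ xx' yy' E bxy bxy'; first by rewrite blow_inner // cy cy'.
have [|u2 S2b] := @quad_cycle V k c k5 _ _ _ _ xx' zz' E bxz bxz'; first by rewrite blow_inner // cz cz'.
have [|u3 S3b] := @quad_cycle V k c k5 _ _ _ _ xx' yz E bxy bxz; first by rewrite /blow cy cz adj_SP.
have lost w w' : e x w -> e x' w -> uniq [:: x; w; x'; w'] -> [set v in [:: x; w; x';
  w']] \notin even_cycles e.
  move=> exw ex'w un; apply/negP; rewrite in_set => /andP[cS _].
  apply: (@cycle_no_triangle V e e_simple _ x x' w cS) => //; last by rewrite sy.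
    by rewrite cardsE (card_uniqP un).
  by rewrite !inE !eqxx ?orbT.
have neq3 : [&& S1 != S2, S1 != S3 & S2 != S3].
  have nin w w1 w2 : w != x -> w != x' -> w != w1 -> w != w2 -> w \notin [set v in [:: x; w1; x'; w2]].
    by rewrite !inE !negb_or => -> -> -> ->.
  have cS w : c w = ordS i -> [/\ w != x, w != x', w != z & w != z'].
    move=> cw; have nSi : ordS i != i by apply: contraTneq (adjS i) => ->; rewrite adj_irr.
    split; [move: nSi | move: nSi | move: nSP | move: nSP]; apply: contraNneq => wE.
    - by rewrite -cw wE.
    - by rewrite -cw wE E.
    - by rewrite -cw wE cz.
    - by rewrite -cw wE cz'.
  have cP w : c w = ord_pred i -> [/\ w != x, w != x' & w != y].
    move=> cw; have nPi : ord_pred i != i by apply: contraTneq (adjP i) => ->; rewrite adj_irr.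
    split; [move: nPi | move: nPi | move: nSP]; apply: contraNneq => wE.
    - by rewrite -cw wE.
    - by rewrite -cw wE E.
    - by rewrite -cw wE cy.
  have [y'x y'x' y'z y'z'] := cS y' cy'; have [z'x z'x' z'y] := cP z' cz'.
  have y'y : y' != y by rewrite eq_sym. have z'z : z' != z by rewrite eq_sym.
  apply/and3P; split.
  - by apply: contraNneq (nin y' z z' y'x y'x' y'z y'z' : y' \notin S2) => <-; rewrite !inE eqxx !orbT.
  - by apply: contraNneq (nin y' y z y'x y'x' y'y y'z : y' \notin S3) => <-; rewrite !inE eqxx !orbT.
  - by apply: contraNneq (nin z' y z z'x z'x' z'y z'z : z' \notin S3) => <-; rewrite !inE eqxx !orbT.
pose L3 := [set S1; S2; S3]; pose X4 := [set cl c j | j in [set j | #|cl c j| == 4]].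
have cL3 : #|L3| = 3%N.
  case/and3P: neq3 => n12 n13 n23.
  by rewrite /L3 -setUA cardsU1 cards2 in_set2 negb_or n12 n13 n23.
have sub : even_cycles e \subset (even_cycles (blow c) :\: L3) :|: X4.
  apply/subsetP => S Se; move: (Se); rewrite in_set => /andP[cS oS].
  have m3 : (3 < #|S|)%N by case/andP: cS oS => + _; clear; case: #|S| => [|[|[|[|?]]]].
  rewrite in_setU in_setD; case: (boolP [forall u in S, forall v in S, e u v == blow c u v]).
    move=> /forall_inP same.
    have hg : {in S &, forall u v, blow c (id u) (id v) = e u v}.
      by move=> u v uS vS; apply/esym/eqP; move/forall_inP: (same u uS); apply.
    have := induces_cycle_img (in2W (fun _ _ => id)) hg cS; rewrite imset_id => /andP[cb _].
    have Sb : S \in even_cycles (blow c) by rewrite in_set cb oS.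
    rewrite Sb andbT; apply/orP; left.
    by rewrite /L3 !in_setU !in_set1 !negb_or -andbA; apply/and3P; split;
      apply: contraTneq Se => ->; apply: lost.
  rewrite negb_forall_in => /exists_inP[u uS]; rewrite negb_forall_in => /exists_inP[v vS].
  move/bad => [cuv euv]; apply/orP; right.
  (* A vertex of an adjacent cluster is joined to both [u] and [v], so a cycle leaving the cluster
     would contain a triangle. *)
  have Ssub : S \subset cl c (c u).
    apply: (cycle_closed cS uS); first by rewrite inE.
    move=> a b aS; rewrite !inE => /eqP ca bS eab; apply: contraT => cb.
    have cb' : c a != c b by rewrite ca eq_sym.
    have adjab : cycle_adj (c u) (c b) by rewrite -ca -cadj.
    case: (@cycle_no_triangle V e e_simple S u v b cS m3) => //.
      by rewrite cadj -?cuv // eq_sym.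
    by rewrite sy cadj // eq_sym.
  have /andP[_ le4] := sz (c u).
  have SE : S = cl c (c u).
    by apply/eqP; rewrite eqEcard Ssub (leq_trans le4).
  apply/imsetP; exists (c u) => //; rewrite inE eqn_leq le4 /=.
  by rewrite -SE.
have := max _ b_simple; rewrite leqNgt => /negP; apply.
apply: leq_ltn_trans (subset_leq_card sub) _; apply: leq_ltn_trans (leq_card_setU _ _) _.
have cX4 : (#|X4| <= 2)%N by apply: leq_trans (leq_imset_card _ _) few.
have := cardsID L3 (even_cycles (blow c)).
have -> : #|even_cycles (blow c) :&: L3| = 3%N.
  by rewrite -cL3; apply: eq_card => S; rewrite in_setI andbC; case: (boolP (S \in L3)) => //;
    rewrite in_setU in_set2 in_set1 => /orP[/orP[]|] /eqP ->; rewrite ?S1b ?S2b ?S3b.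
rewrite /nb_induced_even_cycles -/(even_cycles _); move: cX4; clear; lia.
Qed.

(** * Canonical colourings *)

Lemma graph_iso_eq (V : finType) (e g : rel V) : (forall x y, e x y = g x y) -> graph_iso e g.
Proof. by move=> eg; exists id; [exists id | move=> x y; rewrite eg]. Qed.

Lemma graph_iso_sym (V W : finType) (e : rel V) (g : rel W) : graph_iso e g -> graph_iso g e.
Proof.
case=> f [h fK hK] fe; exists h; first by exists f.
by move=> x y; rewrite -fe !hK.
Qed.

Lemma graph_iso_trans (V W U : finType) (e : rel V) (g : rel W) (u : rel U) :
  graph_iso e g -> graph_iso g u -> graph_iso e u.
Proof.
case=> f fb fe [h hb he]; exists (h \o f); first exact: bij_comp.
by move=> x y; rewrite /= he fe.
Qed.

Lemma graph_iso_simple (V W : finType) (e : rel V) (g : rel W) :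
  graph_iso e g -> simple_graph e -> simple_graph g.
Proof.
move=> /graph_iso_sym[h _ he] e_simple; apply/andP; split.
  by apply/forallP => x; rewrite -he simple_irr.
by apply/forallP => x; apply/forallP => y; rewrite -!he (simple_sym e_simple).
Qed.

Lemma graph_iso_nb (V W : finType) (e : rel V) (g : rel W) : graph_iso e g ->
  nb_induced_even_cycles e = nb_induced_even_cycles g.
Proof.
move=> eg; suff le (V' W' : finType) (e' : rel V') (g' : rel W') : graph_iso e' g' ->
    (nb_induced_even_cycles e' <= nb_induced_even_cycles g')%N.
  by apply/eqP; rewrite eqn_leq !le //; apply: graph_iso_sym.
case=> f fb fe; have f_inj := bij_inj fb.
rewrite /nb_induced_even_cycles -(card_imset _ (imset_inj f_inj)).
apply/subset_leq_card/subsetP => S' /imsetP[S]; rewrite !inE => /andP[cS oS] ->.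
have := @induces_cycle_img _ _ e' g' f S (in2W f_inj) (in2W fe) cS.
by case/andP=> -> /eqP ->.
Qed.

Lemma graph_transport (V W : finType) (e : rel V) : #|V| = #|W| ->
  exists g : rel W, graph_iso e g.
Proof.
move=> VW; pose f (x : V) : W := enum_val (cast_ord VW (enum_rank x)).
pose h (y : W) : V := enum_val (cast_ord (esym VW) (enum_rank y)).
have fK : cancel f h by move=> x; rewrite /f /h enum_valK cast_ordK enum_rankK.
have hK : cancel h f by move=> x; rewrite /f /h enum_valK cast_ordKV enum_rankK.
exists (fun x y => e (h x) (h y)); exists f; first by exists h.
by move=> x y; rewrite !fK.
Qed.

Lemma extremal_exists (V : finType) : exists e : rel V, extremal e.
Proof.
pose P (A : {set V * V}) := simple_graph (fun x y => (x, y) \in A).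
pose F (A : {set V * V}) := nb_induced_even_cycles (fun x y => (x, y) \in A).
have P0 : P set0.
  by apply/andP; split; apply/forallP => x; [rewrite inE | apply/forallP => y; rewrite !inE].
have [A PA maxA] := @arg_maxnP _ set0 P F P0.
exists (fun x y => (x, y) \in A); split=> // g g_simple.
pose B := [set z : V * V | g z.1 z.2].
have iso : graph_iso g (fun x y => (x, y) \in B).
  by apply: graph_iso_eq => x y; rewrite inE.
by rewrite (graph_iso_nb iso); apply: maxA; apply: graph_iso_simple g_simple.
Qed.

Lemma blow_iso (V W : finType) k (c : V -> 'I_k) (d : W -> 'I_k) (s : 'I_k -> 'I_k) :
  injective s -> (forall i j, cycle_adj (s i) (s j) = cycle_adj i j) ->
  (forall i, #|cl d i| = #|cl c (s i)|) -> #|V| = #|W| -> graph_iso (blow d) (blow c).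
Proof.
move=> s_inj s_adj sz VW.
(* The image of [w] is the vertex of the same rank in the corresponding cluster. *)
have ex w : exists v, (c v == s (d w)) && (index v (enum (cl c (s (d w)))) == index w (enum (cl d
  (d w)))).
  have iw : (index w (enum (cl d (d w))) < size (enum (cl c (s (d w)))))%N.
    by rewrite -cardE -sz cardE index_mem mem_enum inE.
  have [v0 v0in] : exists v0, v0 \in enum (cl c (s (d w))).
    by case: (enum (cl c (s (d w)))) iw => // v0 l _; exists v0; rewrite mem_head.
  exists (nth v0 (enum (cl c (s (d w)))) (index w (enum (cl d (d w))))).
  rewrite index_uniq ?enum_uniq // eqxx andbT.
  by have := mem_nth v0 iw; rewrite mem_enum inE.
pose f w := xchoose (ex w).
have fP w : c (f w) = s (d w) /\ index (f w) (enum (cl c (s (d w)))) = index w (enum (cl d (d w))).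
  by have /andP[/eqP h1 /eqP h2] := xchooseP (ex w).
have f_inj : injective f.
  move=> w w' E; have [c1 i1] := fP w; have [c2 i2] := fP w'.
  have dd : d w = d w' by apply: s_inj; rewrite -c1 E c2.
  have ii : index w (enum (cl d (d w))) = index w' (enum (cl d (d w))).
    by rewrite -i1 E {2}dd -i2 -dd.
  have mw : w \in enum (cl d (d w)) by rewrite mem_enum inE.
  have mw' : w' \in enum (cl d (d w)) by rewrite mem_enum inE dd.
  by rewrite -(nth_index w mw) ii nth_index.
exists f; first by apply: inj_card_bij; rewrite ?VW.
by move=> x y; rewrite /blow (proj1 (fP x)) (proj1 (fP y)) s_adj.
Qed.

Lemma iter_ordS_inj k (a : 'I_k) i j : (i < k)%N -> (j < k)%N ->
  (iter i (@ordS k) a == iter j (@ordS k) a) = (i == j).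
Proof.
move=> ik jk; rewrite -val_eqE !iter_ordS.
by rewrite -[X in X = _]/(a + i == a + j %[mod k])%N eqn_modDl !modn_small.
Qed.

Lemma iter_ordS_surj k (a i : 'I_k) : exists2 j, (j < k)%N & i = iter j (@ordS k) a.
Proof.
have k0 : (0 < k)%N by apply: leq_ltn_trans (ltn_ord a).
exists ((i + (k - a)) %% k)%N; first by rewrite ltn_pmod.
apply: val_inj; rewrite iter_ordS modnDmr addnCA subnKC ?modnDr ?modn_small //.
exact: ltnW.
Qed.

Lemma iter_ordS_adj k (a : 'I_k) i j : (i < k)%N -> (j < k)%N ->
  cycle_adj (iter i (@ordS k) a) (iter j (@ordS k) a) =
  (j == i.+1 %% k)%N || (i == j.+1 %% k)%N.
Proof.
move=> ik jk; have k0 : (0 < k)%N by apply: leq_ltn_trans ik.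
have step m : iter m (@ordS k) a = iter (m %% k)%N (@ordS k) a.
  by apply: val_inj; rewrite !iter_ordS modnDmr.
by rewrite /cycle_adj -!iterS (step i.+1) (step j.+1) !iter_ordS_inj ?ltn_pmod.
Qed.

(* The number of clusters of [E_n], the number of its clusters that do not have
   size 3, and their size. *)
Definition nclusters n := (2 * (n %/ 6) + (if (n %% 6 <= 2)%N then 0 else 2))%N.
Definition nexc n : nat := (match n %% 6 with 0 => 0 | 1 => 1 | 2 => 2 | 3 => 3 | 4 => 2 | _ => 1 end)%N.
Definition sexc n := if (n %% 6 <= 2)%N then 4%N else 2%N.

(** Reading the clusters in the direction of [ordS] alone loses nothing: the exceptional clusters
    have equal size, so a block given in the other direction can be started at its other end. *)
Definition canonical n (V : finType) k (c : V -> 'I_k) :=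
  exists a, forall i, (i < k)%N ->
    #|cl c (iter i (@ordS k) a)| = if (i < nexc n)%N then sexc n else 3%N.

Lemma card_cl (V : finType) k (c : V -> 'I_k) : #|V| = (\sum_i #|cl c i|)%N.
Proof.
rewrite -cardsT -sum1_card (partition_big c xpredT) //=; apply: eq_bigr => i _.
by rewrite -sum1_card; apply: eq_bigl => x; rewrite !inE.
Qed.

Lemma sum_canonical n k : (nexc n <= k)%N ->
  (\sum_(i < k) (if (i < nexc n)%N then sexc n else 3) + 3 * nexc n = 3 * k + nexc n * sexc n)%N.
Proof.
move=> rk; rewrite -(subnKC rk) big_split_ord /=.
under eq_bigr => i _ do rewrite ltn_ord.
under [X in (_ + X + _)%N]eq_bigr => i _ do rewrite ltnNge leq_addr /=.
by rewrite !sum_nat_const !card_ord; clear; lia.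
Qed.

Lemma sum_iter_ordS k (a : 'I_k) (F : 'I_k -> nat) :
  (\sum_i F i = \sum_(i < k) F (iter i (@ordS k) a))%N.
Proof.
rewrite (reindex (fun i : 'I_k => iter i (@ordS k) a)) //=.
apply: onW_bij; apply: injF_bij => i j /eqP; rewrite iter_ordS_inj //.
by move/eqP/val_inj.
Qed.

Lemma nexc_bound n : (nexc n <= 3)%N.
Proof. by rewrite /nexc; case: (n %% 6)%N => [|[|[|[|[|[|?]]]]]]. Qed.

Lemma canonical_sizes n (V : finType) k (c : V -> 'I_k) : canonical n c -> #|V| = n ->
  (3 <= k)%N -> k = nclusters n.
Proof.
case=> a sz cV k3; have := sum_canonical (leq_trans (nexc_bound n) k3).
have -> : (\sum_(i < k) (if (i < nexc n)%N then sexc n else 3) = n)%N.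
  by rewrite -[RHS]cV (card_cl c) (sum_iter_ordS a); apply: eq_bigr => i _; rewrite sz.
rewrite /nclusters /sexc /nexc; have := divn_eq n 6; have := ltn_pmod n (isT : (0 < 6)%N).
by case: (n %% 6)%N => [|[|[|[|[|[|//]]]]]] /= _; clear; lia.
Qed.

Lemma canonical_iso n (V W : finType) k (c : V -> 'I_k) (d : W -> 'I_k) :
  canonical n c -> canonical n d -> #|V| = #|W| -> graph_iso (blow d) (blow c).
Proof.
move=> [a sa] [b sb] VW.
have ex i : exists j : 'I_k, iter j (@ordS k) b == i.
  by have [j jk ->] := iter_ordS_surj b i; exists (Ordinal jk).
have [u uP] : exists u : 'I_k -> 'I_k, forall i, iter (u i) (@ordS k) b = i.
  by exists (fun i => xchoose (ex i)) => i; apply/eqP/(xchooseP (ex i)).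
apply: (@blow_iso _ _ _ _ _ (fun i => iter (u i) (@ordS k) a)) => //.
- by move=> i j /eqP; rewrite iter_ordS_inj // => /eqP/val_inj E; rewrite -(uP i) E uP.
- by move=> i j; rewrite iter_ordS_adj // -[in RHS](uP i) -[in RHS](uP j) iter_ordS_adj.
by move=> i; rewrite sa // -[in LHS](uP i) sb.
Qed.

Lemma consec_mem k (a : 'I_k) i : (3 <= k)%N -> (i < k)%N ->
  [/\ (iter i (@ordS k) a \in [set a]) = (i < 1)%N,
      (iter i (@ordS k) a \in [set a; ordS a]) = (i < 2)%N &
      (iter i (@ordS k) a \in [set a; ordS a; ordS (ordS a)]) = (i < 3)%N].
Proof.
move=> k3 ik.
have e0 : (iter i (@ordS k) a == a) = (i == 0)%N by rewrite (@iter_ordS_inj k a i 0) // (leq_trans _ k3).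
have e1 : (iter i (@ordS k) a == ordS a) =
  (i == 1)%N by rewrite (@iter_ordS_inj k a i 1) // (leq_trans _ k3).
have e2 : (iter i (@ordS k) a == ordS (ordS a)) = (i == 2)%N by rewrite (@iter_ordS_inj k a i 2).
by split; rewrite !inE e0 ?e1 ?e2; case: (i) => [|[|[|?]]].
Qed.

Lemma is_E_canonical n (V : finType) (e : rel V) : is_E n e ->
  exists k (c : V -> 'I_k), [/\ (3 <= k)%N, forall x y, e x y = blow c x y & canonical n c].
Proof.
case=> e_simple cV [k [B [[k3 B_inj partB adjB] emp sizes]]].
have sy := simple_sym e_simple.
case/and3P: partB => /eqP covB /trivIsetP trB _.
have Bin l : B l \in [set B i | i : 'I_k] by apply: imset_f.
have Buniq x i j : x \in B i -> x \in B j -> i = j.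
  move=> xi xj; apply: B_inj; apply/eqP; apply: contraT => neq.
  have /disjoint_setI0 /setP/(_ x) := trB _ _ (Bin i) (Bin j) neq.
  by rewrite !inE xi xj.
have ex x : exists i, x \in B i.
  have : x \in cover [set B i | i : 'I_k] by rewrite covB.
  by case/bigcupP=> A /imsetP[i _ ->] xi; exists i.
have [c cP] : exists c : V -> 'I_k, forall x, x \in B (c x).
  by exists (fun x => xchoose (ex x)) => x; apply: (xchooseP (ex x)).
have clE i : cl c i = B i.
  by apply/setP => x; rewrite inE; apply/eqP/idP => [<-|xi]; last exact: Buniq (cP x) xi.
exists k, c; split=> //.
  move=> x y; rewrite /blow; have [sub1 sub2] := adjB _ _ (cP x).
  apply/idP/idP => [exy|/adj_cases cxy].
    have := subsetP sub2 y; rewrite inE exy => /(_ isT); rewrite !in_setU -orbA => /or3P[yi|yi|yi].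
    - by rewrite (Buniq _ _ _ (cP y) yi) adjP.
    - by have := emp _ _ _ (cP x) yi; rewrite exy.
    - by rewrite (Buniq _ _ _ (cP y) yi) adjS.
  have := subsetP sub1 y; rewrite !inE; apply.
  by case: cxy => <-; rewrite cP ?orbT.
have canonI (X : {set 'I_k}) s r a : size_3_except B X s ->
    (forall i, (i < k)%N -> (iter i (@ordS k) a \in X) = (i < r)%N) ->
    r = nexc n -> s = sexc n -> canonical n c.
  by move=> sX Xr rE sE; exists a => i ik; rewrite clE sX Xr // rE sE.
have adjc s (X : {set 'I_k}) i j : (0 < s)%N -> size_3_except B X s -> adjacent_clusters e (B i) (B j) ->
    cycle_adj i j.
  move=> s0 sX adj; have ne l : exists x, x \in B l.
    by apply/card_gt0P; rewrite sX; case: ifP.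
  have [x xi] := ne i; have [y yj] := ne j; have := adj x y xi yj.
  have [_ sub2] := adjB _ _ xi => exy.
  have := subsetP sub2 y; rewrite inE exy => /(_ isT); rewrite !in_setU -orbA => /or3P[yi|yi|yi].
  - by rewrite (Buniq _ _ _ yj yi) adjP.
  - by have := emp _ _ _ xi yi; rewrite exy.
  - by rewrite (Buniq _ _ _ yj yi) adjS.
have two s a b : (0 < s)%N -> size_3_except B [set a; b] s -> adjacent_clusters e (B a) (B b) ->
    2%N = nexc n -> s = sexc n -> canonical n c.
  move=> s0 sX adj r2 sE; case: (adj_cases (adjc _ _ _ _ s0 sX adj)) => E.
    by apply: (canonI _ _ 2%N a sX) => // i ik; rewrite E; have [_ -> _] := consec_mem a k3 ik.
  apply: (canonI _ _ 2%N b sX) => // i ik; have -> : a = ordS b by rewrite E ord_predK.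
  by rewrite setUC; have [_ -> _] := consec_mem b k3 ik.
have one s a : size_3_except B [set a] s -> 1%N = nexc n -> s = sexc n -> canonical n c.
  move=> sX r1 sE; apply: (canonI _ _ 1%N a sX) => // i ik.
  by have [-> _ _] := consec_mem a k3 ik.
move: sizes; rewrite /E_cluster_sizes.
case nE: (n %% 6)%N => [|[|[|[|[|m]]]]].
- move=> sz; exists (Ordinal (leq_trans (isT : (0 < 3)%N) k3)) => i ik.
  by rewrite clE sz /nexc nE.
- by case=> a sX; apply: (one _ _ sX); rewrite /nexc /sexc nE.
- by case=> a [b [_ adj sX]]; apply: (two _ _ _ _ sX adj); rewrite // /nexc /sexc nE.
- case=> a [b [d [un [adj1 adj2] sX]]].
  have := adjc 2%N _ _ _ isT sX adj1; have := adjc 2%N _ _ _ isT sX adj2.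
  move: un; rewrite /= !inE negb_or => /andP[/andP[ab ad] _].
  move=> /adj_cases bd /adj_cases[] E.
    case: bd => E'; last by case/eqP: ad; rewrite E' E ordSK.
    apply: (canonI _ _ 3%N a sX) => [i ik||]; rewrite ?/nexc ?/sexc ?nE //.
    by rewrite E' E; have [_ _ ->] := consec_mem a k3 ik.
  case: bd => E'; first by case/eqP: ad; rewrite E' E ord_predK.
  apply: (canonI _ _ 3%N d sX) => [i ik||]; rewrite ?/nexc ?/sexc ?nE //.
  have bE : b = ordS d by rewrite E' ord_predK.
  have aE : a = ordS (ordS d) by rewrite -bE E ord_predK.
  have -> : [set a; b; d] = [set d; ordS d; ordS (ordS d)].
    by rewrite aE bE; apply/setP => l; rewrite !inE; do 3 case: (l == _).
  by have [_ _ ->] := consec_mem d k3 ik.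
- by case=> a [b [_ adj sX]]; apply: (two _ _ _ _ sX adj); rewrite // /nexc /sexc nE.
by case=> a sX; apply: (one _ _ sX); rewrite /nexc /sexc nE.
Qed.

(** Sizes for a concrete model of [E_n], on pairs of a cluster index and a position in that cluster,
    with the exceptional clusters first. *)
Definition std_size n k (i : 'I_k) := if (i < nexc n)%N then sexc n else 3%N.
Definition std n k : finType := {i : 'I_k & 'I_(@std_size n k i)}.
Definition std_col n k (x : std n k) : 'I_k := tag x.

Lemma card_std_cl n k i : #|cl (@std_col n k) i| = std_size n i.
Proof.
have -> : cl (@std_col n k) i = [set Tagged (fun i => 'I_(@std_size n k i)) y | y : 'I_(std_size n i)].
  apply/setP => -[j y]; rewrite inE; apply/eqP/imsetP => [ij|[y' _ ->] //].
  by rewrite /std_col /= in ij; case: i / ij; exists y.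
by rewrite card_imset ?card_ord // => y y' /eqP; rewrite eq_Tagged => /eqP.
Qed.

Lemma std_canonical n k : (0 < k)%N -> canonical n (@std_col n k).
Proof.
move=> k0; exists (Ordinal k0) => i ik; rewrite card_std_cl /std_size iter_ordS /=.
by rewrite add0n modn_small.
Qed.

Lemma canonical_except n (V : finType) k (c : V -> 'I_k) : canonical n c ->
  exists a, forall X : {set 'I_k}, (forall i, (i < k)%N ->
    (iter i (@ordS k) a \in X) = (i < nexc n)%N) ->
    size_3_except (cl c) X (sexc n).
Proof.
case=> a sz; exists a => X hX i; have [j jk ->] := iter_ordS_surj a i.
by rewrite sz // hX.
Qed.

Lemma except_canonical n (V : finType) k (c : V -> 'I_k) (X : {set 'I_k}) a :
  size_3_except (cl c) X (sexc n) ->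
  (forall i, (i < k)%N -> (iter i (@ordS k) a \in X) = (i < nexc n)%N) -> canonical n c.
Proof. by move=> sX Xa; exists a => i ik; rewrite sX Xa. Qed.

Lemma canonical_is_E n (V : finType) k (c : V -> 'I_k) : canonical n c -> (5 <= k)%N ->
  #|V| = n -> is_E n (blow c).
Proof.
move=> can k5 cV; have k3 : (3 <= k)%N by apply: leq_trans k5.
have ne i : exists x, x \in cl c i.
  case: (can) => a sz; apply/card_gt0P; have [j jk ->] := iter_ordS_surj a i; rewrite sz //.
  by rewrite /sexc; case: ifP => //; case: ifP.
have [a szX] := canonical_except can.
have adjc i j : cycle_adj i j -> adjacent_clusters (blow c) (cl c i) (cl c j).
  by move=> ij x y; rewrite !inE /blow => /eqP -> /eqP ->.
split=> //; first exact: blow_simple.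
exists k, (cl c); split.
- split=> //.
  + move=> i j E; have [x xi] := ne i; move: (xi); rewrite E; move: xi.
    by rewrite !inE => /eqP -> /eqP.
  + apply/and3P; split.
    * apply/eqP/setP => x; rewrite in_setT; apply/bigcupP; exists (cl c (c x)); rewrite ?inE //.
      exact: imset_f.
    * apply/trivIsetP => A B /imsetP[i _ ->] /imsetP[j _ ->] neq.
      rewrite -setI_eq0; apply/eqP/setP => x; rewrite !inE; apply/negP => /andP[/eqP xi /eqP xj].
      by case/eqP: neq; rewrite -xi -xj.
    apply/imsetP => -[i _ E]; have [x] := ne i; by rewrite -E inE.
  move=> i x; rewrite inE => /eqP xi; split; apply/subsetP => y; rewrite !inE.
    by case/orP => /eqP yi; rewrite /blow xi yi ?adjP ?adjS.
  by rewrite /blow xi => /adj_cases[] ->; rewrite eqxx ?orbT.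
- by move=> i x y; rewrite !inE => /eqP xi /eqP yi; rewrite /blow xi yi adj_irr.
rewrite /E_cluster_sizes; move: szX; rewrite /nexc /sexc.
have := ltn_pmod n (isT : (0 < 6)%N).
have aS : a != ordS a by rewrite eq_sym ordS_neq // (leq_trans _ k3).
case nE: (n %% 6)%N => [|[|[|[|[|[|//]]]]]] _ /= szX.
- by have := szX set0 (fun i _ => in_set0 _) => sz i; rewrite sz in_set0.
- by exists a; apply: szX => i ik; have [-> _ _] := consec_mem a k3 ik.
- exists a, (ordS a); split=> //; first exact/adjc/adjS.
  by apply: szX => i ik; have [_ -> _] := consec_mem a k3 ik.
- exists a, (ordS a), (ordS (ordS a)); split.
  + rewrite /= !inE negb_or aS -[a]/(iter 0 (@ordS k) a) -!iterS !iter_ordS_inj //; exact: leq_trans k3.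
  + by split; exact/adjc/adjS.
  by apply: szX => i ik; have [_ _ ->] := consec_mem a k3 ik.
- exists a, (ordS a); split=> //; first exact/adjc/adjS.
  by apply: szX => i ik; have [_ -> _] := consec_mem a k3 ik.
by exists a; apply: szX => i ik; have [-> _ _] := consec_mem a k3 ik.
Qed.

Lemma card_std n : (3 <= nclusters n)%N -> #|std n (nclusters n)| = n.
Proof.
move=> k3; rewrite (card_cl (@std_col n (nclusters n))).
under eq_bigr => i _ do rewrite card_std_cl /std_size.
have := sum_canonical (leq_trans (nexc_bound n) k3).
rewrite /nclusters /sexc /nexc; have := divn_eq n 6; have := ltn_pmod n (isT : (0 < 6)%N).
by case: (n %% 6)%N => [|[|[|[|[|[|//]]]]]] /= _; move: (\sum_(_ < _) _)%N => x; clear; lia.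
Qed.

(** * Comparison of cluster sizes *)

(** Only residue 2 leaves a choice: 4, 4 and 2, 2, 2, 2 agree in sum, in product and in the parity
    of the number of parts. This tie has to be broken by the 4-cycles. *)
Lemma optseq_exceptions u ds : optseq u ds ->
  let l := [seq d <- ds | d != 3%N] in
  (match u %% 6 with
   | 0 => l == [::] | 1 => l == [:: 4] | 2 => (l == [:: 4; 4]) || (l == [:: 2; 2; 2; 2])
   | 3 => l == [:: 2; 2; 2] | 4 => l == [:: 2; 2] | _ => l == [:: 2] end)%N.
Proof.
elim: ds u => [|d ds IH] u /=; first by move=> /eqP ->.
case/andP=> ou /IH /=; set l := [seq d <- ds | _].
have um : (u %% 6 < 6)%N by rewrite ltn_pmod.
rewrite -!addnA -modnDml; move: ou um; rewrite /opt; case: (u %% 6)%N => [|[|[|[|[|[|//]]]]]];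
  case: d => [|[|[|[|[|d]]]]] //= _ _; rewrite ?addn0 ?eqseq_cons //.
all: try by move=> /eqP ->.
Qed.

Section Sizes.

Variables (V : finType) (k : nat) (c : V -> 'I_k).

Definition sizes := [seq #|cl c i| | i <- enum 'I_k].

Lemma sumn_sizes : sumn sizes = #|V|.
Proof. by rewrite sumnE big_map big_enum (card_cl c). Qed.

Lemma prod_sizes (R : realFieldType) (t : R) : 0 < t -> t ^+ 3 = 3 -> optseq #|V| sizes ->
  (\prod_i #|cl c i|)%:R = optval t #|V| * t ^+ #|V|.
Proof.
move=> t0 t3 os; have := optseq_prod t0 t3 os; rewrite sumn_sizes => <-.
by rewrite big_map big_enum.
Qed.

Definition exc := [set i | #|cl c i| != 3%N].

Lemma exc_sizes l : [seq d <- sizes | d != 3%N] = l -> #|exc| = size l /\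
  forall i, i \in exc -> #|cl c i| \in l.
Proof.
move=> <-; split; last first.
  move=> i; rewrite inE mem_filter => -> /=.
  by apply: (map_f (fun i => #|cl c i|)); rewrite mem_enum.
rewrite size_filter /sizes count_map cardE -size_filter; congr size.
by rewrite /enum_mem -filter_predI; apply: eq_filter => i /=; rewrite inE andbT.
Qed.

Lemma optseq_exc n : #|V| = n -> optseq n sizes ->
  exists r s, [/\ #|exc| = r, size_3_except (cl c) exc s &
    r = nexc n /\ s = sexc n \/ [/\ (n %% 6 = 2)%N, r = 4 & s = 2]]%N.
Proof.
move=> cV os; have ex := optseq_exceptions os.
have spec r s l : [seq d <- sizes | d != 3%N] = l -> size l = r -> all (pred1 s) l ->
    #|exc| = r /\ size_3_except (cl c) exc s.
  move=> lE szl /allP al; have [h1 h2] := exc_sizes lE; split; first by rewrite h1.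
  move=> i; case: ifP => [/h2/al/eqP //|]; by rewrite inE => /negbFE/eqP.
have main l : [seq d <- sizes | d != 3%N] = l -> size l = nexc n -> all (pred1 (sexc n)) l ->
  exists r s, [/\ #|exc| = r, size_3_except (cl c) exc s &
    r = nexc n /\ s = sexc n \/ [/\ (n %% 6 = 2)%N, r = 4 & s = 2]]%N.
  by move=> lE sl al; have [h1 h2] := spec _ _ _ lE sl al; exists (nexc n), (sexc n); split=> //; left.
have m6 := ltn_pmod n (isT : (0 < 6)%N).
have [m mE] : exists m, m = (n %% 6)%N by exists (n %% 6)%N.
rewrite -mE in ex m6; case: m mE m6 ex => [|[|[|[|[|[|//]]]]]] nE _ /=;
  [move/eqP=> h | move/eqP=> h | case/orP=> /eqP h | move/eqP=> h | move/eqP=> h | move/eqP=> h];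
  try (by apply: (main _ h); rewrite ?/nexc ?/sexc -?nE).
by have [h1 h2] := spec 4%N 2%N _ h erefl erefl; exists 4%N, 2%N; split=> //; right.
Qed.

(** The second term of [card_even_cycles], which counts the induced 4-cycles of [blow c]. *)
Definition quads := (\sum_i ('C(#|cl c i|, 2) * 'C(#|cl c (ordS i)|, 2) +
     'C(#|cl c i|, 2) * (#|cl c (ordS i)| * #|cl c (ord_pred i)|)))%N.

Variable X : {set 'I_k}.
Let x i : nat := i \in X.
(** [A1], [A2] and [A3] count the adjacent pairs, the pairs at distance two and the consecutive
    triples of indices in [X]. *)
Let A1 := (\sum_i x i * x (ordS i))%N.
Let A2 := (\sum_i x (ordS i) * x (ord_pred i))%N.
Let A3 := (\sum_i x i * (x (ordS i) * x (ord_pred i)))%N.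

Let sum_x : (\sum_i x i)%N = #|X|.
Proof. by rewrite -sum1_card [RHS]big_mkcond. Qed.

Let sum_xS : (\sum_i x (ordS i))%N = #|X|.
Proof. by rewrite -sum_x [RHS](reindex_inj (@ordS_inj k)). Qed.

Let sum_xP : (\sum_i x (ord_pred i))%N = #|X|.
Proof. by rewrite -sum_x [RHS](reindex_inj (can_inj (@ord_predK k))). Qed.

Let sum_xxP : (\sum_i x i * x (ord_pred i))%N = A1.
Proof.
rewrite (reindex_inj (@ordS_inj k)); apply: eq_bigr => i _.
by rewrite ordSK mulnC.
Qed.

(** With cluster sizes [3 - x i], each summand of [quads] is a polynomial in three indicators. The
    negative terms are moved to the left side. *)
Lemma quads2 : size_3_except (cl c) X 2 ->
  (quads + 48 * #|X| + 2 * A3 = 36 * k + 16 * A1 + 3 * A2)%N.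
Proof.
move=> sz; have : (\sum_i (('C(#|cl c i|, 2) * 'C(#|cl c (ordS i)|, 2) +
     'C(#|cl c i|, 2) * (#|cl c (ordS i)| * #|cl c (ord_pred i)|)) +
     (24 * x i + 15 * x (ordS i) + 9 * x (ord_pred i) + 2 * (x i * (x (ordS i) * x (ord_pred i))))) =
   \sum_(i < k) (36 + (10 * (x i * x (ordS i)) + 6 * (x i * x (ord_pred i)) + 3 * (x (ordS i) * x
     (ord_pred i)))))%N.
  apply: eq_bigr => i _; rewrite !sz /x.
  by case: (i \in X); case: (ordS i \in X); case: (ord_pred i \in X).
rewrite !big_split /= !big1_eq sum_x sum_xS sum_xP sum_xxP sum_nat_const card_ord -/A1 -/A2 -/A3.
have -> : quads = (\sum_i 'C(#|cl c i|, 2) * 'C(#|cl c (ordS i)|, 2) +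
     \sum_i 'C(#|cl c i|, 2) * (#|cl c (ordS i)| * #|cl c (ord_pred i)|))%N by rewrite -big_split.
set P := (\sum_i 'C(_, 2) * 'C(_, 2))%N; set Q := (\sum_i 'C(_, 2) * (_ * _))%N.
by move: #|X| (A1) (A2) (A3) P Q; clear => a b d f P Q; lia.
Qed.

Lemma quads4 : size_3_except (cl c) X 4 ->
  (quads = 36 * k + 63 * #|X| + 27 * A1 + 3 * A2 + 3 * A3)%N.
Proof.
move=> sz; have -> : (quads = \sum_(i < k) (36 + (36 * x i + 18 * x (ordS i) + 9 * x (ord_pred i) +
   18 * (x i * x (ordS i)) + 9 * (x i * x (ord_pred i)) + 3 * (x (ordS i) * x (ord_pred i)) +
   3 * (x i * (x (ordS i) * x (ord_pred i))))))%N.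
  apply: eq_bigr => i _; rewrite !sz /x.
  by case: (i \in X); case: (ordS i \in X); case: (ord_pred i \in X).
rewrite !big_split /= !big1_eq sum_x sum_xS sum_xP sum_xxP sum_nat_const card_ord -/A1 -/A2 -/A3.
by move: #|X| (A1) (A2) (A3); clear => a b d f; lia.
Qed.

Definition succs := [set i in X | ordS i \in X].

Lemma quad_bounds : [/\ A1 = #|succs|, (A1 <= #|X|)%N, (A2 <= #|X|)%N, (A3 <= A1)%N & (A3 <= A2)%N].
Proof.
split.
- rewrite -sum1_card [RHS]big_mkcond; apply: eq_bigr => i _; rewrite inE /x.
  by case: (i \in X); case: (ordS i \in X).
- by rewrite -sum_x; apply: leq_sum => i _; rewrite /x; case: (i \in X); case: (ordS i \in X).
- by rewrite -sum_xS; apply: leq_sum => i _; rewrite /x; case: (ordS i \in X); case: (ord_pred i \in X).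
- apply: leq_sum => i _; rewrite /x; case: (i \in X); case: (ordS i \in X) => //=.
  by case: (ord_pred i \in X).
by apply: leq_sum => i _; rewrite /x; case: (i \in X); case: (ordS i \in X); case: (ord_pred i \in X).
Qed.

Lemma quads2_bounds : size_3_except (cl c) X 2 -> exists A1 A2 A3,
  (quads + 48 * #|X| + 2 * A3 = 36 * k + 16 * #|succs| + 3 * A2 /\
   [/\ A1 = #|succs|, A1 <= #|X|, A2 <= #|X|, A3 <= A1 & A3 <= A2])%N.
Proof.
move=> /quads2 q; have b := quad_bounds; exists A1, A2, A3; split=> //.
by rewrite q; case: b => ->.
Qed.

Lemma quads4_bounds : size_3_except (cl c) X 4 -> exists A1 A2 A3,
  (quads = 36 * k + 63 * #|X| + 27 * #|succs| + 3 * A2 + 3 * A3 /\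
   [/\ A1 = #|succs|, A1 <= #|X|, A2 <= #|X|, A3 <= A1 & A3 <= A2])%N.
Proof.
move=> /quads4 q; have b := quad_bounds; exists A1, A2, A3; split=> //.
by rewrite q; case: b => ->.
Qed.

End Sizes.

Lemma optseq_std n (V : finType) (d : V -> 'I_(nclusters n)) : (3 <= nclusters n)%N ->
  (forall i, #|cl d i| = if (i < nexc n)%N then sexc n else 3%N) -> optseq n (sizes d).
Proof.
move=> k3 sz.
have -> : sizes d = [seq (if (j < nexc n)%N then sexc n else 3%N) | j <- iota 0 (nclusters n)].
  by rewrite -val_enum_ord -map_comp; apply: eq_map => i /=.
have o3 m u : optseq u (nseq m 3%N) = (u %% 6 == 0)%N.
  elim: m u => //= m IH u; rewrite IH -addnA; congr (_ == _).
  by clear; lia.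
rewrite -(subnKC (leq_trans (nexc_bound n) k3)) iotaD map_cat add0n.
set m := (_ - _)%N.
have -> : [seq (if (j < nexc n)%N then sexc n else 3%N) | j <- iota 0 (nexc n)] = nseq (nexc n) (sexc n).
  apply: (@eq_from_nth _ 0%N); rewrite size_map size_iota ?size_nseq // => i ir.
  by rewrite (nth_map 0%N) ?size_iota // nth_iota // add0n ir nth_nseq ir.
have -> : [seq (if (j < nexc n)%N then sexc n else 3%N) | j <- iota (nexc n) m] = nseq m 3%N.
  apply: (@eq_from_nth _ 0%N); rewrite size_map size_iota ?size_nseq // => i ir.
  by rewrite (nth_map 0%N) ?size_iota // nth_iota // ltnNge leq_addr nth_nseq ir.
rewrite (@optseq_mod n (n %% 6)); last by rewrite modn_mod.
rewrite /nexc /sexc; have := ltn_pmod n (isT : (0 < 6)%N).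
by case: (n %% 6)%N => [|[|[|[|[|[|//]]]]]] _ /=; rewrite o3.
Qed.

Lemma sum_except (V : finType) k (c : V -> 'I_k) (X : {set 'I_k}) s :
  size_3_except (cl c) X s -> (#|V| + 3 * #|X| = 3 * k + s * #|X|)%N.
Proof.
move=> sX; rewrite (card_cl c) (bigID (mem X)) /=.
rewrite (eq_bigr (fun=> s)); last by move=> i iX; rewrite sX iX.
rewrite [X in (_ + X + _)%N](eq_bigr (fun=> 3%N)); last by move=> i /negPf iX; rewrite sX iX.
rewrite !sum_nat_const; have := cardC (mem X); rewrite card_ord.
have -> : #|[pred i | i \notin X]| = #|[predC X]| by apply: eq_card => i; rewrite !inE.
by move: #|[predC X]| #|X|; clear => a b; nia.
Qed.

Section Consecutive.

Variables (k : nat) (X : {set 'I_k}).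
Hypothesis k5 : (5 <= k)%N.

Let nS (a : 'I_k) : (ordS a == a) = false.
Proof. by rewrite ordS_neq // (leq_trans _ k5). Qed.

Lemma consec2 : #|X| = 2%N -> (0 < #|succs X|)%N -> exists a, X = [set a; ordS a].
Proof.
move=> cX /card_gt0P[a]; rewrite inE => /andP[aX SX]; exists a.
apply/esym/eqP; rewrite eqEcard cX cards2 eq_sym nS andbT.
by apply/subsetP => i; rewrite !inE => /orP[] /eqP ->.
Qed.

(** Two disjoint pairs of successive indices would need four elements, so the two pairs share an
    index. *)
Lemma consec3 : #|X| = 3%N -> (1 < #|succs X|)%N ->
  exists a, X = [set a; ordS a; ordS (ordS a)].
Proof.
move=> cX /card_gt1P[a [b []]]; rewrite !inE => /andP[aX SaX] /andP[bX SbX] ab.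
have three u : u \in X -> ordS u \in X -> ordS (ordS u) \in X ->
    exists a, X = [set a; ordS a; ordS (ordS a)].
  move=> uX SuX SSuX; exists u; apply/esym/eqP; rewrite eqEcard cX; apply/andP; split; last first.
    rewrite -setUA cardsU1 cards2 !inE ![u == _]eq_sym [ordS u == ordS _]eq_sym.
    by rewrite !nS ordSS_neq // (leq_trans _ k5).
  by apply/subsetP => i; rewrite !inE -orbA => /or3P[] /eqP ->.
case: (eqVneq (ordS a) b) => [E|Sab]; first by apply: (three a) => //; rewrite E.
case: (eqVneq (ordS b) a) => [E|Sba]; first by apply: (three b) => //; rewrite E.
have : (#|[set a; ordS a; b; ordS b]| <= 3)%N.
  by rewrite -cX; apply/subset_leq_card/subsetP => i; rewrite !inE -!orbA => /or4P[] /eqP ->.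
rewrite -!setUA !cardsU1 cards1 !inE !negb_or ![a == _]eq_sym nS Sba.
rewrite [b == a]eq_sym ab Sab [b == _]eq_sym nS /=.
by rewrite (inj_eq (can_inj (@ordSK k))) ab.
Qed.

End Consecutive.

Lemma nclusters_large n : (60 <= n)%N -> (8 <= nclusters n)%N /\ ~~ odd (nclusters n).
Proof.
by rewrite /nclusters; move=> n60; split; [|rewrite oddD oddM /=]; case: ifP => _ //; move: n60;
  clear; lia.
Qed.

(** * Extremal graphs have consecutive exceptional clusters *)

Section ExtremalCanonical.

Variables (R : archiRealFieldType) (t : R).
Hypotheses (t_gt0 : 0 < t) (t3 : t ^+ 3 = 3).

Lemma extremal_canonical : exists n1, forall (V : finType) (e : rel V),
  extremal e -> (n1 <= #|V|)%N ->
  exists k (c : V -> 'I_k), [/\ (5 <= k)%N, forall x y, e x y = blow c x y & canonical #|V| c].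
Proof.
have [n1 hn1] := extremal_quasi t_gt0 t3.
exists (n1 + 60)%N => V e e_ext nV; set n := #|V| in nV *.
have n60 : (60 <= n)%N by apply: leq_trans nV; rewrite leq_addl.
have [k0_8 k0_even] := nclusters_large n60; set k0 := nclusters n in k0_8 k0_even.
have k0_5 : (5 <= k0)%N by apply: leq_trans k0_8.
have k0_3 : (3 <= k0)%N by apply: leq_trans k0_8.
pose d := @std_col n k0; have cW : #|std n k0| = n by apply: card_std.
have osd : optseq #|std n k0| (sizes d) by rewrite cW; apply: optseq_std => // i; apply: card_std_cl.
have nbd : nb_induced_even_cycles (blow d) = (\prod_i #|cl d i| + quads d)%N.
  by rewrite -card_even_cycles.
have [g iso] := graph_transport (blow d) cW.
have le1 : (nb_induced_even_cycles (blow d) <= nb_induced_even_cycles e)%N.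
  rewrite (graph_iso_nb iso); case: e_ext => _; apply.
  exact: graph_iso_simple iso (blow_simple d k0_5).
have prd := prod_sizes t_gt0 t3 osd; rewrite cW in prd.
have [||k [c [k8 cadj os]]] := hn1 V e e_ext.
- by apply: leq_trans nV; rewrite leq_addr.
- by rewrite -/n -prd ler_nat; apply: leq_trans le1; rewrite nbd leq_addr.
have k5 : (5 <= k)%N by apply: leq_trans k8.
have [r [s [Xr sX alt]]] := optseq_exc erefl os.
have kE := sum_except sX; rewrite Xr -/n in kE.
have n6 := divn_eq n 6; have n6m := ltn_pmod n (isT : (0 < 6)%N).
have k_even : ~~ odd k.
  case: alt => [[rE sE]|[m rE sE]]; last by move: kE n6; rewrite m rE sE; clear; lia.
  move: kE n6 n6m; rewrite rE sE /nexc /sexc.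
  by case: (n %% 6)%N => [|[|[|[|[|[|//]]]]]] /=; clear; lia.
have szb i : (2 <= #|cl c i| <= 4)%N.
  by have /allP := optseq_sizes os; apply; apply: (map_f (fun i => #|cl c i|)); rewrite mem_enum.
have few : (#|[set i | #|cl c i| == 4%N]| <= 2)%N.
  case: (leqP s 2) => s2.
    rewrite (_ : [set i | _] = set0) ?cards0 //; apply/setP => i; rewrite !inE sX.
    by case: ifP => // _; case: s s2 {sX alt kE} => [|[|[|]]].
  apply: (@leq_trans #|exc c|).
    by apply/subset_leq_card/subsetP => i; rewrite !inE => /eqP ->.
  rewrite Xr; case: alt => [[-> sE]|[_ _ sE]]; last by rewrite sE in s2.
  by move: s2; rewrite sE /sexc /nexc; case: (n %% 6)%N => [|[|[|?]]].
have eb := extremal_blow e_ext k5 k_even cadj szb few.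
exists k, c; split=> //.
have nbc : nb_induced_even_cycles e = (\prod_i #|cl c i| + quads c)%N.
  rewrite -card_even_cycles //; apply: (@graph_iso_nb V V e (blow c)).
  exact: graph_iso_eq.
have prE : (\prod_i #|cl c i| = \prod_i #|cl d i|)%N.
  by apply/eqP; rewrite -(eqr_nat R) (prod_sizes t_gt0 t3 os) prd.
have qle : (quads d <= quads c)%N by move: le1; rewrite nbd nbc prE leq_add2l.
have [a hd] := canonical_except (@std_canonical n k0 (leq_trans (isT : (0 < 5)%N) k0_5)).
have two (a' : 'I_k0) : [/\ #|[set a'; ordS a']| = 2, (0 < #|succs [set a'; ordS a']|) &
    #|[set a'; ordS a'; ordS (ordS a')]| = 3 /\ (1 < #|succs [set a'; ordS a'; ordS (ordS a')]|)]%N.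
  have nS (l : 'I_k0) : (ordS l == l) = false by rewrite ordS_neq // (leq_trans _ k0_5).
  have nSS : (ordS (ordS a') == a') = false by rewrite ordSS_neq // (leq_trans _ k0_5).
  split; [by rewrite cards2 eq_sym nS | | split].
  - by apply/card_gt0P; exists a'; rewrite !inE !eqxx orbT.
  - by rewrite -setUA cardsU1 cards2 !inE ![a' == _]eq_sym [ordS a' == ordS _]eq_sym !nS nSS.
  - apply/card_gt1P; exists a', (ordS a').
    by rewrite !inE !eqxx !orbT eq_sym nS.
have [d2 d2s [d3 d3s]] := two a.
have kk0 : r = nexc n -> s = sexc n -> k = k0.
  move=> rE sE; move: kE n6 n6m; rewrite /k0 /nclusters rE sE /nexc /sexc.
  by case: (n %% 6)%N => [|[|[|[|[|[|//]]]]]] /=; clear; lia.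
have {}hd2 : nexc n = 2%N -> size_3_except (cl d) [set a; ordS a] (sexc n).
  by move=> r2; apply: hd => i ik; rewrite r2; have [_ -> _] := consec_mem a k0_3 ik.
have hd3 : nexc n = 3%N -> size_3_except (cl d) [set a; ordS a; ordS (ordS a)] (sexc n).
  by move=> r3; apply: hd => i ik; rewrite r3; have [_ _ ->] := consec_mem a k0_3 ik.
have k3 : (3 <= k)%N by apply: leq_trans k5.
case: alt => [[rE sE]|[m rE sE]]; last first.
  have r2 : nexc n = 2%N by rewrite /nexc m.
  have s4 : sexc n = 4%N by rewrite /sexc m.
  (* Four clusters of size 2 give at most [36 * k0 - 44] 4-cycles, against at least [36 * k0 + 153]
     for two adjacent clusters of size 4. *)
  have h2 := hd2 r2; rewrite s4 in h2; have [A1 [A2 [A3 [q4 _]]]] := quads4_bounds h2.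
  rewrite sE in sX; have [B1 [B2 [B3 [q2 [b1 b2 b3 _ _]]]]] := quads2_bounds sX; exfalso.
  have kE' : k = (k0 + 2)%N by rewrite /k0 /nclusters m; move: kE n6; rewrite m rE sE /=; clear; lia.
  move: qle q4 q2 b1 b2 b3 d2 d2s kE'; rewrite Xr rE; clear; lia.
have kk := kk0 rE sE; rewrite sE rE in sX Xr.
have [r4|] := leqP 4 (nexc n); first by have := leq_trans r4 (nexc_bound n).
case rn: (nexc n) Xr => [|[|[|[|//]]]] Xr _.
- apply: (@except_canonical _ _ _ _ _ (Ordinal (leq_trans (isT : (0 < 3)%N) k3)) sX) => i ik.
  by rewrite rn (cards0_eq Xr) inE.
- have /cards1P[l lE] : #|exc c| == 1%N by rewrite Xr.
  rewrite lE in sX; apply: (@except_canonical _ _ _ _ _ l sX) => i ik.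
  by rewrite rn; have [-> _ _] := consec_mem l k3 ik.
(* Without an adjacent pair [A3] vanishes and [A2] contributes at most [3 * 2], while an adjacent
   pair contributes at least 16 for size 2 and 27 for size 4. *)
- have [|l lE] := consec2 k5 Xr.
    move: (hd2 rn) sX qle; rewrite /sexc; case: ifP => _ h2 sX qle.
      have [A1 [A2 [A3 [q _]]]] := quads4_bounds h2.
      have [B1 [B2 [B3 [q' [b1 b2 b3 b4 b5]]]]] := quads4_bounds sX.
      rewrite d2 in q; rewrite Xr in q' b3; move: qle q q' b1 b3 b4 b5 d2s kk.
      move: #|succs [set a; ordS a]| #|succs (exc c)| (quads d) (quads c).
      by clear => sd sc qd qc; lia.
    have [A1 [A2 [A3 [q [_ _ _ _ a5]]]]] := quads2_bounds h2.
    have [B1 [B2 [B3 [q' [b1 b2 b3 b4 b5]]]]] := quads2_bounds sX.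
    rewrite d2 in q; rewrite Xr in q' b3; move: qle q q' a5 b1 b3 b4 b5 d2s kk.
    move: #|succs [set a; ordS a]| #|succs (exc c)| (quads d) (quads c).
    by clear => sd sc qd qc; lia.
  rewrite lE in sX; apply: (@except_canonical _ _ _ _ _ l sX) => i ik.
  by rewrite rn; have [_ -> _] := consec_mem l k3 ik.
have s2 : sexc n = 2%N by move: rn; rewrite /nexc /sexc; case: (n %% 6)%N => [|[|[|[|]]]].
(* At most one adjacent pair gives at most [16 + 3 * 3 = 25], three consecutive clusters at least
   [16 * 2 = 32]. *)
have [|l lE] := consec3 k5 Xr.
  have h3 := hd3 rn; rewrite s2 in h3 sX; 
  have [A1 [A2 [A3 [q [_ _ _ _ a5]]]]] := quads2_bounds h3.
  have [B1 [B2 [B3 [q' [b1 b2 b3 b4 b5]]]]] := quads2_bounds sX.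
  rewrite d3 in q; rewrite Xr in q' b3; move: qle q q' a5 b1 b3 b4 b5 d3s kk.
  move: #|succs [set a; ordS a; ordS (ordS a)]| #|succs (exc c)| (quads d) (quads c).
  by clear => sd sc qd qc; lia.
rewrite lE in sX; apply: (@except_canonical _ _ _ _ _ l sX) => i ik.
by rewrite rn; have [_ _ ->] := consec_mem l k3 ik.
Qed.

End ExtremalCanonical.

Lemma realalg_cbrt3 : exists2 t : realalg, 0 < t & t ^+ 3 = 3.
Proof.
have [||t /andP[t1 _]] := @poly_ivt realalg ('X^3 - 3%:P) 1 2; first by rewrite ler1n.
  by rewrite !hornerE; apply/andP; split; lra.
rewrite /root !hornerE subr_eq0 => /eqP tE; exists t => //.
exact: lt_le_trans t1.
Qed.

(** Some extremal graph exists on [V], and any extremal graph is a copy of the canonical one; a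
    graph with equally many even cycles is then extremal itself. *)
Lemma std_maximal : exists n0, forall n, (n0 <= n)%N ->
  (60 <= n)%N /\ forall (V : finType) (g : rel V), simple_graph g -> #|V| = n ->
    (nb_induced_even_cycles g <= nb_induced_even_cycles (blow (@std_col n (nclusters n))))%N /\
    (nb_induced_even_cycles g = nb_induced_even_cycles (blow (@std_col n (nclusters n))) ->
     graph_iso (blow (@std_col n (nclusters n))) g).
Proof.
have [t t0 t3] := realalg_cbrt3; have [n1 hn1] := extremal_canonical t0 t3.
exists (n1 + 60)%N => n nn; have n60 : (60 <= n)%N by apply: leq_trans nn; rewrite leq_addl.
split=> // V g g_simple cV; have [k8 _] := nclusters_large n60.
have k3 : (3 <= nclusters n)%N by apply: leq_trans k8.
have isoP (e : rel V) : extremal e -> graph_iso (blow (@std_col n (nclusters n))) e.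
  move=> e_ext; have [|k [c [k5 eb can]]] := hn1 V e e_ext.
    by rewrite cV; apply: leq_trans nn; rewrite leq_addr.
  rewrite cV in can; have kE := canonical_sizes can cV (leq_trans (isT : (3 <= 5)%N) k5).
  subst k; apply: graph_iso_trans (_ : graph_iso (blow c) e); last first.
    exact: graph_iso_eq.
  apply: canonical_iso can (std_canonical _ _) _; first by apply: leq_trans k3.
  by rewrite cV card_std.
have [e e_ext] := extremal_exists V; have le_e := proj2 e_ext g g_simple.
rewrite (graph_iso_nb (isoP e e_ext)); split=> // E.
by apply: isoP; split=> // h h_simple; rewrite E; apply: (proj2 e_ext).
Qed.

Local Close Scope ring_scope.

Theorem theorem1p8 :
  exists n0 : nat, forall n : nat, n0 <= n ->
    (exists (V : finType) (e : rel V), is_E n e) /\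
    (forall (V : finType) (e : rel V), is_E n e ->
     forall (W : finType) (g : rel W), simple_graph g -> #|W| = n ->
       (nb_induced_even_cycles g = m_e n <-> graph_iso e g)).
Proof.
have [n0 hn0] := std_maximal; exists n0 => n /hn0[n60 maxK].
have [k8 _] := nclusters_large n60.
have k5 : 5 <= nclusters n by apply: leq_trans k8.
have k3 : 3 <= nclusters n by apply: leq_trans k8.
set K := blow _ in maxK; have canK := std_canonical n (leq_trans (isT : 0 < 3) k3).
have cK := card_std k3; have K_simple : simple_graph K := blow_simple _ k5.
have mE : m_e n = nb_induced_even_cycles K.
  apply/eqP; rewrite eqn_leq; apply/andP; split.
    by apply/bigmax_leqP => A A_simple; have [] := maxK _ _ A_simple (card_ord n).
  (* The maximum in [m_e] runs over graphs on ['I_n], so a copy of [K] has to be placed there. *)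
  have [|g iso] := @graph_transport _ 'I_n K; first by rewrite cK card_ord.
  pose A := [set z : 'I_n * 'I_n | g z.1 z.2].
  have isoA : graph_iso K (fun x y => (x, y) \in A).
    by apply: graph_iso_trans iso _; apply: graph_iso_eq => x y; rewrite inE.
  rewrite (graph_iso_nb isoA) /m_e.
  apply: (leq_bigmax_cond (F :=
    fun A : {set 'I_n * 'I_n} => nb_induced_even_cycles (fun x y => (x, y) \in A))).
  exact: graph_iso_simple isoA K_simple.
split; first by exists (std n (nclusters n)), K; apply: canonical_is_E.
move=> V e eE W g g_simple cW.
have isoK : graph_iso e K.
  have [k [c [k3' eb can]]] := is_E_canonical eE; case: eE => _ cV _.
  have kE := canonical_sizes can cV k3'; subst k.
  apply: graph_iso_trans (_ : graph_iso (blow c) K).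
    exact: graph_iso_eq.
  by apply: canonical_iso canK can _; rewrite cV cK.
rewrite mE; split=> [E|iso].
  by apply: graph_iso_trans isoK _; have [_] := maxK _ _ g_simple cW; apply.
by rewrite -(graph_iso_nb isoK) (graph_iso_nb iso).
Qed.
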